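(* There is an algorithm that, given a set system $(E, \mathcal{P})$ with the weak max-flow/min-cut property, accessed via a separation oracle for $Y_{\mathcal{P}}$, and vectors $\rho, \mu \in [0,1]^E$ such that $\sum_{e \in P} \rho_e \ge \pi_P := 1 - \sum_{e \in P}\mu_e$ for all $P \in \mathcal{P}$, returns a feasible decomposition of $\rho$ for $(E,\mathcal{P},\pi)$ in time polynomial in $T_Y$, $|E|$, and the encoding sizes of $\mu$ and $\rho$, where $T_Y$ denotes the time for one call to the separation oracle.
   Context: $E$ is a finite set and $\mathcal{P} \subseteq 2^E$. $Y_{\mathcal{P}} := \{y \in \mathbb{R}_+^E : \sum_{e \in P} y_e \ge 1 \ \forall P \in \mathcal{P}\}$; $(E,\mathcal{P})$ has the weak max-flow/min-cut property if $Y_{\mathcal{P}}$ is integral. A separation oracle for $Y_{\mathcal{P}}$ is given $y \in \mathbb{R}^E$ and either asserts $y \in Y_{\mathcal{P}}$ or returns a hyperplane separating $y$ from $Y_{\mathcal{P}}$. For $\rho \in [0,1]^E$ and $\pi \in [0,1]^{\mathcal{P}}$, a feasible decomposition of $\rho$ for $(E,\mathcal{P},\pi)$ is a vector $x \in \mathbb{R}^{2^E}$ with $x_S \ge 0$ for all $S\subseteq E$, $\sum_{S} x_S = 1$, $\sum_{S : e \in S} x_S = \rho_e$ for all $e \in E$, and $\sum_{S : S \cap P \ne \emptyset} x_S \ge \pi_P$ for all $P \in \mathcal{P}$ (returned as the list of its nonzero entries). *)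

(* Defs.v *)
From HB Require Import structures.
From mathcomp Require Import all_boot all_order all_algebra.
From mathcomp Require Import reals.

Set Implicit Arguments.
Unset Strict Implicit.
Unset Printing Implicit Defensive.

Import Order.TTheory GRing.Theory Num.Theory.

Local Open Scope ring_scope.

(** * Set systems and decompositions *)

Definition in_Y (F : realFieldType) (E : finType) (PP : {set {set E}})
    (y : {ffun E -> F}) : Prop :=
  (forall e, 0 <= y e) /\ (forall P, P \in PP -> 1 <= \sum_(e in P) y e).

Definition extreme_point (F : realFieldType) (E : finType)
    (Y : {ffun E -> F} -> Prop) (y : {ffun E -> F}) : Prop :=
  Y y /\ forall (u v : {ffun E -> F}) (t : F), Y u -> Y v -> 0 < t < 1 ->
           (forall e, y e = t * u e + (1 - t) * v e) -> u = v.

(** [Y_PP] lies in the nonnegative orthant, hence is pointed: it is an integral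
    polyhedron when all its extreme points have integer coordinates. *)
Definition weak_mfmc (R : realType) (E : finType) (PP : {set {set E}}) : Prop :=
  forall y : {ffun E -> R},
    extreme_point (in_Y PP) y -> forall e, y e \is a Num.int.

Definition feasible_decomposition (F : realFieldType) (E : finType)
    (PP : {set {set E}}) (rho : {ffun E -> F}) (ppi : {set E} -> F)
    (x : {ffun {set E} -> F}) : Prop :=
  [/\ forall S, 0 <= x S,
      \sum_S x S = 1,
      forall e, \sum_(S : {set E} | e \in S) x S = rho e
    & forall P, P \in PP ->
        ppi P <= \sum_(S : {set E} | S :&: P != set0) x S].

(** * Encodings *)

(** Binary length of [z] with its sign: 1 + ceil (log2 (|z| + 1)). *)
Definition isize (z : int) : nat := (up_log 2 `|z|.+1).+1.

Definition encsize (s : seq int) : nat := (\sum_(z <- s) isize z)%N.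

Definition enc_rat (q : rat) : seq int := [:: numq q; denq q].

Definition enc_vec (E : finType) (y : {ffun E -> rat}) : seq int :=
  flatten [seq enc_rat (y e) | e <- enum E].

Definition vsize (E : finType) (y : {ffun E -> rat}) : nat :=
  encsize (enc_vec y).

(** * Separation oracles *)

(** [None] asserts membership; [Some (a, b)] is the hyperplane [a . z = b]. *)
Definition sep_answer (E : finType) : Type :=
  option ({ffun E -> rat} * rat).

Definition enc_answer (E : finType) (r : sep_answer E) : seq int :=
  match r with
  | None => [:: 0]
  | Some (a, b) => 1 :: enc_rat b ++ enc_vec a
  end.

(** [otime y] is the time the oracle spends on the query [y]. *)
Record oracle (E : finType) := Oracle {
  oanswer : {ffun E -> rat} -> sep_answer E;
  otime : {ffun E -> rat} -> nat
}.

(** A hyperplane is oriented so that [y] is strictly on its negative side and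
    [Y_PP] on its closed nonnegative side. The last clause says that writing
    down the answer is part of the time of the call. *)
Definition separation_oracle (R : realType) (E : finType)
    (PP : {set {set E}}) (O : oracle E) : Prop :=
  forall y : {ffun E -> rat},
    match oanswer O y with
    | None => in_Y PP [ffun e => ratr (y e) : R]
    | Some (a, b) =>
        [/\ a != 0,
            \sum_e a e * y e < b
          & forall z : {ffun E -> R}, in_Y PP z ->
              ratr b <= \sum_e ratr (a e) * z e]
    end /\ (encsize (enc_answer (oanswer O y)) <= otime O y)%N.

(** * Random access machine programs with logarithmic cost *)

Definition memory : Type := nat -> int.

Inductive binop := Add | Sub | Mul | Div.

(** [Fetch a] is the content of the cell whose address is the absolute value of
    [a]. *)
Inductive expr :=
  | Lit of int
  | Fetch of expr
  | Bin of binop & expr & expr.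

(** [Store a v] writes [v] into cell [a]; [If] and [While] test whether their
    guard is positive; [Query a r] submits the vector stored from cell [a] on
    to the oracle and has the answer written from cell [r] on. *)
Inductive prog :=
  | Skip
  | Store of expr & expr
  | Seq of prog & prog
  | If of expr & prog & prog
  | While of expr & prog
  | Query of expr & expr.

Definition eval_binop (o : binop) (x y : int) : int :=
  match o with
  | Add => x + y
  | Sub => x - y
  | Mul => x * y
  | Div => (x %/ y)%Z
  end.

Fixpoint eval (m : memory) (a : expr) : int :=
  match a with
  | Lit z => z
  | Fetch a => m `|eval m a|%N
  | Bin o a b => eval_binop o (eval m a) (eval m b)
  end.

(** Every elementary operation is charged the binary lengths of its operands
    (addresses included) and of its result. *)
Fixpoint eval_cost (m : memory) (a : expr) : nat :=
  match a with
  | Lit z => isize z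
  | Fetch b => (eval_cost m b + isize (eval m b) + isize (eval m a))%N
  | Bin _ b c => (eval_cost m b + eval_cost m c + isize (eval m b)
                  + isize (eval m c) + isize (eval m a))%N
  end.

Definition write (m : memory) (a : nat) (s : seq int) : memory :=
  fun i => if (a <= i < a + size s)%N then nth 0 s (i - a) else m i.

Definition block_cost (m : memory) (a k : nat) : nat :=
  (\sum_(a <= i < a + k) (isize i + isize (m i)))%N.

(** A rational is stored as a numerator and a denominator, not necessarily
    coprime, in two consecutive cells; a vector (a set) stores the rational
    (the membership bit) of its elements in the order of [enum E]. *)
Definition rat_at (m : memory) (a : nat) : rat := (m a)%:~R / (m a.+1)%:~R.

Definition vec_at (E : finType) (m : memory) (a : nat) : {ffun E -> rat} :=
  [ffun e => rat_at m (a + 2 * enum_rank e)%N].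

Definition set_at (E : finType) (m : memory) (a : nat) : {set E} :=
  [set e | m (a + enum_rank e)%N != 0].

(** [exec O c m m' t]: started on [m], with oracle [O], the program [c] halts
    with memory [m'] after time [t], oracle calls included. *)
Inductive exec (E : finType) (O : oracle E) :
    prog -> memory -> memory -> nat -> Prop :=
  | exec_skip m : exec O Skip m m 1
  | exec_store a v m :
      exec O (Store a v) m (write m `|eval m a|%N [:: eval m v])
        (1 + eval_cost m a + eval_cost m v
           + isize (eval m a) + isize (eval m v))%N
  | exec_seq c d m m' m'' t t' :
      exec O c m m' t -> exec O d m' m'' t' ->
      exec O (Seq c d) m m'' (1 + t + t')%N
  | exec_if a c d m m' t :
      exec O (if 0 < eval m a then c else d) m m' t ->
      exec O (If a c d) m m' (1 + eval_cost m a + t)%N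
  | exec_while_done a c m :
      eval m a <= 0 ->
      exec O (While a c) m m (1 + eval_cost m a)%N
  | exec_while_step a c m m' m'' t t' :
      0 < eval m a ->
      exec O c m m' t -> exec O (While a c) m' m'' t' ->
      exec O (While a c) m m'' (1 + eval_cost m a + t + t')%N
  | exec_query a r m y s m' :
      y = vec_at E m `|eval m a|%N ->
      s = enc_answer (oanswer O y) ->
      m' = write m `|eval m r|%N s ->
      exec O (Query a r) m m'
        (1 + eval_cost m a + eval_cost m r
           + block_cost m `|eval m a|%N (2 * #|E|)
           + otime O y
           + block_cost m' `|eval m r|%N (size s))%N.

Definition input (E : finType) (rho mu : {ffun E -> rat}) : memory :=
  nth 0 (#|E|%:Z :: enc_vec rho ++ enc_vec mu).

(** Cell 0 holds the number of entries; each entry [(S, x_S)] takes up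
    [#|E| + 2] cells, [x_S] first. *)
Definition output (E : finType) (m : memory) : seq ({set E} * rat) :=
  [seq (set_at E m (1 + i * (#|E| + 2) + 2)%N,
        rat_at m (1 + i * (#|E| + 2))%N) | i <- iota 0 `|m 0%N|].

Definition nonzero_entries (E : finType) (x : {ffun {set E} -> rat}) :
    seq ({set E} * rat) :=
  [seq (A, x A) | A <- enum {set E} & x A != 0].

(* Main.v *)
(* Let C be the cone over Y_P in dimension n + 1. The vector w = (rho + mu, 1) lies in C,
   and the extreme rays of C are found by a walk: from a point of C, move within the null
   space of the rows (P in PP, or e in E) known to be tight until a new row gets tight. The
   length of a step is found by bisection with the oracle as a mere membership oracle, and
   the new row by self-reduction; scaled projections with determinantal denominators keep
   all numbers at polynomial size, so that no ellipsoid method is needed.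

   By the weak max-flow/min-cut property the support r of the extreme ray reached from w
   is a 0/1 vector of C which satisfies the rows tight at w with equality. Subtracting
   from w the largest multiple of r that keeps it in C makes a further independent row
   tight. After n + 1 rounds w is a sum of multiples of 0/1 vectors: weights x_S of sum 1,
   supported on sets that meet every P in PP and cover each e with weight at most
   rho_e + mu_e. Toggling e in sets of total weight |sum_{S : e in S} x_S - rho_e| then
   corrects the marginals, and the sets disjoint from P get weight at most mu(P). *)
Require Import Defs.
From HB Require Import structures.
From mathcomp Require Import all_boot all_order all_algebra.
From mathcomp Require Import reals.
From Stdlib Require Import FunctionalExtensionality.
From mathcomp Require Import zify ring.

Set Implicit Arguments.
Unset Strict Implicit.
Unset Printing Implicit Defensive.

Import Order.TTheory GRing.Theory Num.Theory.

Local Open Scope ring_scope.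

(** * Projections onto null spaces *)

(** An oracle may return any separating hyperplane, not necessarily a row of the system. So its
    answers are used as single bits, and a violated row has to be reconstructed from them. [TY]
    bounds the oracle time only for queries of a size fixed beforehand by [q], in terms of [#|E|]
    and the input. Hence all numbers submitted must be bounded without reference to [TY], whereas
    answers are limited by the oracle time only. This is why two bounds run through the proof: [b]
    for the numbers computed, [B] for everything stored. The cone is unbounded, so a walk inside it
    might never get stuck. The first row of every matrix is therefore all ones: directions in its
    null space have coordinate sum 0, hence a negative coordinate, and every step ends. Integrality
    is used only when a walk has ended. The ray is then replaced by its support, which treats the
    rays with last coordinate 0, the recession directions of [Y_PP], like the others; they are
    recorded with mass 0. *)

Section Projection.
Variable N : nat.

(* [A / D] is the orthogonal projection onto the null space of [M]. *)
Definition projm k (M : 'M[int]_(k, N)) (A : 'M[int]_N) (D : int) : Prop :=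
  [/\ D = \det (M *m M^T), A = D%:M - M^T *m \adj (M *m M^T) *m M & 0 < D].

Lemma projm0 : projm (0 : 'M_(0, N)) 1%:M 1.
Proof. by split=> //; rewrite ?det_mx00 // mulmx0 subr0. Qed.

Section Facts.
Variables (k : nat) (M : 'M[int]_(k, N)) (A : 'M[int]_N) (D : int).
Hypothesis h : projm M A D.

Lemma projm_kill : M *m A = 0.
Proof.
case: h => hD -> _; rewrite mulmxBr !mulmxA mul_mx_adj -hD.
by rewrite mul_mx_scalar mul_scalar_mx subrr.
Qed.

Lemma projm_sym : A^T = A.
Proof.
case: h => hD -> _; rewrite linearB /= tr_scalar_mx !trmx_mul trmxK mulmxA.
by rewrite trmx_adj trmx_mul trmxK.
Qed.

Lemma projm_idem : A *m A = D *: A.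
Proof.
case: (h) => hD hA _; rewrite {1}hA mulmxBl mul_scalar_mx -!mulmxA projm_kill.
by rewrite !mulmx0 subr0.
Qed.

(** The trace of the projection [A / D] is the dimension of the null space. It yields a column with
    positive diagonal entry while [k < N], and shows that [A] vanishes for [k = N]. *)
Lemma projm_tr : \tr A = D * (N%:R - k%:R).
Proof.
case: (h) => hD -> _; rewrite raddfB /= mxtrace_scalar -mulmxA mxtrace_mulC.
rewrite -mulmxA mul_adj_mx -hD mxtrace_scalar mulrBr.
by rewrite !mulr_natr.
Qed.

Lemma projm_diag j : D * A j j = \sum_i A i j ^+ 2.
Proof.
have := congr1 (fun X : 'M_N => X j j) projm_idem; rewrite !mxE => <-.
by apply: eq_bigr => i _; rewrite expr2 -{1}projm_sym mxE.
Qed.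

Lemma projm_diag_ge0 j : 0 <= A j j.
Proof.
case: (h) => _ _ D0; rewrite -(pmulr_rge0 _ D0) projm_diag.
by apply: sumr_ge0 => i _; exact: sqr_ge0.
Qed.

Lemma projm_sqr_le i j : A i j ^+ 2 <= D * A j j.
Proof.
rewrite projm_diag (bigD1 i) //= lerDl.
by apply: sumr_ge0 => i' _; exact: sqr_ge0.
Qed.

(** By symmetry and idempotence [D * A j j] is the squared norm of column [j]. This bounds the
    diagonal by [D] and then every entry, so the size of [D] controls all matrices of the run. *)
Lemma projm_le i j : `|A i j| <= D.
Proof.
case: (h) => _ _ D0.
have hd l : A l l <= D.
  have h1 := projm_sqr_le l l; have h2 := projm_diag_ge0 l.
  case: (ltrP 0 (A l l)) => h3; last by apply: le_trans h3 (ltW D0).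
  by move: h1; rewrite expr2 ler_pM2r.
rewrite -(ler_pXn2r (n := 2)) // ?nnegrE ?(ltW D0) //.
rewrite real_normK ?num_real //; apply: le_trans (projm_sqr_le i j) _.
by rewrite expr2 ler_pM2l.
Qed.

Lemma projm_lt : (k < N)%N -> exists j, 0 < A j j.
Proof.
case: (h) => _ _ D0 kN.
have : 0 < \tr A by rewrite projm_tr pmulr_rgt0 // subr_gt0 ltr_nat.
case: (pickP (fun j => 0 < A j j)) => [j hj|h0]; first by exists j.
rewrite /mxtrace big1 ?ltxx // => j _.
by apply/eqP; rewrite eq_le projm_diag_ge0 leNgt h0.
Qed.

Lemma projm_full : k = N -> A = 0.
Proof.
case: (h) => _ _ D0 kN.
have t0 : \tr A = 0 by rewrite projm_tr kN subrr mulr0.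
have d0 j : A j j = 0.
  apply/eqP; rewrite eq_le projm_diag_ge0 andbT -t0 /mxtrace (bigD1 j) //=.
  by rewrite lerDl sumr_ge0 // => i _; exact: projm_diag_ge0.
apply/matrixP => i j; rewrite mxE; apply/eqP; rewrite -sqrf_eq0.
by rewrite eq_le sqr_ge0 andbT; apply: le_trans (projm_sqr_le i j) _; rewrite d0 mulr0.
Qed.

Section Step.
Variable p : 'rV[int]_N.
Let s := (p *m A *m p^T) 0 0.
Let y := A *m p^T.

Lemma projm_s_gt0 : y != 0 -> 0 < s.
Proof.
move=> y0; case: (h) => _ _ D0; rewrite -(pmulr_rgt0 _ D0).
have -> : D * s = (y^T *m y) 0 0.
  rewrite /y trmx_mul trmxK projm_sym !mulmxA -(mulmxA p A A) projm_idem.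
  by rewrite -scalemxAr -scalemxAl mxE.
rewrite mxE lt0r sumr_ge0 ?andbT; last by move=> i _; rewrite mxE -expr2 sqr_ge0.
apply: contra y0 => /eqP hs; apply/eqP/matrixP => i j; rewrite ord1 [RHS]mxE.
have hn l : true -> 0 <= (y^T) 0 l * y l 0 by move=> _; rewrite mxE -expr2 sqr_ge0.
have /eqP := @psumr_eq0P _ _ xpredT _ hn hs i isT.
by rewrite mxE -expr2 sqrf_eq0 => /eqP.
Qed.

Let M2 := col_mx M p.

(** A Schur complement without division: multiplication by [U] clears the upper right block of the
    Gram matrix and leaves [M *m M^T] and [s] on the diagonal, while [\det U = D] cancels against
    the determinant of the first block. *)
Lemma det_gram_step : \det (M2 *m M2^T) = s.
Proof.
case: (h) => hD hA D0; have Dn0 : D != 0 by rewrite gt_eqF.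
apply: (mulIf Dn0).
pose U : 'M[int]_(k + 1) :=
  block_mx 1%:M (- (\adj (M *m M^T) *m (M *m p^T))) 0 D%:M.
have dU : \det U = D by rewrite det_ublock det1 mul1r det_scalar1.
rewrite -{1}dU -det_mulmx /M2 tr_col_mx mul_col_row mulmx_block.
rewrite !mulmx1 !mulmx0 !addr0 !mulmxN mulmxA mul_mx_adj -hD.
rewrite mul_scalar_mx mul_mx_scalar addNr det_lblock -hD mulrC; congr (_ * _).
rewrite det_mx11 /s hA mulmxBr mulmxBl; congr (fun_of_matrix _ 0 0).
rewrite addrC; congr (_ + _); last by rewrite !mulmxA.
by rewrite !mul_mx_scalar -scalemxAl.
Qed.

(** Both [X] and [D] times the new matrix are annihilated by [M2], and both differ from [s * D]
    times the identity by some [M2^T *m Z]. Their difference is thus orthogonal to the rows of [M2]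
    and in their span, hence 0. That the division by [D] leaves no remainder is a consequence. *)
Lemma projm_step : y != 0 ->
  projm M2 (\matrix_(i, j) ((s * A i j - y i ord0 * y j ord0) %/ D)%Z) s.
Proof.
move=> y0; have s0 := projm_s_gt0 y0; case: (h) => hD hA D0.
have Dn0 : D != 0 by rewrite gt_eqF.
split=> //; first by rewrite det_gram_step.
set A2 := s%:M - _; pose X := s *: A - y *m y^T.
suff hX : X = D *: A2.
  apply/matrixP => i j; rewrite mxE.
  have -> : s * A i j - y i ord0 * y j ord0 = X i j.
    by rewrite !mxE big_ord1 !mxE.
  by rewrite hX mxE mulrC mulzK.
have yT : y^T = p *m A by rewrite /y trmx_mul trmxK projm_sym.
have ey : y = M2^T *m col_mx (- (\adj (M *m M^T) *m M *m p^T)) D%:M.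
  rewrite /M2 tr_col_mx mul_row_col mulmxN !mulmxA mul_mx_scalar addrC /y hA.
  by rewrite mulmxBl mul_scalar_mx.
have MX : M2 *m X = 0.
  rewrite /M2 mul_col_mx /X !mulmxBr -!scalemxAr projm_kill scaler0 sub0r.
  rewrite !mulmxA projm_kill !mul0mx oppr0.
  have -> : p *m A *m p^T = s%:M by rewrite [LHS]mx11_scalar.
  by rewrite yT mul_scalar_mx subrr col_mx0.
have MA2 : M2 *m (D *: A2) = 0.
  rewrite -scalemxAr mulmxBr !mulmxA mul_mx_adj det_gram_step.
  by rewrite mul_mx_scalar mul_scalar_mx subrr scaler0.
have [Z hZ] : exists Z, X - D *: A2 = M2^T *m Z.
  pose c := col_mx (- (\adj (M *m M^T) *m M *m p^T)) D%:M.
  pose e := col_mx (\adj (M *m M^T) *m M) 0 : 'M[int]_(k + 1, N).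
  exists (- (s *: e) - c *m y^T + D *: (\adj (M2 *m M2^T) *m M2)).
  rewrite !mulmxDr !mulmxN mulmxA -ey -!scalemxAr.
  have -> : M2^T *m e = M^T *m \adj (M *m M^T) *m M.
    by rewrite /M2 /e tr_col_mx mul_row_col mulmx0 addr0 mulmxA.
  rewrite /X /A2 {1}hA !scalerBr !mulmxA opprB !scale_scalar_mx (mulrC D s).
  set u := (s * D)%:M; set v := s *: _; set w := y *m y^T; set x := D *: _.
  by rewrite [LHS]addrC -!addrA addKr addrC addrA.
have : M2 *m (X - D *: A2) = 0 by rewrite mulmxBr MX MA2 subrr.
rewrite hZ mulmxA => hG.
have := congr1 (mulmx (\adj (M2 *m M2^T))) hG.
rewrite mulmxA mul_adj_mx det_gram_step mulmx0 mul_scalar_mx => /eqP.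
rewrite scalemx_eq0 gt_eqF //= => /eqP Z0.
by apply/eqP; rewrite -subr_eq0 hZ Z0 mulmx0.
Qed.
End Step.
End Facts.
End Projection.

(** * Bit lengths and costs of expressions *)

Lemma isize_gt0 z : (0 < isize z)%N.
Proof. by []. Qed.

Lemma isize_pow z b : (`|z| < 2 ^ b)%N -> (isize z <= b.+1)%N.
Proof. by move=> h; rewrite /isize ltnS; apply: up_log_min. Qed.

Lemma pow_isize z : (`|z| < 2 ^ (isize z).-1)%N.
Proof. by rewrite /isize /=; apply: up_logP. Qed.

(** The shifted product bound holds for sums, differences, products and quotients alike, so one
    argument serves all four operations. *)
Lemma isize_mulS (z x y : int) :
  (`|z|.+1 <= `|x|.+1 * `|y|.+1)%N -> (isize z <= isize x + isize y)%N.
Proof.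
move=> h; rewrite {1}/isize addSn ltnS; apply: up_log_min => //.
rewrite expnD; apply: leq_trans h _; apply: leq_mul; first exact: up_logP.
by apply: (leq_trans (up_logP `|y|.+1 (isT : 1 < 2)%N)); rewrite leq_exp2l.
Qed.

Lemma isize_binop o (x y : int) :
  (isize (eval_binop o x y) <= isize x + isize y)%N.
Proof.
apply: isize_mulS; case: o => /=; [nia|nia|by rewrite abszM; nia|].
by have := lez_div x y; nia.
Qed.

Definition nelts (E : finType) : nat := #|E|.

Lemma enc_vec_size (E : finType) (y : {ffun E -> rat}) :
  size (enc_vec y) = (2 * nelts E)%N.
Proof.
rewrite /enc_vec size_flatten /shape -map_comp /nelts cardE.
by elim: (enum E) => //= e s ->; rewrite mulnS.
Qed.

(* Exceeds [pbound decompP]. *)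
Definition kmax : nat := 2600.

(** Bit length of the value in units of [B], for a memory whose cells have at most [B] bits; a fetch
    counts 1 whatever its address is. *)
Fixpoint vbound (a : expr) : nat :=
  match a with
  | Lit z => isize z
  | Fetch a => 1
  | Bin _ a b => (vbound a + vbound b)%N
  end.

Fixpoint cbound (a : expr) : nat :=
  match a with
  | Lit z => isize z
  | Fetch a => (cbound a + vbound a + 1)%N
  | Bin _ a b => (cbound a + cbound b + (vbound a + vbound b) * 2)%N
  end.

(** Cost of the dearest single instruction or guard in units of [B]; once it is at most [kmax <= B],
    each of them costs at most [B ^ 2]. For a query only the address expressions are counted,
    because the rest of its cost depends on the vectors and the oracle. *)
Fixpoint pbound (c : prog) : nat :=
  match c with
  | Skip => 1
  | Store a v => (1 + cbound a + cbound v + vbound a + vbound v)%N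
  | Seq c d => maxn (pbound c) (pbound d)
  | If a c d => maxn (1 + cbound a) (maxn (pbound c) (pbound d))
  | While a c => maxn (1 + cbound a) (pbound c)
  | Query a r => (1 + cbound a + cbound r)%N
  end.

(* Time in units of [b ^ 2], when every loop makes at most [b] iterations. *)
Fixpoint kost (b : nat) (c : prog) : nat :=
  match c with
  | Skip => 1
  | Store _ _ => 1
  | Seq c d => (1 + kost b c + kost b d)%N
  | If _ c d => (1 + kost b c + kost b d)%N
  | While _ c => (1 + (1 + kost b c) * b)%N
  | Query _ _ => 1
  end.

Section Bounded.
Variable B : nat.
Hypothesis B_gt0 : (0 < B)%N.
Variable m : memory.
Hypothesis mB : forall i, (isize (m i) <= B)%N.

Lemma vboundP a : (isize (eval m a) <= vbound a * B)%N.
Proof.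
elim: a => [z|a _|o a iha b ihb]; [exact: leq_pmulr| by rewrite mul1n; exact: mB|].
by apply: leq_trans (isize_binop _ _ _) _; rewrite mulnDl leq_add.
Qed.

Lemma cboundP a : (eval_cost m a <= cbound a * B)%N.
Proof.
elim: a => [z|a iha|o a iha b ihb]; first exact: leq_pmulr.
  have := vboundP a; have := mB `|eval m a|%N; rewrite [cbound _]/= [eval_cost _ _]/=.
  by rewrite !mulnDl mul1n; lia.
have ha := vboundP a; have hb := vboundP b; have hab := vboundP (Bin o a b).
rewrite (_ : eval_cost m (Bin o a b) = eval_cost m a + eval_cost m b +
  isize (eval m a) + isize (eval m b) + isize (eval m (Bin o a b)))%N //.
rewrite [cbound _]/= [vbound (Bin _ _ _)]/= in hab *.
by rewrite !(mulnDl, muln2) -!addnn !mulnDl in hab *; lia.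
Qed.
End Bounded.

(** * Programs over arrays *)

(* Array [k > 0] lives in the cells congruent to [k] modulo [nids] beyond a base
   address; array 0 is the memory below the base, which holds the input, the
   queries, the answers and the output. *)
Definition nids : nat := 40.
(** Room for the longest of input, queries, answers and output: the output has a counter and up to
    [2 * n + 1] entries of [n + 2] cells. *)
Definition base (n : nat) : nat := (2 * ((n + 2) * (n + 2)))%N.
Definition loc (n k i : nat) : nat :=
  if k == 0%N then i else (base n + (nids * i + k))%N.
(** Cell 0 is excluded: it holds [n], from which all addresses are computed, until the last
    instruction of the program overwrites it. *)
Definition valid (n k i : nat) : bool :=
  if k == 0%N then (0 < i < base n)%N else (k < nids)%N.

Lemma loc_inj n k k' i i' : valid n k i -> valid n k' i' ->
  (loc n k i == loc n k' i') = ((k == k') && (i == i')).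
Proof.
rewrite /loc /valid /nids.
have h (a b c d : nat) : (a < 40)%N -> (b < 40)%N ->
  (40 * c + a == 40 * d + b)%N = (a == b) && (c == d).
  by move=> ha hb; apply/idP/idP; lia.
by case: (k =P 0%N) => [->|/eqP k0]; case: (k' =P 0%N) => [->|/eqP k0'] // ha hb;
  [apply/idP/idP; lia | apply/idP/idP; lia | rewrite eqn_add2l h].
Qed.

Lemma loc_gt0 n k i : valid n k i -> (0 < loc n k i)%N.
Proof. by rewrite /loc /valid /base; case: (k =P 0%N); lia. Qed.

Definition nX : expr := Fetch (Lit 0).
Definition addx (a b : expr) := Bin Add a b.
Definition subx (a b : expr) := Bin Defs.Sub a b.
Definition mulx (a b : expr) := Bin Mul a b.
Definition divx (a b : expr) := Bin Div a b.
Definition adr (k : nat) (e : expr) : expr :=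
  if k == 0%N then e else
  addx (mulx (Lit 2) (mulx (addx nX (Lit 2)) (addx nX (Lit 2))))
       (addx (mulx (Lit nids) e) (Lit k)).
Definition ar (k : nat) (e : expr) : expr := Fetch (adr k e).
Definition sc (k : nat) : expr := ar k (Lit 0).
Definition aset (k : nat) (e v : expr) : prog := Store (adr k e) v.
Definition sset (k : nat) (v : expr) : prog := aset k (Lit 0) v.
Definition forl (k : nat) (b : expr) (c : prog) : prog :=
  Seq (sset k (Lit 0))
    (While (subx b (sc k)) (Seq c (sset k (addx (sc k) (Lit 1))))).

Lemma ev_lit m z : eval m (Lit z) = z. Proof. by []. Qed.
Lemma ev_add m a b : eval m (addx a b) = eval m a + eval m b. Proof. by []. Qed.
Lemma ev_sub m a b : eval m (subx a b) = eval m a - eval m b. Proof. by []. Qed.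
Lemma ev_mul m a b : eval m (mulx a b) = eval m a * eval m b. Proof. by []. Qed.
Lemma ev_div m a b : eval m (divx a b) = (eval m a %/ eval m b)%Z.
Proof. by []. Qed.
Definition evE := (ev_lit, ev_add, ev_sub, ev_mul, ev_div).

Declare Scope prog_scope.
Delimit Scope prog_scope with P.
Notation "# z" := (Lit z%Z) (at level 1, format "# z") : prog_scope.
Notation "a + b" := (addx a b) : prog_scope.
Notation "a - b" := (subx a b) : prog_scope.
Notation "a * b" := (mulx a b) : prog_scope.
Notation "a / b" := (divx a b) : prog_scope.
Notation "c ;; d" := (Seq c%P d%P) (at level 90, right associativity) : prog_scope.
Notation "k $[ i ]" := (ar k i%P) (at level 1, format "k $[ i ]") : prog_scope.
Notation "k @[ i ] ::= v" := (aset k i%P v%P) (at level 80) : prog_scope.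
Notation "k ::= v" := (sset k v%P) (at level 80) : prog_scope.

(* A vector [y] over [E] is stored as [u] with [y_e = u_e / u_n]. [vW] is the part of the
   input still to be decomposed, [vV] the point of the walk, [vD] the direction, [vU] the
   vector submitted to the oracle, [vP] the violated row, [vM / xD] and [vN / xE] the
   projections, [vB] and [vX] the bits and masses of the [xn] sets found so far, [vR] the
   marginals; masses and marginals have the common denominator [xL]. *)
Notation vW := 1%N (only parsing).
Notation vV := 2%N (only parsing).
Notation vU := 3%N (only parsing).
Notation vD := 4%N (only parsing).
Notation vP := 5%N (only parsing).
Notation vR := 6%N (only parsing).
Notation vM := 7%N (only parsing).
Notation vN := 8%N (only parsing).
Notation vY := 9%N (only parsing).
Notation vX := 10%N (only parsing).
Notation vB := 11%N (only parsing).
Notation xD := 12%N (only parsing).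
Notation xE := 13%N (only parsing).
Notation ii := 14%N (only parsing).
Notation jj := 15%N (only parsing).
Notation kk := 16%N (only parsing).
Notation qq := 17%N (only parsing).
Notation oo := 18%N (only parsing).
Notation xS := 19%N (only parsing).
Notation xB := 20%N (only parsing).
Notation xQ := 21%N (only parsing).
Notation xlo := 22%N (only parsing).
Notation xhi := 23%N (only parsing).
Notation xmid := 24%N (only parsing).
Notation xf := 25%N (only parsing).
Notation xi := 26%N (only parsing).
Notation xt := 27%N (only parsing).
Notation xg := 28%N (only parsing).
Notation xh := 29%N (only parsing).
Notation xs := 30%N (only parsing).
Notation xj := 31%N (only parsing).
Notation xn := 32%N (only parsing).
Notation xL := 33%N (only parsing).
Notation xc := 34%N (only parsing).
Notation xb := 35%N (only parsing).
Notation xm := 36%N (only parsing).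
Notation xo := 37%N (only parsing).
Notation xe := 38%N (only parsing).

(** * A program logic for correctness and running time *)

Section Machine.
Variables (R : realType) (E : finType) (PP : {set {set E}}) (O : oracle E).
Variables (B b : nat).
Local Notation n := (nelts E).
Hypothesis bB : (b < B)%N.
Hypothesis B_ge : (100 + kmax + 20 * n <= B)%N.

(** Numbers stored by the program stay below [2 ^ b], but the cells also hold the input and the
    answers of the oracle, whose length is limited only by the time of the call; hence the larger
    bound [B]. *)
Definition st (m : memory) : Prop :=
  m 0%N = n%:Z /\ forall i, (isize (m i) <= B)%N.

Definition get (m : memory) (k i : nat) : int := m (loc n k i).
Definition put (m : memory) (k i : nat) (v : int) : memory :=
  write m (loc n k i) [:: v].

Lemma writeE (m : memory) a v i :
  write m a [:: v] i = if i == a then v else m i.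
Proof.
rewrite /write /= addn1 ltnS -eqn_leq eq_sym.
by case: (i =P a) => [->|//]; rewrite subnn.
Qed.

Lemma getP m k i v k' i' : valid n k i -> valid n k' i' ->
  get (put m k i v) k' i' = if (k == k') && (i == i') then v else get m k' i'.
Proof. by move=> h h'; rewrite /get /put writeE eq_sym loc_inj. Qed.

Lemma st_put m k i v : st m -> valid n k i -> (`|v| < 2 ^ b)%N ->
  st (put m k i v).
Proof.
move=> [h0 hB] hv hb; split.
  by rewrite /put writeE; have := loc_gt0 hv; case: eqP => // <-.
move=> j; rewrite /put writeE; case: eqP => // _.
by apply: leq_trans (isize_pow hb) _.
Qed.

Lemma ev_n m : st m -> eval m nX = n%:Z.
Proof. by case. Qed.

Lemma ev_adr m k e (i : nat) : st m -> eval m e = i ->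
  eval m (adr k e) = loc n k i.
Proof.
move=> hs he; rewrite /adr /loc; case: eqP => // _.
by rewrite /= he (proj1 hs) /base !(PoszD, PoszM).
Qed.

Lemma ev_ar m k e (i : nat) : st m -> eval m e = i ->
  eval m (ar k e) = get m k i.
Proof. by move=> hs he; rewrite /ar /= (ev_adr k hs he). Qed.

Lemma ev_sc m k : st m -> eval m (sc k) = get m k 0.
Proof. by move=> hs; rewrite (ev_ar k hs (i := 0)). Qed.

Definition tick : nat := (B * B)%N.

(* The premise on [pbound] is discharged once, by computation on the final program. *)
Definition ht (c : prog) (m : memory) (Q : memory -> Prop) : Prop :=
  exists m', [/\ st m', Q m' &
    (pbound c <= kmax)%N -> exists2 t, exec O c m m' t & (t <= kost B c * tick)%N].

Lemma ht_conseq c m (Q Q' : memory -> Prop) :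
  ht c m Q -> (forall m', st m' -> Q m' -> Q' m') -> ht c m Q'.
Proof. by move=> [m' [h1 h2 h3]] h; exists m'; split=> //; exact: h. Qed.

Lemma ht_seq c d m Q :
  ht c m (fun m' => ht d m' Q) -> ht (Seq c d) m Q.
Proof.
move=> [m1 [h1 [m2 [h2 h3 h4]] h5]]; exists m2; split=> // /=.
rewrite geq_max => /andP[hc hd]; have [t e1 t1] := h5 hc; have [t' e2 t2] := h4 hd.
exists (1 + t + t')%N; first exact: exec_seq e1 e2.
by rewrite !mulnDl; rewrite /tick in t1 t2 *; nia.
Qed.

Lemma ht_skip m (Q : memory -> Prop) : st m -> Q m -> ht Skip m Q.
Proof.
move=> hs hQ; exists m; split=> // _; exists 1%N; first exact: exec_skip.
by rewrite /= mul1n /tick; nia.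
Qed.

Lemma ht_put m k e v (i : nat) (Q : memory -> Prop) :
  st m -> eval m e = i -> valid n k i -> (`|eval m v| < 2 ^ b)%N ->
  Q (put m k i (eval m v)) -> ht (aset k e v) m Q.
Proof.
move=> hs he hv hb hQ; exists (put m k i (eval m v)); split=> //.
  exact: st_put.
rewrite /= => hp.
exists (1 + eval_cost m (adr k e) + eval_cost m v
           + isize (eval m (adr k e)) + isize (eval m v))%N.
  have := exec_store O (adr k e) v m; rewrite (ev_adr k hs he) /put.
  by rewrite absz_nat.
have B0 : (0 < B)%N by lia.
have := cboundP B0 (proj2 hs) (adr k e); have := cboundP B0 (proj2 hs) v.
have := vboundP B0 (proj2 hs) (adr k e); have := vboundP B0 (proj2 hs) v.
by rewrite /tick mul1n => h1 h2 h3 h4; nia.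
Qed.

Lemma ht_if m g c d Q : st m ->
  (0 < eval m g -> ht c m Q) -> (eval m g <= 0 -> ht d m Q) ->
  ht (If g c d) m Q.
Proof.
move=> hs h1 h2.
have : ht (if 0 < eval m g then c else d) m Q by case: ltP.
move=> [m' [s' q' hp]]; exists m'; split=> //=; rewrite !geq_max => /and3P[p1 p2 p3].
have [|t et ht] := hp; first by case: ifP.
exists (1 + eval_cost m g + t)%N; first exact: exec_if.
have B0 : (0 < B)%N by lia.
have := cboundP B0 (proj2 hs) g => h3.
have h4 : (kost B (if (0 < eval m g)%R then c else d) <= kost B c + kost B d)%N.
  by case: ifP => _; lia.
have : (1 + eval_cost m g <= tick)%N by rewrite /tick; nia.
rewrite -(addnA 1%N (kost B c)) mulnDl mul1n => h5; apply: leq_add => //.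
by apply: leq_trans ht _; rewrite leq_mul2r h4 orbT.
Qed.

(** The index of [I] bounds the number of iterations left and need not equal it: the guard may fail
    early, as in the bisection, so the final index is arbitrary. *)
Lemma ht_while (I : nat -> memory -> Prop) g c m j :
  (j <= B)%N ->
  (forall m, st m -> I 0%N m -> eval m g <= 0) ->
  (forall i m, st m -> I i.+1 m -> 0 < eval m g -> ht c m (I i)) ->
  st m -> I j m -> ht (While g c) m (fun m' => eval m' g <= 0 /\ exists i, I i m').
Proof.
move=> jB I0 IS hs Ij.
suff [m' [h1 h2 h3]] : exists m', [/\ st m', eval m' g <= 0 /\ exists i, I i m' &
    (maxn (1 + cbound g) (pbound c) <= kmax)%N ->
    exists2 t, exec O (While g c) m m' t & (t <= (1 + (1 + kost B c) * j) * tick)%N].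
  exists m'; split=> // /h3 [t h4 h5]; exists t => //; apply: leq_trans h5 _.
  by rewrite leq_mul2r /= leq_add2l leq_mul2l jB !orbT.
have B0 : (0 < B)%N by lia.
have cost m0 : st m0 -> (1 + cbound g <= kmax)%N -> (1 + eval_cost m0 g <= tick)%N.
  by move=> hs0 p1; have := cboundP B0 (proj2 hs0) g; rewrite /tick; nia.
elim: j jB m hs Ij => [|j ih] jB m hs Ij.
  exists m; split=> //; first by split; [exact: I0|exists 0%N].
  rewrite geq_max => /andP[p1 p2]; exists (1 + eval_cost m g)%N.
    by apply: exec_while_done; exact: I0.
  by apply: leq_trans (cost _ hs p1) _; rewrite muln0 mul1n.
have [g0|g0] := lerP (eval m g) 0.
  exists m; split=> //; first by split=> //; exists j.+1.
  rewrite geq_max => /andP[p1 p2]; exists (1 + eval_cost m g)%N.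
    exact: exec_while_done.
  by apply: leq_trans (cost _ hs p1) _; rewrite mulnDl mul1n leq_addr.
have [m1 [s1 q1 hp1]] := IS _ _ hs Ij g0.
have [m2 [s2 q2 hp2]] := ih (ltnW jB) _ s1 q1.
exists m2; split=> // p; have [t2 e2 c2] := hp2 p.
move: p; rewrite geq_max => /andP[p1 p2]; have [t1 e1 c1] := hp1 p2.
exists (1 + eval_cost m g + t1 + t2)%N; first exact: exec_while_step e1 e2.
have h := cost _ hs p1; rewrite mulnS addnCA mulnDl (leq_add _ c2) //.
by rewrite mulnDl mul1n leq_add.
Qed.

Definition fr (ks : seq nat) (m m' : memory) : Prop :=
  forall k i, k \notin ks -> valid n k i -> get m' k i = get m k i.

Lemma fr_trans ks m m' m'' : fr ks m m' -> fr ks m' m'' -> fr ks m m''.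
Proof. by move=> h h' k i hk hi; rewrite h' // h. Qed.

Lemma fr_sub ks ks' m m' : {subset ks <= ks'} -> fr ks m m' -> fr ks' m m'.
Proof. by move=> s h k i hk hi; apply: h => //; apply: contra hk; apply: s. Qed.

Lemma fr_put ks m m' k i v : fr ks m m' -> valid n k i -> k \in ks ->
  fr ks m (put m' k i v).
Proof.
move=> h hv hk k' i' hk' hv'; rewrite getP //; case: eqP => [e|_] /=.
  by rewrite -e hk in hk'.
exact: h.
Qed.

Lemma valid0 k i : (0 < k < nids)%N -> valid n k i.
Proof. by rewrite /valid; case: k. Qed.

(** The bound [e] is evaluated anew before each iteration and the body is arbitrary. So the
    invariant has to determine the value of [e], and the body has to leave the counter intact. *)
Lemma ht_for (I : nat -> memory -> Prop) iv e c m (N : nat) (Q : memory -> Prop) :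
  st m -> (0 < iv < nids)%N -> (N <= B)%N -> (N < 2 ^ b)%N ->
  I 0%N (put m iv 0 0) ->
  (forall j m', st m' -> I j m' -> eval m' e = N) ->
  (forall j m', st m' -> (j < N)%N -> I j m' -> get m' iv 0 = j ->
    ht c m' (fun m'' => get m'' iv 0 = j /\ I j.+1 (put m'' iv 0 j.+1))) ->
  (forall m', st m' -> I N m' -> get m' iv 0 = N -> Q m') ->
  ht (forl iv e c) m Q.
Proof.
move=> hs hiv NB Nb I0 He Hc HQ; have v0 := valid0 0 hiv.
have b0 : (0 < 2 ^ b)%N by rewrite expn_gt0.
apply: ht_seq; apply: (ht_put hs (i := 0)) => //; rewrite [eval _ _]/=.
set J := fun j m' => (j <= N)%N /\ (I (N - j)%N m' /\ get m' iv 0 = (N - j)%N).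
have s1 : st (put m iv 0 0) by apply: st_put.
have h : ht (While (subx e (sc iv)) (Seq c (sset iv (addx (sc iv) (Lit 1)))))
   (put m iv 0 0)
   (fun m' => eval m' (subx e (sc iv)) <= 0 /\ exists i, J i m').
  apply: (ht_while NB) => // [m1 hs1 [_ [h1 h2]]|i m1 hs1 [hi [h1 h2]] hg|].
  - by rewrite !evE ev_sc // (He _ _ hs1 h1) h2 subn0 subrr.
  - apply: ht_seq; apply: ht_conseq; first by apply: (Hc _ _ hs1 _ h1 h2); lia.
    move=> m2 hs2 [h3 h4]; apply: (ht_put hs2 (i := 0)) => //.
      by rewrite !evE ev_sc // h3; lia.
    have e1 : eval m2 (addx (sc iv) (Lit 1)) = (N - i)%N.
      by rewrite !evE ev_sc // h3; lia.
    rewrite e1 /J; split; first exact: ltnW.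
    have e2 : (N - i)%N = (N - i.+1).+1 by lia.
    rewrite {1 2}e2; split=> //.
    by rewrite getP // !eqxx.
  - rewrite /J subnn; split=> //; split=> //.
    by rewrite getP // !eqxx.
apply: (ht_conseq h) => m' hs' [g0 [i [hi [h1 h2]]]].
have i0 : i = 0%N.
  by move: g0; rewrite !evE ev_sc // (He _ _ hs' h1) h2; lia.
by rewrite i0 subn0 in h1 h2; exact: HQ.
Qed.

(** In-place updates are covered: [e] may read array [k], where the first [j] new entries are
    already present, hence the description of [k] among the premises on [e]. *)
Lemma ht_map k iv bx ix e m (f : nat -> int) (N o : nat) (Q : memory -> Prop) :
  st m -> (0 < iv < nids)%N -> iv != k -> (N <= B)%N -> (N < 2 ^ b)%N ->
  (forall j, (j < N)%N -> valid n k (o + j)) ->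
  (forall m', st m' -> fr [:: k; iv] m m' -> eval m' bx = N) ->
  (forall j, (j < N)%N -> (`|f j| < 2 ^ b)%N) ->
  (forall j m', st m' -> (j < N)%N -> fr [:: k; iv] m m' ->
     (forall i, valid n k i ->
        get m' k i = if (o <= i < o + j)%N then f (i - o)%N else get m k i) ->
     get m' iv 0 = j -> eval m' ix = (o + j)%N /\ eval m' e = f j) ->
  (forall m', st m' -> fr [:: k; iv] m m' ->
     (forall i, valid n k i ->
        get m' k i = if (o <= i < o + N)%N then f (i - o)%N else get m k i) ->
     Q m') ->
  ht (forl iv bx (aset k ix e)) m Q.
Proof.
move=> hs hiv ivk NB Nb hv Hb fb He HQ; have v0 := valid0 0 hiv.
pose I j m' := fr [:: k; iv] m m' /\ forall i, valid n k i ->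
        get m' k i = if (o <= i < o + j)%N then f (i - o)%N else get m k i.
have ivin : iv \in [:: k; iv] by rewrite !inE eqxx orbT.
apply: (ht_for (I := I) (N := N)) => //.
- split=> [|i hi]; first by apply: fr_put.
  by rewrite getP // (negbTE ivk) addn0 leqNgt andNb.
- by move=> j m' hs' [h _]; exact: Hb.
- move=> j m' hs' jN [h1 h2] h3; have [e1 e2] := He _ _ hs' jN h1 h2 h3.
  have vj := hv _ jN.
  apply: (ht_put hs' e1) => //; first by rewrite e2 fb.
  have s2 : st (put m' k (o + j) (f j)) by apply: st_put => //; exact: fb.
  rewrite e2; split; first by rewrite getP // eq_sym (negbTE ivk).
  split; first by apply: fr_put => //; apply: fr_put => //; rewrite !inE eqxx.
  move=> i hi; rewrite !getP // eqxx (negbTE ivk) /= h2 // addnS ltnS.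
  case: (o + j =P i)%N => [<-|hne]; first by rewrite leq_addr leqnn addKn.
  by rewrite (_ : (o <= i < o + j) = (o <= i <= o + j))%N //; apply/idP/idP; lia.
- by move=> m' hs' [h1 h2] _; exact: HQ.
Qed.

Definition suml (k iv : nat) (bx e : expr) : prog :=
  Seq (sset k (Lit 0)) (forl iv bx (sset k (addx (sc k) e))).

Lemma ht_sum k iv bx e m (f : nat -> int) (N : nat) (Q : memory -> Prop) :
  st m -> (0 < iv < nids)%N -> (0 < k < nids)%N -> iv != k ->
  (N <= B)%N -> (N < 2 ^ b)%N ->
  (forall m', st m' -> fr [:: k; iv] m m' -> eval m' bx = N) ->
  (forall j, (j <= N)%N -> (`|(\sum_(i < j) f i)%R| < 2 ^ b)%N) ->
  (forall j m', st m' -> (j < N)%N -> fr [:: k; iv] m m' ->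
     get m' iv 0 = j -> eval m' e = f j) ->
  (forall m', st m' -> fr [:: k; iv] m m' -> get m' k 0 = \sum_(i < N) f i -> Q m') ->
  ht (suml k iv bx e) m Q.
Proof.
move=> hs hiv hk ivk NB Nb Hb fb He HQ.
have v0 := valid0 0 hiv; have k0 := valid0 0 hk.
have b0 : (0 < 2 ^ b)%N by rewrite expn_gt0.
apply: ht_seq; apply: (ht_put hs (i := 0)) => //; rewrite [eval _ _]/=.
have s1 : st (put m k 0 0) by apply: st_put.
pose I j m' := fr [:: k; iv] m m' /\ get m' k 0 = \sum_(i < j) f i.
have kin : k \in [:: k; iv] by rewrite !inE eqxx.
have ivin : iv \in [:: k; iv] by rewrite !inE eqxx orbT.
apply: (ht_for (I := I) (N := N)) => //.
- split; first by apply: fr_put => //; apply: fr_put.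
  by rewrite !getP // (negbTE ivk) !eqxx big_ord0.
- by move=> j m' hs' [h _]; exact: Hb.
- move=> j m' hs' jN [h1 h2] h3; have e1 := He _ _ hs' jN h1 h3.
  have e2 : eval m' (addx (sc k) e) = \sum_(i < j.+1) f i.
    by rewrite !evE ev_sc // e1 h2 big_ord_recr.
  apply: (ht_put hs' (i := 0)) => //; first by rewrite e2 fb.
  rewrite e2; split; first by rewrite getP // eq_sym (negbTE ivk).
  split; first by apply: fr_put => //; apply: fr_put.
  by rewrite !getP // (negbTE ivk) !eqxx.
- by move=> m' hs' [h1 h2] _; exact: HQ.
Qed.

(** Of an answer only the first cell is remembered, which tells membership from separation. The term
    [20 * n] in the bounds on [B] pays for moving query and answer between memory and oracle. *)
Lemma ht_query m a r Q : st m -> (0 < a)%N -> (a + 2 * n <= base n)%N ->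
  (0 < r)%N -> (r + 2 * n + 3 <= base n)%N ->
  (forall y, y = vec_at E m a -> (encsize (enc_answer (oanswer O y)) <= otime O y)%N /\
     (20 * n + otime O y + (100 + kmax) <= B)%N) ->
  (forall m', st m' -> fr [:: 0%N] m m' ->
     get m' 0 r = (oanswer O (vec_at E m a) != None)%:Z -> Q m') ->
  ht (Query (Lit a) (Lit r)) m Q.
Proof.
move=> hs a0 an r0 rn HO HQ; have [osz oB] := HO _ erefl.
set y := vec_at E m a in HQ osz oB *; set s := enc_answer (oanswer O y).
have s_le : (size s <= 2 * n + 3)%N.
  rewrite /s; case: (oanswer O y) => [[u v]|] /=; last by rewrite addn3.
  by rewrite enc_vec_size addn3.
have sB i : (isize (nth 0%R s i) <= B)%N.
  case: (ltnP i (size s)) => hi; last by rewrite nth_default // (_ : isize 0 = 1%N) //; lia.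
  apply: (@leq_trans (encsize s)); last by rewrite /s; lia.
  by rewrite /encsize (big_nth 0%R) big_mkord (bigD1 (Ordinal hi)) //= leq_addr.
have s0 : nth 0 s 0%N = (oanswer O y != None)%:Z.
  by rewrite /s; case: (oanswer O y) => [[u v]|].
have s_gt0 : (0 < size s)%N by rewrite /s; case: (oanswer O y) => [[u v]|].
pose m' := write m r s.
have m'B i : (isize (m' i) <= B)%N.
  by rewrite /m' /write; case: ifP => // _; exact: (proj2 hs).
have hs' : st m'.
  split=> //; rewrite /m' /write.
  by rewrite (_ : (r <= 0)%N = false) ?(proj1 hs) //; lia.
exists m'; split=> //.
  apply: HQ => //.
    move=> k i; rewrite inE /valid /get /loc => /negbTE-> _; rewrite /m' /write.
    by rewrite (_ : (_ < r + size s)%N = false) ?andbF //; lia.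
  rewrite /get /loc /= /m' /write leqnn /= subnn s0.
  by rewrite -[X in (X < _)%N]addn0 ltn_add2l s_gt0.
rewrite /= => hp.
have isz_small i : (i < base n)%N -> (isize i%:Z <= 5 * n + 10)%N.
  move=> hi; apply: leq_trans (_ : ((5 * n + 8).+1 <= _)%N); last by lia.
  apply: isize_pow; rewrite absz_nat; apply: leq_trans hi _.
  rewrite expnD (_ : 2 ^ 8 = 256)%N // expnM (_ : 2 ^ 5 = 32)%N //.
  rewrite /base; elim: {+}n => // k ih; rewrite expnS; nia.
have bc mm u l : (forall i, (isize (mm i) <= B)%N) -> (u + l <= base n)%N ->
   (block_cost mm u l <= l * (B + (5 * n + 10)))%N.
  move=> hmm hu; rewrite /block_cost.
  apply: (@leq_trans (\sum_(u <= i < u + l) (B + (5 * n + 10)))%N).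
    rewrite big_nat [X in (_ <= X)%N]big_nat; apply: leq_sum => i /andP[_ hi].
    by rewrite addnC; apply: leq_add => //; apply: isz_small; lia.
  by rewrite sum_nat_const_nat addKn.
eexists; first by apply: exec_query; reflexivity.
rewrite -/y -/s -/m' !absz_nat -/(nelts E).
have h1 := bc m a (2 * n)%N (proj2 hs) an.
have h2 : (block_cost m' r (size s) <= size s * (B + (5 * n + 10)))%N.
  by apply: bc => //; lia.
rewrite /tick !mul1n.
have h5 : ((2 * n + size s) * (B + (5 * n + 10)) <= (4 * n + 3) * (2 * B))%N.
  by apply: leq_mul; lia.
have h6 : ((8 * n + 6 + 1) * B <= B * B)%N by rewrite leq_mul2r; lia.
change (eval_cost m (Lit a)) with (isize a).
change (eval_cost m (Lit r)) with (isize r).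
have h7 : ((4 * n + 3) * (2 * B) = (8 * n + 6) * B)%N by lia.
move: h5 h6; rewrite h7 !mulnDl mul1n => h5 h6; lia.
Qed.

(** * Rows of the cone, maximal steps and violated rows *)

Definition dot (p u : nat -> int) : int := \sum_(i < n.+1) p i * u i.

(* The cone over [Y_PP]: the last coordinate homogenizes. *)
Definition conb (u : nat -> int) : bool :=
  [forall i : 'I_n.+1, 0 <= u i] &&
  [forall P in PP, u n <= \sum_(e in P) u (enum_rank e)].

(** Incidence vector of [P] with -1 in the homogenizing coordinate, so that [0 <= dot (rowP P) u] is
    the inequality of [P] in the cone. *)
Definition rowP (P : {set E}) (j : nat) : int :=
  if j == n then -1 else [exists e in P, (enum_rank e == j :> nat)]%:Z.

(** Only the entries up to [n] are prescribed, because a row found by the program is the content of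
    an array, which goes on with arbitrary values. *)
Definition isrow (p : nat -> int) : Prop :=
  (exists2 i, (i <= n)%N & forall j, (j <= n)%N -> p j = (j == i)%:Z) \/
  (exists2 P, P \in PP & forall j, (j <= n)%N -> p j = rowP P j).

Lemma sum_enum_rank (V : nmodType) (f : nat -> V) :
  \sum_(i < n) f i = \sum_(e : E) f (enum_rank e).
Proof. by rewrite (reindex enum_rank) //; exact/onW_bij/enum_rank_bij. Qed.

Lemma rowP_rank P e : rowP P (enum_rank e) = (e \in P)%:Z.
Proof.
rewrite /rowP ltn_eqF //; congr (nat_of_bool _)%:Z.
apply/existsP/idP => [[e' /andP[h /eqP/val_inj/enum_rank_inj <-]] //|h].
by exists e; rewrite h eqxx.
Qed.

Lemma rowP_sum (V : pzRingType) (f : nat -> V) P :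
  \sum_(i < n.+1) (rowP P i)%:~R * f i = \sum_(e in P) f (enum_rank e) - f n.
Proof.
rewrite big_ord_recr /= {2}/rowP eqxx mulN1r; congr (_ - _).
rewrite (sum_enum_rank (fun i => (rowP P i)%:~R * f i)) [RHS]big_mkcond /=.
by apply: eq_bigr => e _; rewrite rowP_rank; case: (e \in P); rewrite ?mul1r ?mul0r.
Qed.

Lemma delta_sum (V : pzRingType) (f : nat -> V) i : (i <= n)%N ->
  \sum_(j < n.+1) (j == i :> nat)%:R * f j = f i.
Proof.
move=> hi; rewrite (bigD1 (Ordinal (hi : (i < n.+1)%N))) //= eqxx mul1r.
by rewrite big1 ?addr0 // => j; rewrite -val_eqE /= => /negbTE->; rewrite mul0r.
Qed.

Lemma dot_rowP p u P : (forall j, (j <= n)%N -> p j = rowP P j) ->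
  dot p u = \sum_(e in P) u (enum_rank e) - u n.
Proof.
move=> hp; rewrite -rowP_sum /dot; apply: eq_bigr => i _.
by rewrite hp ?intz // -ltnS.
Qed.

Lemma dot_delta p u i : (i <= n)%N ->
  (forall j, (j <= n)%N -> p j = (j == i)%:Z) -> dot p u = u i.
Proof.
move=> hi hp; rewrite -[RHS](delta_sum _ hi) /dot; apply: eq_bigr => j _.
by rewrite hp ?natz // -ltnS.
Qed.

Lemma conbP u : reflect (forall p, isrow p -> 0 <= dot p u) (conb u).
Proof.
apply: (iffP andP) => [[/forallP h1 /forallP h2] p [[i hi hp]|[P hP hp]]|h].
- by rewrite (dot_delta _ hi hp) (h1 (Ordinal (hi : (i < n.+1)%N))).
- by rewrite (dot_rowP _ hp) subr_ge0; have := h2 P; rewrite hP.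
split.
  apply/forallP => i.
  have hi : (i <= n)%N by rewrite -ltnS.
  rewrite -(dot_delta (p := fun j => (j == i)%:Z) u hi) //.
  by apply: h; left; exists i.
apply/forallP => P; apply/implyP => hP.
rewrite -subr_ge0 -(dot_rowP (p := rowP P)) //.
by apply: h; right; exists P.
Qed.

Lemma conb_ge0 u i : conb u -> (i <= n)%N -> 0 <= u i.
Proof. by case/andP => /forallP h _ hi; exact: (h (Ordinal (hi : (i < n.+1)%N))). Qed.

Lemma eq_dotr p u u' : (forall i, (i <= n)%N -> u i = u' i) -> dot p u = dot p u'.
Proof. by move=> h; apply: eq_bigr => i _; rewrite h // -ltnS. Qed.

Lemma eq_dotl p p' u : (forall i, (i <= n)%N -> p i = p' i) -> dot p u = dot p' u.
Proof. by move=> h; apply: eq_bigr => i _; rewrite h // -ltnS. Qed.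

Lemma eq_conb u u' : (forall i, (i <= n)%N -> u i = u' i) -> conb u = conb u'.
Proof.
move=> h; have e p := eq_dotr p h.
by apply/conbP/conbP => h' p hp; [rewrite -e|rewrite e]; exact: h'.
Qed.

Lemma dot_lin p (a c : int) u v :
  dot p (fun i => a * u i + c * v i) = a * dot p u + c * dot p v.
Proof.
rewrite /dot !mulr_sumr -big_split; apply: eq_bigr => i _ /=; ring.
Qed.

Lemma isrow_le1 p i : isrow p -> (i <= n)%N -> `|p i| <= 1.
Proof.
move=> [[j hj hp]|[P hP hp]] hi; rewrite hp //; first by case: eqP.
by rewrite /rowP; case: eqP => // _; case: existsP.
Qed.

Lemma isrow_dot_le p d (X : nat) : isrow p ->
  (forall i, (i <= n)%N -> `|d i| <= X%:Z) -> `|dot p d| <= (n.+1 * X)%N%:Z.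
Proof.
move=> hp hd; apply: (le_trans (ler_norm_sum _ _ _)).
apply: (@le_trans _ _ (\sum_(i < n.+1) X%:Z)).
  apply: ler_sum => i _; have hi : (i <= n)%N by rewrite -ltnS.
  by rewrite normrM -[leRHS]mul1r ler_pM ?hd // isrow_le1.
by rewrite sumr_const card_ord -mulr_natl PoszM natz.
Qed.

(** Entries of rows are at most 1 in absolute value, and [|d i| <= d i ^ 2] for integers. This gives
    the program a bound for all rows at once, computed without absolute values. *)
Lemma isrow_dot_sqr p d : isrow p -> `|dot p d| <= \sum_(i < n.+1) d i * d i.
Proof.
move=> hp; apply: (le_trans (ler_norm_sum _ _ _)); apply: ler_sum => i _.
have hi : (i <= n)%N by rewrite -ltnS.
have := isrow_le1 hp hi; rewrite normrM => h; nia.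
Qed.

(* Two distinct fractions with denominators at most [X] differ by at least
   [1 / X ^ 2], so a violated row at [(lo + 1) / Q] is the first one hit. *)
Lemma maxstepP v d p (Q lo X : int) : conb v -> 0 <= lo -> X ^+ 2 < Q ->
  (forall p', isrow p' -> `|dot p' d| <= X) ->
  conb (fun i => Q * v i + lo * d i) -> isrow p ->
  dot p (fun i => Q * v i + (lo + 1) * d i) < 0 ->
  dot p d < 0 /\ conb (fun i => (- dot p d) * v i + dot p v * d i).
Proof.
move=> /conbP hv lo0 XQ hX /conbP hlo hp; rewrite dot_lin.
have Q0 : 0 < Q by apply: le_lt_trans XQ; exact: sqr_ge0.
have f0 := hv _ hp => hhi.
have pd0 : dot p d < 0 by nia.
split=> //; apply/conbP => p' hp'; rewrite dot_lin.
have := hlo _ hp'; rewrite dot_lin; have := hv _ hp'; have := hX _ hp'; have := hX _ hp.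
move: (dot p d) (dot p v) (dot p' d) (dot p' v) f0 hhi pd0 => a f a' f' f0 hhi a0.
move=> ha ha' f'0 h'; case: (lerP 0 a') => a'0; first by nia.
rewrite leNgt; apply/negP => hneg.
(* The row [p] is crossed before [(lo + 1) / Q] and [p'] not before [lo / Q]. If [p'] were hit
   first, [f / - a] would exceed [f' / - a'] by less than [1 / Q], against a gap of at least
   [1 / (a * a')]. *)
have h1 : Q * (f * - a' - - a * f') < a * a'.
  have h2 : (Q * f + (lo + 1) * a) * - a' < 0 by nia.
  have h3 : 0 <= (Q * f' + lo * a') * - a by nia.
  by nia.
have h4 : a * a' <= X ^+ 2 by rewrite expr2; nia.
have h5 : 1 <= f * - a' - - a * f' by lia.
by nia.
Qed.

(* Setting [y_e := 1] for one element after another, whenever this leaves [y] outside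
   [Y_PP], ends with a point whose other coordinates form a violated member of [PP]. *)
Lemma selfredP (u0 p : nat -> int) :
  let cur j i := if (i < j)%N then (if p i == 1 then u0 i else u0 n) else u0 i in
  (forall i, (i <= n)%N -> 0 <= u0 i) ->
  (forall i, (i < n)%N -> p i = 0 \/ p i = 1) -> p n = -1 ->
  ~~ conb (cur n) ->
  (forall j, (j < n)%N -> p j = 1 ->
     conb (fun i => if i == j then u0 n else cur j i)) ->
  isrow p /\ dot p u0 < 0.
Proof.
move=> cur u00 p01 pn nc hc.
have [P hP vP] : exists2 P, P \in PP & \sum_(e in P) cur n (enum_rank e) < u0 n.
  move: nc; rewrite negb_and; case/orP.
    move=> /forallPn[i]; rewrite -ltNge {1}/cur => h; exfalso; move: h.
    by have := u00 i (ltn_ord i); have := u00 n (leqnn n); do 2?case: ifP => _; lia.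
  move=> /forallPn[P]; rewrite negb_imply -ltNge => /andP[hP].
  by rewrite {2}/cur ltnn => h; exists P.
have c0 i : (i <= n)%N -> 0 <= cur n i.
  by move=> hi; rewrite /cur; have := u00 i hi; have := u00 n (leqnn n); do 2?case: ifP.
have inP e : e \in P -> p (enum_rank e) = 1.
  move=> eP; case: (p01 (enum_rank e)) => // pe; exfalso; move: vP.
  rewrite (bigD1 e) //= {1}/cur ltn_ord pe /= ltNge lerDl sumr_ge0 //.
  by move=> e' _; apply: c0; exact: ltnW.
(* Raising [e] at its turn made the point feasible. If [e] were not in [P], the point would have
   satisfied [P] even without this, and still at the end, as no coordinate in [P] is raised for
   good. *)
have Pin e : p (enum_rank e) = 1 -> e \in P.
  move=> pe; have := hc _ (ltn_ord (enum_rank e)) pe; case/andP => _ /forallP /(_ P).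
  rewrite hP /= gtn_eqF // => h.
  apply: contraLR vP => eP; rewrite -leNgt.
  apply: le_trans (_ : cur (enum_rank e) n <= _); first by rewrite /cur ltnNge ltnW.
  apply: le_trans h _; apply: ler_sum => e' e'P.
  rewrite (_ : (enum_rank e' == enum_rank e :> nat) = false); last first.
    by apply: contraNF eP => /eqP/val_inj/enum_rank_inj <-.
  by rewrite /cur inP //= ltn_ord; case: ifP.
have hp j : (j <= n)%N -> p j = rowP P j.
  rewrite leq_eqVlt => /orP[/eqP->|hj]; first by rewrite pn /rowP eqxx.
  have -> : j = enum_rank (enum_val (Ordinal hj)) by rewrite enum_valK.
  rewrite rowP_rank; case: (boolP (_ \in P)) => [/inP //|hn].
  by case: (p01 _ (ltn_ord (enum_rank (enum_val (Ordinal hj))))) => // /Pin; rewrite (negbTE hn).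
split; first by right; exists P.
rewrite (dot_rowP _ hp) subr_lt0; apply: le_lt_trans vP; apply: ler_sum => e eP.
by rewrite /cur ltn_ord inP.
Qed.

(** * The separation oracle as a membership oracle *)

Lemma in_Y_ratr (y : {ffun E -> rat}) :
  in_Y PP [ffun e => ratr (y e) : R] <-> in_Y PP y.
Proof.
split=> [[h1 h2]|[h1 h2]]; split.
- by move=> e; have := h1 e; rewrite ffunE ler0q.
- move=> P hP; have := h2 P hP; rewrite (eq_bigr (fun e => ratr (y e))) => [|e _].
    by rewrite -rmorph_sum -{1}(rmorph1 (ratr : rat -> R)) ler_rat.
  by rewrite ffunE.
- by move=> e; rewrite ffunE ler0q.
- move=> P hP; rewrite (eq_bigr (fun e => ratr (y e))) => [|e _].
    by rewrite -rmorph_sum -{1}(rmorph1 (ratr : rat -> R)) ler_rat; exact: h2.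
  by rewrite ffunE.
Qed.

(** A returned hyperplane serves only as a proof that [y] lies outside: [y] violates it strictly and
    no point of [Y_PP] does, so the two kinds of answers exclude each other. *)
Lemma oracle_in_Y y : separation_oracle R PP O ->
  reflect (in_Y PP y) (oanswer O y == None).
Proof.
move=> /(_ y) [h _]; case: (oanswer O y) h => [[a c] [_ h1 h2]|h]; last first.
  by apply: (iffP idP) => // _; apply/in_Y_ratr.
apply: (iffP idP) => // /in_Y_ratr /h2 h3; exfalso.
move: h3; rewrite (eq_bigr (fun e => ratr (a e * y e))) => [|e _]; last first.
  by rewrite ffunE rmorphM.
by rewrite -rmorph_sum ler_rat leNgt h1.
Qed.

Lemma conb_in_Y (u : nat -> int) : (forall i, (i <= n)%N -> 0 <= u i) -> 0 < u n ->
  conb u <-> in_Y PP [ffun e => (u (enum_rank e))%:~R / (u n)%:~R : rat].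
Proof.
move=> u0 un0; have un0' : 0 < (u n)%:~R :> rat by rewrite ltr0z.
have e1 (P : {set E}) : (1 <= \sum_(e in P)
   [ffun e => (u (enum_rank e))%:~R / (u n)%:~R : rat] e) =
   (u n <= \sum_(e in P) u (enum_rank e)).
  rewrite (eq_bigr (fun e => (u (enum_rank e))%:~R / (u n)%:~R)) => [|e _].
    by rewrite -mulr_suml ler_pdivlMr // mul1r -rmorph_sum /= ler_int.
  by rewrite ffunE.
split=> [hc|[_ h2]].
  split=> [e|P hP].
    by rewrite ffunE divr_ge0 ?ler0z // u0 // ltnW.
  by rewrite e1; case/andP: hc => _ /forallP /(_ P); rewrite hP.
apply/andP; split; first by apply/forallP => i; rewrite u0 // -ltnS.
by apply/forallP => P; apply/implyP => hP; rewrite -e1 h2.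
Qed.

(** At [u n = 0] there is no point [u / u n] to submit to the oracle; the inequalities of [PP] then
    follow from the signs. *)
Lemma conb_un0 u : (forall i, (i <= n)%N -> 0 <= u i) -> u n = 0 -> conb u.
Proof.
move=> u0 un; apply/andP; split; first by apply/forallP => i; rewrite u0 // -ltnS.
apply/forallP => P; apply/implyP => hP; rewrite un sumr_ge0 // => e _.
by rewrite u0 // ltnW.
Qed.

(** * Extreme rays *)

(** Besides tight rows a matrix may contain the all-ones row. It asks nothing of [v]: it fixes the
    scale of a ray and makes directions sum to 0. *)
Definition rowsat k (M : 'M[int]_(k, n.+1)) (v : nat -> int) : Prop :=
  forall l, exists p : nat -> int, (forall j, M l j = p j) /\
    ((forall j, (j <= n)%N -> p j = 1) \/ (isrow p /\ dot p v = 0)).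

Lemma isrow_real_ge0 p (z : {ffun E -> R}) : isrow p -> in_Y PP z ->
  forall x : nat -> R, x n = 1 -> (forall e, x (enum_rank e) = z e) ->
  0 <= \sum_(i < n.+1) (p i)%:~R * x i.
Proof.
move=> hp [h1 h2] x xn xe; case: hp => [[i hi hp]|[P hP hp]].
  rewrite (eq_bigr (fun j : 'I_n.+1 => (j == i :> nat)%:R * x j)).
    rewrite delta_sum //; move: hi; rewrite leq_eqVlt => /orP[/eqP->|hi].
      by rewrite xn.
    have -> : i = enum_rank (enum_val (Ordinal hi)) by rewrite enum_valK.
    by rewrite xe.
  by move=> j _; rewrite hp ?pmulrn // -ltnS.
rewrite (eq_bigr (fun i : 'I_n.+1 => (rowP P i)%:~R * x i)); last first.
  by move=> j _; rewrite hp // -ltnS.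
rewrite rowP_sum xn subr_ge0; apply: le_trans (h2 P hP) _.
by apply: ler_sum => e _; rewrite xe.
Qed.

(** If [y] lies between [u] and [u'], every tight row is tight at both. Scaling each homogenized
    point by the coordinate sum of the other makes the difference [X] vanish on the all-ones row
    too, so [X = 0] by full rank. The last coordinates, both 1, then give equal scales and
    [u = u']. *)
Lemma extreme_full (M : 'M[int]_(n.+1)) A D (v : nat -> int) :
  conb v -> 0 < v n -> projm M A D -> rowsat M v ->
  extreme_point (in_Y PP) [ffun e => (v (enum_rank e))%:~R / (v n)%:~R : R].
Proof.
move=> cv vn hM hr; set y := finfun _.
have vn0 : (v n)%:~R != 0 :> R by rewrite intr_eq0 gt_eqF.
have yE e : y e = (v (enum_rank e))%:~R / (v n)%:~R by rewrite ffunE.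
split.
  have v0 i : (i <= n)%N -> 0 <= v i by apply: conb_ge0.
  have /in_Y_ratr := (conb_in_Y v0 vn).1 cv.
  congr in_Y; apply/ffunP => e; rewrite !ffunE rmorphM fmorphV /=.
  by rewrite !ratr_int.
move=> u u' t hu hu' /andP[t0 t1] hy.
pose x (z : {ffun E -> R}) (i : nat) : R :=
  if insub i is Some j then z (enum_val (j : 'I_n)) else 1.
have xn z : x z n = 1 by rewrite /x insubF // ltnn.
have xe z e : x z (enum_rank e) = z e.
  by rewrite /x insubT // => hi; rewrite -[in RHS](enum_rankK e); congr (z (enum_val _)); apply: val_inj.
have xlin i : (i <= n)%N -> (v i)%:~R / (v n)%:~R = t * x u i + (1 - t) * x u' i.
  rewrite leq_eqVlt => /orP[/eqP->|hi]; first by rewrite !xn divff //; ring.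
  have -> : i = enum_rank (enum_val (Ordinal hi)) by rewrite enum_valK.
  by rewrite !xe -hy yE.
have tight p : isrow p -> dot p v = 0 ->
   \sum_(i < n.+1) (p i)%:~R * x u i = 0 /\ \sum_(i < n.+1) (p i)%:~R * x u' i = 0.
  move=> hp pv.
  have h1 := isrow_real_ge0 hp hu (xn u) (xe u).
  have h2 := isrow_real_ge0 hp hu' (xn u') (xe u').
  have h3 : t * (\sum_(i < n.+1) (p i)%:~R * x u i) +
            (1 - t) * (\sum_(i < n.+1) (p i)%:~R * x u' i) = 0.
    rewrite !mulr_sumr -big_split /=.
    transitivity (\sum_(i < n.+1) (p i * v i)%:~R / (v n)%:~R : R).
      apply: eq_bigr => i _; rewrite intrM -mulrA xlin -1?ltnS //; ring.
    by rewrite -mulr_suml -rmorph_sum /= -/(dot p v) pv mul0r.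
  have t1' : 0 < 1 - t by rewrite subr_gt0.
  move/eqP: h3; rewrite paddr_eq0 ?mulr_ge0 // ?(ltW t0) ?(ltW t1') //.
  by rewrite !mulf_eq0 (gt_eqF t0) (gt_eqF t1') /= => /andP[/eqP-> /eqP->].
have sgt0 z : in_Y PP z -> 0 < \sum_(i < n.+1) x z i.
  move=> [hz _]; rewrite big_ord_recr /= xn (sum_enum_rank (x z)).
  by apply: ltr_wpDl => //; apply: sumr_ge0 => e _; rewrite xe.
have su := sgt0 _ hu; have su' := sgt0 _ hu'.
set S := \sum_(i < _) _ in su; set S' := \sum_(i < _) _ in su'.
pose X : 'cV[R]_(n.+1) := \col_i (S' * x u i - S * x u' i).
pose fM := map_mx (intr : int -> R) M.
have MX : fM *m X = 0.
  apply/matrixP => l j; rewrite !mxE; have [p [hp hp']] := hr l.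
  transitivity (S' * (\sum_(i < n.+1) (p i)%:~R * x u i) -
                S * (\sum_(i < n.+1) (p i)%:~R * x u' i)).
    rewrite !mulr_sumr -sumrB; apply: eq_bigr => i _; rewrite !mxE hp; ring.
  case: hp' => [h1|[h1 h2]]; last first.
    by have [-> ->] := tight _ h1 h2; rewrite !mulr0 subrr.
  have hh z : \sum_(i < n.+1) (p i)%:~R * x z i = \sum_(i < n.+1) x z i.
    by apply: eq_bigr => i _; rewrite h1 ?mul1r // -ltnS.
  by rewrite !hh -/S -/S' mulrC subrr.
have A0 := projm_full hM erefl; case: hM => hD hA D0.
have eD : D%:M = M^T *m \adj (M *m M^T) *m M.
  by apply/eqP; rewrite -subr_eq0 -hA A0.
have X0 : X = 0.
  have := congr1 (map_mx (intr : int -> R)) eD.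
  rewrite map_scalar_mx !map_mxM -/fM => h.
  have := congr1 (mulmx^~ X) h; rewrite -mulmxA MX mulmx0 mul_scalar_mx => /eqP.
  by rewrite scalemx_eq0 intr_eq0 gt_eqF //= => /eqP.
have SS : S = S'.
  have := congr1 (fun Z : 'cV[R]_(n.+1) => Z ord_max 0) X0.
  by rewrite !mxE /= !xn !mulr1 => /eqP; rewrite subr_eq0 => /eqP.
apply/ffunP => e.
have := congr1 (fun Z : 'cV[R]_(n.+1) => Z (widen_ord (leqnSn _) (enum_rank e)) 0) X0.
rewrite !mxE /= !xe SS -mulrBr => /eqP.
by rewrite mulf_eq0 gt_eqF //= subr_eq0 => /eqP.
Qed.

(** Takes the place of [v / v n]: a 0/1 vector by construction, and defined as well for rays with
    [v n = 0]. *)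
Definition supp (v : nat -> int) (i : nat) : int := (0 < v i)%R%:Z.

(** When [v n > 0], the inequality of [P] forces a positive coordinate of [v] in [P], and one such
    coordinate is all that the support needs. *)
Lemma conb_supp v : conb v -> conb (supp v).
Proof.
move=> hv; apply/andP; split; first by apply/forallP => i.
apply/forallP => P; apply/implyP => hP; rewrite {1}/supp.
case: (ltrP 0 (v n)) => vn; last by rewrite sumr_ge0.
case/andP: (hv) => _ /forallP /(_ P); rewrite hP /= => h.
case: (pickP (fun e => (e \in P) && (0 < v (enum_rank e)))) => [e /andP[eP ve]|h0].
  by rewrite (bigD1 e) //= {1}/supp ve lerDl sumr_ge0.
move: h; rewrite big1 => [|e eP]; first by rewrite leNgt vn.
have := h0 e; rewrite eP /= => /negbT; rewrite -leNgt => hle.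
by apply/eqP; rewrite eq_le hle conb_ge0 // ltnW.
Qed.

(* If [v n > 0] then [v / v n] is an extreme point of [Y_PP], hence integral, and exactly
   one of its coordinates in a tight member of [PP] is nonzero. *)
Lemma supp_tight (M : 'M[int]_(n.+1)) A D (v : nat -> int) :
  weak_mfmc R PP -> conb v -> projm M A D -> rowsat M v ->
  forall p, isrow p -> dot p v = 0 -> dot p (supp v) = 0.
Proof.
move=> hPP cv hM hr p [[i hi hp]|[P hP hp]].
  by rewrite !(dot_delta _ hi hp) /supp => ->; rewrite ltxx.
rewrite !(dot_rowP _ hp) => /eqP; rewrite subr_eq0 => /eqP hv.
have v0 (e : E) : 0 <= v (enum_rank e) by apply: (conb_ge0 cv); apply: ltnW; exact: ltn_ord.
have [vn|vn] := ltrP 0 (v n); last first.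
  have vn0 : v n = 0 by apply/eqP; rewrite eq_le vn conb_ge0.
  rewrite {2}/supp vn0 ltxx subr0 big1 // => e eP; rewrite /supp.
  have := psumr_eq0P (fun e (_ : e \in P) => v0 e) (etrans hv vn0) eP => ->.
  by rewrite ltxx.
have hint := hPP _ (extreme_full cv vn hM hr).
have hve e : e \in P -> v (enum_rank e) = v n * supp v (enum_rank e).
  move=> eP; have := hint e; rewrite ffunE => /intrP[z hz].
  have vn0 : (v n)%:~R != 0 :> R by rewrite intr_eq0 gt_eqF.
  have {hz} : v (enum_rank e) = z * v n.
    by apply: (@intr_inj R); rewrite intrM -hz divfK.
  have : v (enum_rank e) <= v n.
    by rewrite -hv (bigD1 e) //= lerDl sumr_ge0.
  rewrite /supp; have := v0 e; move: (v (enum_rank e)) (v n) vn => a c c0 a0 ac az.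
  case: (ltrP 0 a) => ha /=; last by lia.
  by have z1 : z = 1 by [nia]; rewrite az z1; lia.
apply/eqP; rewrite subr_eq0; apply/eqP; apply: (@mulfI _ (v n)).
  by rewrite gt_eqF.
have -> : supp v n = 1 by rewrite /supp vn.
rewrite mulr1 mulr_sumr -[RHS]hv; apply: eq_bigr => e eP.
by rewrite -hve.
Qed.

(** If [p] were in the row space of [M], then [dot p r] would be determined by [M *m r]. But
    [M *m r] and [M *m w] are proportional: tight rows vanish on both vectors, and the all-ones row
    gives the two coordinate sums. So [dot p w = 0] would force [dot p r = 0]. *)
Lemma indep_outer k (M : 'M[int]_(k, n.+1)) A D p (w r : nat -> int) :
  projm M A D -> rowsat M w ->
  dot p w = 0 -> dot p r != 0 -> 0 < \sum_(i < n.+1) w i ->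
  rowsat M r -> A *m (\row_(j < n.+1) p j)^T != 0.
Proof.
move=> [hD hA D0] hw pw pr sw hr; apply: contra pr => /eqP hp.
set P := (\row_j p j)^T in hp.
pose W (u : nat -> int) : 'cV[int]_(n.+1) := \col_j u j.
have pW u : (P^T *m W u) 0 0 = dot p u.
  by rewrite mxE; apply: eq_bigr => i _; rewrite !mxE.
have eP : D *: P^T = P^T *m M^T *m \adj (M *m M^T) *m M.
  move: hp; rewrite hA mulmxBl mul_scalar_mx => /eqP; rewrite subr_eq0 => /eqP.
  move=> /(congr1 trmx); rewrite linearZ /= => ->; rewrite !trmx_mul trmxK.
  by rewrite trmx_adj trmx_mul trmxK !mulmxA.
have hMW : (\sum_(i < n.+1) w i) *: (M *m W r) = (\sum_(i < n.+1) r i) *: (M *m W w).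
  apply/matrixP => l j; rewrite ord1 !mxE.
  have eM (u q : nat -> int) : (forall j, M l j = q j) -> \sum_j M l j * W u j 0 = dot q u.
    by move=> hq; apply: eq_bigr => i _; rewrite hq mxE.
  have [q [hq hq']] := hw l; have [q' [hq'' hq3]] := hr l.
  rewrite (eM r q) // (eM w q) //.
  case: hq' => [h1|[h1 h2]].
    have h0 u : dot q u = \sum_(i < n.+1) u i.
      by apply: eq_bigr => i _; rewrite h1 ?mul1r // -ltnS.
    by rewrite !h0 mulrC.
  case: hq3 => [h3|[h3 h4]].
    have e3 u : dot q u = \sum_(i < n.+1) u i.
      apply: eq_bigr => i _; have := hq i; rewrite hq'' h3 ?mul1r -1?ltnS // => <-.
      by rewrite mul1r.
    by move: h2; rewrite e3 => h2; rewrite h2 ltxx in sw.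
  have -> : dot q r = dot q' r.
    by apply: eq_bigr => i _; rewrite -hq -hq''.
  by rewrite h2 h4 !mulr0.
have h5 : (\sum_(i < n.+1) w i) * (D * dot p r) = (\sum_(i < n.+1) r i) * (D * dot p w).
  have hh u c : c * (D * dot p u) = (P^T *m M^T *m \adj (M *m M^T) *m (c *: (M *m W u))) 0 0.
    by rewrite -scalemxAr mxE mulmxA -eP -scalemxAl mxE pW.
  by rewrite !hh hMW.
move: h5; rewrite pw !mulr0 => /eqP; by rewrite !mulf_eq0 (gt_eqF sw) (gt_eqF D0).
Qed.

(** * Programs for membership, violated rows and maximal steps *)

(** [xf] is the membership bit; [xi] is one more than the index of a negative coordinate, or 0 if
    there is none, so that [violP] knows which kind of row is violated. The oracle is called only
    for nonnegative [u] with [u n > 0], and its answer overwrites the query. *)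
Definition testP : prog := (
  xi ::= #0 ;;
  forl ii (nX + #1)%P (If (#0 - vU $[ sc ii ])%P (xi ::= sc ii + #1) Skip) ;;
  xf ::= #1 ;;
  If (sc xi) (xf ::= #0)
    (If (vU $[ nX ])%P (
      forl ii nX (0%N @[ #1 + #2 * sc ii ] ::= vU $[ sc ii ] ;;
                  0%N @[ #2 + #2 * sc ii ] ::= vU $[ nX ]) ;;
      Query (Lit 1) (Lit 1) ;;
      xf ::= #1 - 0%N $[ #1 ]) Skip))%P.

Definition violP : prog := (
  If (sc xi) (
    forl ii (nX + #1) (vP @[ sc ii ] ::= #0) ;;
    vP @[ sc xi - #1 ] ::= #1) (
    forl kk nX (
      xt ::= vU $[ sc kk ] ;;
      vU @[ sc kk ] ::= vU $[ nX ] ;;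
      testP ;;
      If (sc xf) (vU @[ sc kk ] ::= sc xt ;; vP @[ sc kk ] ::= #1)
                 (vP @[ sc kk ] ::= #0)) ;;
    vP @[ nX ] ::= #0 - #1))%P.

Definition affP (v k : nat) : prog :=
  forl ii (nX + #1)%P
    (vU @[ sc ii ] ::= sc xQ * v $[ sc ii ] + sc k * vD $[ sc ii ])%P.

(** The final test at the infeasible end leaves [vU] and [xi] as [violP] expects them. *)
Definition bsearchP (v : nat) : prog := (
  While (sc xhi - sc xlo - #1) (
    xmid ::= (sc xlo + sc xhi) / #2 ;;
    affP v xmid ;;
    testP ;;
    If (sc xf) (xlo ::= sc xmid) (xhi ::= sc xmid)) ;;
  affP v xhi ;;
  testP)%P.

(** The exact step length is [xh / xg]; multiplying the point by [xg] keeps it integral, as only its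
    ray matters. *)
Definition moveP (v : nat) : prog := (
  suml xg ii (nX + #1) (vP $[ sc ii ] * vD $[ sc ii ]) ;;
  xg ::= #0 - sc xg ;;
  suml xh ii (nX + #1) (vP $[ sc ii ] * v $[ sc ii ]) ;;
  forl ii (nX + #1)
    (v @[ sc ii ] ::= sc xg * v $[ sc ii ] + sc xh * vD $[ sc ii ]))%P.

(** [xB] bounds [|dot p d|] for all rows, so [xQ] exceeds the square that [maxstepP] asks for. At
    step length [xhi / xQ = xS + 1] a coordinate in which the direction is negative has itself
    become negative. *)
Definition mstepP (v : nat) : prog := (
  suml xS ii (nX + #1) (v $[ sc ii ]) ;;
  suml xB ii (nX + #1) (vD $[ sc ii ] * vD $[ sc ii ]) ;;
  xQ ::= sc xB * sc xB + #1 ;;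
  xlo ::= #0 ;;
  xhi ::= (sc xS + #1) * sc xQ ;;
  bsearchP v ;;
  violP ;;
  moveP v)%P.

Ltac evs := rewrite ?evE; repeat match goal with
  | hs : st ?m |- context [eval ?m (sc ?k)] => rewrite (ev_sc k hs)
  | hs : st ?m |- context [eval ?m nX] => rewrite (ev_n hs)
  end.
Ltac frs := repeat match goal with
  | h : fr _ ?m ?m' |- context [get ?m' ?k ?i] =>
      rewrite (h k i); [|by []|by []]
  end.
Ltac fgets := repeat match goal with
  | |- context [get (put ?m ?k ?i ?v) ?k' ?i'] =>
      rewrite (@getP m k i v k' i'); [|by []|by []]; rewrite /=
  end.
Ltac arx j := match goal with
  | hs : st ?m |- context [eval ?m (ar ?k ?e)] =>
      rewrite (@ev_ar m k e j hs); [|evs; frs; try lia]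
  end.

Hypothesis b_ge : (2 * n + 4 < 2 ^ b)%N.
Hypothesis HO : separation_oracle R PP O.
Hypothesis Hq : forall y : {ffun E -> rat}, (vsize y <= 2 * n * b.+1)%N ->
  (20 * n + otime O y + (100 + kmax) <= B)%N.

Lemma ht_map0 k iv bx e m (f : nat -> int) (N : nat) (Q : memory -> Prop) :
  st m -> (0 < iv < nids)%N -> (0 < k < nids)%N -> iv != k -> (N <= B)%N ->
  (N < 2 ^ b)%N ->
  (forall m', st m' -> fr [:: k; iv] m m' -> eval m' bx = N) ->
  (forall j, (j < N)%N -> (`|f j| < 2 ^ b)%N) ->
  (forall j m', st m' -> (j < N)%N -> fr [:: k; iv] m m' ->
     (forall i, get m' k i = if (i < j)%N then f i else get m k i) ->
     get m' iv 0 = j -> eval m' e = f j) ->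
  (forall m', st m' -> fr [:: k; iv] m m' ->
     (forall i, get m' k i = if (i < N)%N then f i else get m k i) -> Q m') ->
  ht (forl iv bx (aset k (sc iv) e)) m Q.
Proof.
move=> hs hiv hk ivk NB Nb Hb fb He HQ; have hv i := valid0 i hk.
apply: (ht_map (f := f) (N := N) (o := 0) ) => // [j m' hs' jN h1 h2 h3|].
  split; first by rewrite (ev_sc _ hs').
  by apply: He => // i; rewrite h2 // subn0.
by move=> m' hs' h1 h2; apply: HQ => // i; rewrite h2 // subn0.
Qed.

Lemma ht_aset (i : nat) (w : int) k e v m Q :
  st m -> eval m e = i -> eval m v = w -> valid n k i -> (`|w| < 2 ^ b)%N ->
  (st (put m k i w) -> Q (put m k i w)) -> ht (aset k e v) m Q.
Proof.
move=> hs he <- hv hw hQ; apply: (ht_put hs he hv hw).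
by apply: hQ; apply: st_put.
Qed.

Lemma ht_sset (w : int) k v m Q :
  st m -> eval m v = w -> (0 < k < nids)%N -> (`|w| < 2 ^ b)%N ->
  (st (put m k 0 w) -> Q (put m k 0 w)) -> ht (sset k v) m Q.
Proof. by move=> hs hv hk; apply: (ht_aset (i := 0)) => //; apply: valid0. Qed.

(** The size of a query is that of fractions in lowest terms. The stored numerator and denominator
    are a common multiple, by [c], of the reduced ones, which are therefore not longer. *)
Lemma vsize_frac (num : E -> int) (den : int) (y : {ffun E -> rat}) :
  (forall e, `|num e| < 2 ^ b)%N -> 0 < den -> (`|den| < 2 ^ b)%N ->
  y = [ffun e => (num e)%:~R / den%:~R] -> (vsize y <= 2 * n * b.+1)%N.
Proof.
move=> hnum den0 hden ->; rewrite /vsize /encsize /enc_vec.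
rewrite big_flatten big_map big_enum /=.
apply: (@leq_trans (\sum_(e : E) 2 * b.+1)%N); last first.
  by rewrite sum_nat_const mulnCA mulnA.
apply: leq_sum => e _; rewrite ffunE !big_cons big_nil addn0 mul2n -addnn.
have [c c0 [hc1 hc2]] : exists2 c : int, c != 0 &
    num e = c * numq ((num e)%:~R / den%:~R) /\
    den = c * denq ((num e)%:~R / den%:~R).
  set x := (num e)%:~R / den%:~R.
  have dn0 : den%:~R != 0 :> rat by rewrite intr_eq0 gt_eqF.
  have hx : den * numq x = num e * denq x.
    apply: (@intr_inj rat); rewrite !intrM.
    have -> : (numq x)%:~R = x * (denq x)%:~R.
      by rewrite -{2}[x]divq_num_den divfK // intr_eq0 denq_neq0.
    by rewrite mulrA (mulrC den%:~R) divfK.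
  have /dvdzP[c hc] : (denq x %| den)%Z.
    rewrite -(@Gauss_dvdzl _ _ (numq x)); first by rewrite hx dvdz_mull.
    by rewrite coprimezE coprime_sym; exact: coprime_num_den.
  have c0 : c != 0 by apply: contraTneq den0 => c0; rewrite hc c0 mul0r ltxx.
  exists c => //; split=> //.
  apply: (mulIf (denq_neq0 x)); rewrite -hx hc; ring.
have cle (z w : int) : z = c * w -> (`|w| <= `|z|)%N.
  by move=> ->; rewrite abszM leq_pmull // absz_gt0.
apply: leq_add; apply: isize_pow.
  exact: leq_ltn_trans (cle _ _ hc1) (hnum e).
exact: leq_ltn_trans (cle _ _ hc2) hden.
Qed.

Lemma ht_test m u (Q : memory -> Prop) :
  st m -> (forall i, (i <= n)%N -> get m vU i = u i) ->
  (forall i, (i <= n)%N -> (`|u i| < 2 ^ b)%N) ->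
  (forall m', st m' -> fr [:: 0%N; ii; xf; xi] m m' ->
     get m' xf 0 = (conb u)%:Z ->
     (exists x : nat, get m' xi 0 = x /\
        if x is x'.+1 then (x' <= n)%N /\ u x' < 0
        else forall i, (i <= n)%N -> 0 <= u i) -> Q m') ->
  ht testP m Q.
Proof.
move=> hs hu ub HQ.
have b1 : (1 < 2 ^ b)%N by lia.
apply: ht_seq; apply: (ht_sset (w := 0)) => //; first by rewrite absz0; lia.
set m1 := put _ _ _ _ => s1.
have f1 : fr [:: 0%N; ii; xf; xi] m m1 by apply: fr_put.
apply: ht_seq.
pose I j m' := fr [:: 0%N; ii; xf; xi] m m' /\ exists x : nat, get m' xi 0 = x /\
  if x is x'.+1 then (x' <= n)%N /\ u x' < 0
  else forall i, (i < j)%N -> 0 <= u i.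
apply: (ht_for (I := I) (N := n.+1)) => //; try lia.
- split; first by apply: fr_put => //.
  by exists 0%N; rewrite /m1; fgets.
- by move=> j m' hs' _; evs; lia.
- move=> j m' hs' jn [h1 [x [h2 h3]]] h4.
  apply: (ht_if hs') => //.
    evs; arx j => //; frs; rewrite hu // => hneg.
    apply: (ht_sset (w := j.+1)) => //; [by evs; lia|lia|move=> _].
    split; first by fgets.
    split; first by apply: fr_put => //; apply: fr_put.
    by exists j.+1; fgets; split=> //; split; lia.
  evs; arx j => //; frs; rewrite hu // => hpos.
  apply: ht_skip => //; split=> //; split; first by apply: fr_put.
  exists x; fgets; split=> //; case: x h2 h3 => // _ h3 i.
  by rewrite ltnS leq_eqVlt => /orP[/eqP->|/h3 //]; lia.
move=> m2 s2 [f2 [x [h1 h2]]] _.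
have hu0 : if x is x'.+1 then (x' <= n)%N /\ u x' < 0
   else forall i, (i <= n)%N -> 0 <= u i by case: x h1 h2.
apply: ht_seq; apply: (ht_sset (w := 1)) => //; set m3 := put _ _ _ _ => s3.
have f3 : fr [:: 0%N; ii; xf; xi] m m3 by apply: fr_put.
have x3 : get m3 xi 0 = x by rewrite /m3; fgets.
apply: (ht_if s3).
  evs; rewrite x3 => x0; apply: (ht_sset (w := 0)) => //; first by rewrite absz0; lia.
  move=> s4; apply: HQ => //; first exact: fr_put.
    fgets; case: (boolP (conb u)) => // hc; exfalso.
    case: x {h1 h2 x3} x0 hu0 => // x' _ [h3 h4].
    by have := conb_ge0 hc h3; lia.
  by exists x; fgets.
evs; rewrite x3 => x0; have x00 : x = 0%N by lia.
rewrite {}x00 {x} in h1 hu0 x3 x0 h2.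
apply: (ht_if s3).
  arx (nelts E) => //; frs; rewrite hu // => un.
  pose J j m' := fr [:: 0%N; ii; xf; xi] m m' /\
     get m' xi 0 = 0 /\ forall i, (i < j)%N -> get m' 0 (1 + 2 * i) = u i /\ get m' 0 (2 + 2 * i) = u n.
  have vq i : (i < n)%N -> valid n 0 (1 + 2 * i) /\ valid n 0 (2 + 2 * i).
    by rewrite /valid /base /=; nia.
  apply: ht_seq; apply: (ht_for (I := J) (N := n)) => //; try lia.
  - by split; [apply: fr_put | split; first by fgets].
  - by move=> j m' hs' _; evs.
  - move=> j m' hs' jn [h3 [h5 h6]] h4; have [v1 v2] := vq j jn.
    apply: ht_seq; apply: (ht_aset (i := 1 + 2 * j) (w := u j)) => //.
    + by evs; lia.
    + by arx j => //; frs; rewrite hu // ltnW.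
    + by rewrite ub // ltnW.
    move=> s5; apply: (ht_aset (i := 2 + 2 * j) (w := u n)) => //.
    + by evs; rewrite getP //=; lia.
    + arx (nelts E) => //; rewrite getP //=; frs; rewrite hu //.
    + by rewrite ub.
    move=> s6; split; first by rewrite !getP //.
    split; first by apply: fr_put => //; apply: fr_put => //; apply: fr_put.
    split; first by rewrite !getP.
    move=> i; rewrite ltnS => hi.
    have hin : (i < n)%N by apply: leq_ltn_trans jn.
    have [v3 v4] := vq i hin.
    rewrite !getP //= !eqn_add2l !eqn_mul2l /=.
    rewrite (_ : (2 + 2 * j == 1 + 2 * i)%N = false); last by apply/negP; lia.
    rewrite (_ : (2 * j == (2 * i).+1)%N = false); last by apply/negP; lia.
    case: eqP => [->|hne] //; apply: h6; lia.
  move=> m4 s4 [h3 [h5 h6]] h4.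
  have hy : vec_at E m4 1 = [ffun e => (u (enum_rank e))%:~R / (u n)%:~R].
    apply/ffunP => e; rewrite !ffunE /rat_at.
    have [] := h6 _ (ltn_ord (enum_rank e)); rewrite /get /loc /= => -> h7.
    by rewrite -h7 -addSn.
  have vs : (vsize (vec_at E m4 1) <= 2 * n * b.+1)%N.
    by apply: (vsize_frac _ un _ hy); [move=> e; rewrite ub // ltnW|rewrite ub].
  apply: ht_seq; apply: (ht_query) => //; try by rewrite /base; nia.
    move=> y ->; split; first by have [] := HO (vec_at E m4 1).
    exact: Hq.
  move=> m5 s5 f5 h7.
  have hc : conb u = (oanswer O (vec_at E m4 1) == None).
    apply/idP/idP; first by move/(conb_in_Y hu0 un) => h; apply/(oracle_in_Y _ HO); rewrite hy.
    by move/(oracle_in_Y _ HO) => h; apply/(conb_in_Y hu0 un); rewrite -hy.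
  apply: (ht_sset (w := (conb u)%:Z)) => //.
  - evs; arx 1%N => //; rewrite h7 hc; by case: (_ == None).
  - by case: (conb u); rewrite ?absz0; lia.
  move=> s6; apply: HQ => //; first 1 last.
  - by fgets.
  - by exists 0%N; fgets; rewrite (f5 xi 0%N).
  apply: fr_put => //; apply: fr_trans h3 _; apply: fr_sub f5 => k.
  by rewrite !inE => ->.
arx (nelts E) => //; frs; rewrite hu // => un.
have un0 : u n = 0 by apply/eqP; rewrite eq_le un hu0.
apply: ht_skip => //; apply: HQ => //; first by rewrite /m3; fgets; rewrite conb_un0.
by exists 0%N.
Qed.

Lemma absz_sum (f : nat -> int) (X j : nat) :
  (forall i, (i < j)%N -> (`|f i| <= X)%N) -> (`|(\sum_(i < j) f i)%R| <= j * X)%N.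
Proof.
elim: j => [|j ih] h; first by rewrite big_ord0.
rewrite big_ord_recr /= mulSn; have := ih (fun i hi => h i (ltnW hi)).
by have := h j (leqnn _); move: (\sum_(_ < _) _) (f j) => x y; lia.
Qed.

Definition cur (n : nat) (u p : nat -> int) (j i : nat) : int :=
  if (i < j)%N then (if p i == 1 then u i else u n) else u i.

Lemma eq_cur n u p p' j i : (forall l, (l < j)%N -> p l = p' l) ->
  cur n u p j i = cur n u p' j i.
Proof. by move=> h; rewrite /cur; case: ifP => // hi; rewrite h. Qed.

Ltac nin := first [by [] | match goal with
  hv : ?v = 1%N \/ ?v = 2%N |- _ => by case: hv => -> end].
Ltac frs ::= repeat match goal with
  | h : fr _ ?m ?m' |- context [get ?m' ?k ?i] =>
      rewrite (h k i); [|nin|nin]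
  end.

Lemma ht_viol m u (x : nat) (Q : memory -> Prop) :
  st m -> (forall i, (i <= n)%N -> get m vU i = u i) ->
  (forall i, (i <= n)%N -> (`|u i| < 2 ^ b)%N) -> ~~ conb u ->
  get m xi 0 = x ->
  (if x is x'.+1 then (x' <= n)%N /\ u x' < 0
        else forall i, (i <= n)%N -> 0 <= u i) ->
  (forall m' p, st m' -> fr [:: 0; ii; kk; vU; vP; xt; xf; xi]%N m m' ->
     (forall i, (i <= n)%N -> get m' vP i = p i) -> isrow p -> dot p u < 0 ->
     Q m') -> ht violP m Q.
Proof.
move=> hs hu ub uc hx hx' HQ; apply: (ht_if hs); evs; rewrite hx.
  case: x hx hx' => // x' hx [x'n ux'] _.
  apply: ht_seq; apply: (ht_map0 (f := fun=> 0) (N := n.+1)) => //; try lia.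
  - by move=> m' hs' _; evs; lia.
  move=> m1 s1 f1 h1; apply: (ht_aset (i := x') (w := 1)) => //; first by evs; frs; lia.
    by lia.
  move=> s2; apply: (HQ _ (fun j => (j == x')%:Z)) => //.
  - apply: fr_put => //; apply: fr_sub f1 => k; rewrite !inE.
    by case/orP => ->; rewrite ?orbT.
  - by move=> i hi; fgets; rewrite h1 ltnS hi eq_sym; case: eqP.
  - by left; exists x'.
  - by rewrite (@dot_delta _ _ x').
case: x hx hx' => [|x] hx hx' // _.
pose ks := [:: 0; ii; kk; vU; vP; xt; xf; xi]%N.
(* The point in [vU] stays raised exactly at the elements with bit 0. The last two clauses are the
   hypotheses of [selfredP] for the elements treated so far. *)
pose J j m' := [/\ fr ks m m',
  forall i, (i <= n)%N -> get m' vU i = cur n u (get m' vP) j i,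
  forall i, (i < j)%N -> get m' vP i = 0 \/ get m' vP i = 1,
  ~~ conb (cur n u (get m' vP) j) &
  forall j', (j' < j)%N -> get m' vP j' = 1 ->
    conb (fun i => if i == j' then u n else cur n u (get m' vP) j' i)].
apply: ht_seq; apply: (ht_for (I := J) (N := n)) => //; try lia.
- split=> //; first by apply: fr_put.
  by move=> i hi; fgets; rewrite hu.
- by move=> j m' hs' _; evs.
- move=> j m' hs' jn [f1 h1 h2 h3 h4] hj.
  have cn : cur n u (get m' vP) j n = u n by rewrite /cur ltnNge ltnW.
  have cj : cur n u (get m' vP) j j = u j by rewrite /cur ltnn.
  apply: ht_seq; apply: (ht_sset (w := u j)) => //.
  + by evs; arx j => //; rewrite h1 ?cj // ltnW.
  + by rewrite ub // ltnW.
  move=> s2; apply: ht_seq; apply: (ht_aset (i := j) (w := u n)) => //.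
  + by evs; fgets.
  + by arx (nelts E) => //; fgets; rewrite h1 ?cn.
  + by rewrite ub.
  move=> s3; set m3 := put _ _ _ _ in s3 *.
  pose w l := if l == j then u n else cur n u (get m' vP) j l.
  apply: ht_seq; apply: (ht_test (u := w)) => //.
  + move=> i hi; rewrite /m3 /w; fgets; rewrite eq_sym; case: eqP => // _.
    exact: h1.
  + move=> i hi; rewrite /w; case: eqP => _; first exact: ub.
    by rewrite /cur; do 2?case: ifP => _; apply: ub.
  move=> m4 s4 f4 hf _.
  have g4 k i : (0 < k < nids)%N -> k \notin [:: 0%N; 14%N; 25%N; 26%N] ->
      get m4 k i = get m3 k i.
    by move=> hk hk'; apply: f4 => //; exact: valid0.
  have fr4 : fr ks m m4.
    apply: (@fr_trans _ m m3).
      by do 2!(apply: fr_put => //).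
    by apply: fr_sub f4 => k; rewrite !inE => /or4P[] ->; rewrite ?orbT.
  have P4 i : get m4 vP i = get m' vP i by rewrite g4 // /m3; fgets.
  have U4 i : (i <= n)%N -> get m4 vU i = w i.
    by move=> hi; rewrite g4 // /m3 /w; fgets; rewrite eq_sym; case: eqP => // _; exact: h1.
  have kk4 : get m4 kk 0 = j by rewrite g4 // /m3; fgets.
  have hP x m5 : get m5 vP =1 (fun i => if j == i then x else get m' vP i) ->
      (forall l, (l < j)%N -> get m5 vP l = get m' vP l).
    by move=> e5 l lj; rewrite e5 gtn_eqF.
  apply: (ht_if s4).
    evs; rewrite hf => hc; have {}hc : conb w by case: (conb w) hc.
    apply: ht_seq; apply: (ht_aset (i := j) (w := u j)) => //.
    + by evs.
    + by evs; rewrite g4 // /m3; fgets.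
    + by rewrite ub // ltnW.
    move=> s5; apply: (ht_aset (i := j) (w := 1)) => //; [by evs; fgets|by lia|].
    move=> s6; split; first by fgets.
    set m6 := put _ _ _ _.
    have P6 : get m6 vP =1 (fun i => if j == i then 1 else get m' vP i).
      by move=> i; rewrite /m6; fgets; rewrite P4.
    have c6 i : cur n u (get m6 vP) j.+1 i = cur n u (get m' vP) j i.
      rewrite /cur ltnS leq_eqVlt; case: (i =P j) => [->|_] /=.
        by rewrite P6 !eqxx ltnn.
      by case: ltnP => // ij; rewrite P6 gtn_eqF.
    split=> //.
    + by do 3!(apply: fr_put => //).
    + move=> i hi; rewrite c6 /m6; fgets; case: (j =P i) => [<-|/eqP ji]; first by rewrite cj.
      by rewrite U4 // /w eq_sym (negbTE ji).
    + move=> i; rewrite ltnS leq_eqVlt P6 eq_sym; case: eqP => [_ _|_ /= /h2 //].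
      by right.
    + by rewrite (eq_conb (fun i _ => c6 i)).
    + move=> j'; rewrite ltnS leq_eqVlt => /orP[/eqP-> _|lj].
        rewrite (eq_conb (u' := w)) // => i _; rewrite /w; case: eqP => // _.
        by apply: eq_cur; exact: hP P6.
      rewrite P6 gtn_eqF // => /(h4 _ lj); congr is_true; apply: eq_conb => i _.
      by case: eqP => // _; apply: eq_cur => l /ltn_trans /(_ lj) l'; rewrite P6 gtn_eqF.
  evs; rewrite hf => hc; have {}hc : ~~ conb w by case: (conb w) hc.
  apply: (ht_aset (i := j) (w := 0)) => //; [by evs|by rewrite absz0; lia|].
  move=> s6; split; first by fgets.
  set m6 := put _ _ _ _.
  have P6 : get m6 vP =1 (fun i => if j == i then 0 else get m' vP i).
    by move=> i; rewrite /m6; fgets; rewrite P4.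
  have c6 i : cur n u (get m6 vP) j.+1 i = w i.
    rewrite /cur /w ltnS leq_eqVlt; case: (i =P j) => [->|_] /=.
      by rewrite P6 !eqxx.
    by rewrite /cur; case: ltnP => // ij; rewrite P6 gtn_eqF.
  split=> //.
  + by do 2!(apply: fr_put => //).
  + by move=> i hi; rewrite c6 /m6; fgets; rewrite U4.
  + move=> i; rewrite ltnS leq_eqVlt P6 eq_sym; case: eqP => [_ _|_ /= /h2 //].
    by left.
  + by rewrite (eq_conb (fun i _ => c6 i)).
  + move=> j'; rewrite ltnS leq_eqVlt => /orP[/eqP->|lj]; first by rewrite P6 eqxx.
    rewrite P6 gtn_eqF // => /(h4 _ lj); congr is_true; apply: eq_conb => i _.
    by case: eqP => // _; apply: eq_cur => l /ltn_trans /(_ lj) l'; rewrite P6 gtn_eqF.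
move=> m1 s1 [f1 h1 h2 h3 h4] hj.
apply: (ht_aset (i := nelts E) (w := -1)) => //; [by evs|by lia|move=> s2].
set m2 := put _ _ _ _ in s2 *.
have P2 i : get m2 vP i = if n == i then -1 else get m1 vP i by rewrite /m2; fgets.
have P2l j i : (j <= n)%N -> cur n u (get m2 vP) j i = cur n u (get m1 vP) j i.
  by move=> jn; apply: eq_cur => l lj; rewrite P2 gtn_eqF // (leq_trans lj).
have [||||h5 h6] := @selfredP u (get m2 vP) hx'.
- by move=> i hi; rewrite P2 gtn_eqF //; exact: h2.
- by rewrite P2 eqxx.
- by rewrite (eq_conb (u' := cur n u (get m1 vP) n)) // => i _; rewrite -P2l.
- move=> j jn; rewrite P2 gtn_eqF // => /(h4 _ jn); congr is_true; apply: eq_conb => i _.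
  by case: eqP => // _; rewrite -(P2l _ _ (ltnW jn)).
by apply: (HQ _ (get m2 vP)) => //; apply: fr_put.
Qed.

Let nB1 : (n.+1 <= B)%N. Proof. by clear -B_ge; lia. Qed.
Let nb1 : (n.+1 < 2 ^ b)%N. Proof. by clear -b_ge; lia. Qed.
Let lt0b : (`|0%R : int| < 2 ^ b)%N. Proof. by rewrite absz0; clear -b_ge; lia. Qed.
Hint Resolve nB1 nb1 lt0b : core.

Lemma ev_n1 m : st m -> eval m (nX + #1)%P = n.+1.
Proof. by move=> s; evs; clear; lia. Qed.

Lemma fr_sub2 (ks ks' : seq nat) m m' : all (mem ks') ks -> fr ks m m' -> fr ks' m m'.
Proof. by move=> /allP h; exact: fr_sub. Qed.

(** * Bisection and exact maximal steps *)

Section Search.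
Variables (vi : nat) (v d : nat -> int).
Hypothesis hv : vi = 1%N \/ vi = 2%N.

Section Bisection.
Variable q : int.

Lemma ht_aff ke k m (Q : memory -> Prop) : ke = xmid \/ ke = xhi -> st m ->
  (forall i, (i <= n)%N -> get m vi i = v i) ->
  (forall i, (i <= n)%N -> get m vD i = d i) ->
  get m xQ 0 = q -> get m ke 0 = k ->
  (forall i, (i <= n)%N -> (`|(q * v i + k * d i)%R| < 2 ^ b)%N) ->
  (forall m', st m' -> fr [:: vU; ii] m m' ->
      (forall i, (i <= n)%N -> get m' vU i = q * v i + k * d i) -> Q m') ->
  ht (affP vi ke) m Q.
Proof.
move=> hke hs hvi hd hQ hk ub HQ.
apply: (ht_map0 (f := fun i => q * v i + k * d i) (N := n.+1)) => //.
- by move=> m' s' _; exact: ev_n1.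
- move=> j m' s' hj f' _ hj'; evs; do 2!(arx j => //; frs); rewrite hvi // hd //.
  by rewrite hQ; congr (_ + _ * _); rewrite f' ?hk //; case: hke => ->.
- by move=> m' s' f' h'; apply: HQ => // i hi'; rewrite h' ltnS hi'.
Qed.

Lemma ht_bsearch hi m (Q : memory -> Prop) : st m ->
  (forall i, (i <= n)%N -> get m vi i = v i) ->
  (forall i, (i <= n)%N -> get m vD i = d i) ->
  get m xQ 0 = q -> get m xlo 0 = 0 -> get m xhi 0 = hi ->
  (forall (k : int) i, 0 <= k <= hi -> (i <= n)%N -> (`|(q * v i + k * d i)%R| < 2 ^ b)%N) ->
  0 < hi -> (`|hi| < 2 ^ b)%N ->
  conb (fun i => q * v i + 0 * d i) -> ~~ conb (fun i => q * v i + hi * d i) ->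
  (forall m' lo, st m' -> fr [:: 0; ii; vU; xlo; xhi; xmid; xf; xi]%N m m' ->
     0 <= lo < hi -> conb (fun i => q * v i + lo * d i) ->
     ~~ conb (fun i => q * v i + (lo + 1) * d i) ->
     (forall i, (i <= n)%N -> get m' vU i = q * v i + (lo + 1) * d i) ->
     (exists x : nat, get m' xi 0 = x /\
        if x is x'.+1 then (x' <= n)%N /\ q * v x' + (lo + 1) * d x' < 0
        else forall i, (i <= n)%N -> 0 <= q * v i + (lo + 1) * d i) ->
     Q m') ->
  ht (bsearchP vi) m Q.
Proof.
move=> hs hvi hd hQ hlo hhi ub hi0 hib c0 c1 HQ.
pose ks := [:: 0; ii; vU; xlo; xhi; xmid; xf; xi]%N.
pose I j m' := fr ks m m' /\ exists lo h, [/\ get m' xlo 0 = lo,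
   get m' xhi 0 = h, [&& 0 <= lo, lo < h & h <= hi], h - lo <= (2 ^ j)%N%:Z &
   conb (fun i => q * v i + lo * d i) /\ ~~ conb (fun i => q * v i + h * d i)].
apply: ht_seq; apply: ht_conseq.
  (* The interval has length [hi < 2 ^ b] at the start, so [b] halvings suffice. *)
  apply: (ht_while (I := I) (j := b)) => //; first exact: ltnW.
  - move=> m' s' [_ [lo [h [e1 e2 e3 e4 _]]]]; evs; rewrite e1 e2.
    by rewrite expn0 in e4; clear -e4; lia.
  - move=> j m' s' [f' [lo [h [e1 e2 e3 e4 [d1 d2]]]]]; evs; rewrite e1 e2 => hg.
    pose mid := ((lo + h) %/ 2)%Z.
    have [hm1 [hm2 [hm3 hm4]]] : 0 <= lo < mid /\ mid < h <= hi /\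
        h - mid <= (2 ^ j)%N%:Z /\ mid - lo <= (2 ^ j)%N%:Z.
      have := divz_eq (lo + h) 2; rewrite -/mid.
      have := modz_ge0 (lo + h) (isT : (2 : int) != 0).
      have := ltz_pmod (lo + h) (isT : 0 < (2 : int)).
      by rewrite expnS in e4; clear -e3 e4 hg; lia.
    have hm : 0 <= mid <= hi by clear -hm1 hm2; lia.
    have mB : (`|mid| < 2 ^ b)%N by clear -hm hib; lia.
    apply: ht_seq; apply: (ht_sset (w := mid)) => //; first by evs; rewrite e1 e2.
    move=> s6; apply: ht_seq; apply: (ht_aff (k := mid)) => //.
    + by left.
    + by move=> i hi'; case: (hv) => hv'; rewrite hv' in hvi *; fgets; rewrite f' // hvi.
    + by move=> i hi'; fgets; frs; exact: hd.
    + by fgets; frs.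
    + by fgets.
    + by move=> i; exact: ub.
    move=> m7 s7 f7 h7.
    apply: ht_seq; apply: (ht_test (u := fun i => q * v i + mid * d i)) => //.
      by move=> i; exact: ub.
    move=> m8 s8 f8 hf _.
    have f8' : fr [:: 0; ii; vU; xf; xi]%N (put m' xmid 0 mid) m8.
      by apply: fr_trans (fr_sub2 _ f7) (fr_sub2 _ f8).
    have f8m : fr ks m m8.
      by apply: fr_trans (fr_sub2 _ f8'); first exact: fr_put.
    apply: (ht_if s8); evs; rewrite hf => hc.
      have {}hc : conb (fun i => q * v i + mid * d i) by case: (conb _) hc.
      apply: (ht_sset (w := mid)) => //; first by evs; frs; fgets.
      move=> s9; split; first exact: fr_put.
      exists mid, h; fgets; frs; fgets; split=> //.
      by clear -hm1 hm2; lia.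
    have {}hc : ~~ conb (fun i => q * v i + mid * d i) by case: (conb _) hc.
    apply: (ht_sset (w := mid)) => //; first by evs; frs; fgets.
    move=> s9; split; first exact: fr_put.
    exists lo, mid; fgets; frs; fgets; split=> //.
    by clear -hm1 hm2; lia.
  - split=> //; exists 0, hi; split=> //; first by clear -hi0; lia.
    by clear -hib hi0; lia.
move=> m6 s6 [hg [j [f6 [lo [h [e1 e2 e3 _ [d1 d2]]]]]]].
have hlo' : h = lo + 1 by move: hg; evs; rewrite e1 e2; clear -e3; lia.
have hm : 0 <= h <= hi by clear -e3; lia.
rewrite {}hlo' in e2 e3 d2 hm *.
apply: ht_seq; apply: (ht_aff (k := lo + 1)) => //.
- by right.
- by move=> i hi'; frs; exact: hvi.
- by move=> i hi'; frs; exact: hd.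
- by frs.
- by move=> i; exact: ub.
move=> m7 s7 f7 h7.
apply: (ht_test (u := fun i => q * v i + (lo + 1) * d i)) => //.
  by move=> i; exact: ub.
move=> m8 s8 f8 hf hx; apply: (HQ _ lo) => //.
- by apply: fr_trans f6 (fr_trans (fr_sub2 _ f7) (fr_sub2 _ f8)).
- by clear -e3; lia.
- by move=> i hi'; frs; exact: h7.
Qed.

End Bisection.

Lemma ht_move p (Vb Db : nat) m (Q : memory -> Prop) : st m -> isrow p ->
  (forall i, (i <= n)%N -> get m vi i = v i) ->
  (forall i, (i <= n)%N -> get m vD i = d i) ->
  (forall i, (i <= n)%N -> get m vP i = p i) ->
  (forall i, (i <= n)%N -> (`|v i| <= Vb)%N) ->
  (forall i, (i <= n)%N -> (`|d i| <= Db)%N) ->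
  (n.+1 * Vb < 2 ^ b)%N -> (n.+1 * Db < 2 ^ b)%N -> (2 * (n.+1 * (Db * Vb)) < 2 ^ b)%N ->
  (forall m', st m' -> fr [:: ii; vi; xg; xh] m m' ->
     (forall i, (i <= n)%N -> get m' vi i = - dot p d * v i + dot p v * d i) ->
     get m' xg 0 = - dot p d -> get m' xh 0 = dot p v -> Q m') ->
  ht (moveP vi) m Q.
Proof.
move=> hs hp hvi hd hpp vb db b1 b2 b3 HQ.
have pdb : `|dot p d| <= (n.+1 * Db)%N%:Z.
  by apply: isrow_dot_le hp _ => i hi'; have := db _ hi'; clear; lia.
have pvb : `|dot p v| <= (n.+1 * Vb)%N%:Z.
  by apply: isrow_dot_le hp _ => i hi'; have := vb _ hi'; clear; lia.
have part (w : nat -> int) (Wb : nat) j : (forall i, (i <= n)%N -> (`|w i| <= Wb)%N) ->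
    (n.+1 * Wb < 2 ^ b)%N -> (j <= n.+1)%N -> (`|(\sum_(i < j) p i * w i)%R| < 2 ^ b)%N.
  move=> hw hW hj; apply: leq_ltn_trans hW.
  apply: (@leq_trans (j * Wb)); last by rewrite leq_mul2r hj orbT.
  apply: (@absz_sum (fun i => p i * w i)) => i hi'.
  have hin : (i <= n)%N by rewrite -ltnS (leq_trans hi').
  rewrite abszM -[Wb]mul1n; apply: leq_mul; last exact: hw.
  by have := isrow_le1 hp hin; clear; lia.
have pdB : (`|(- dot p d)%R| < 2 ^ b)%N by clear -pdb b2; lia.
apply: ht_seq; apply: (ht_sum (f := fun i => p i * d i) (N := n.+1)) => //.
- by move=> m' s' _; exact: ev_n1.
- by move=> j hj; apply: (part d Db).
- by move=> j m' s' hj f' hj'; evs; do 2!(arx j => //; frs); rewrite hpp // hd.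
move=> m10 s10 f10 h10; rewrite -/(dot p d) in h10.
apply: ht_seq; apply: (ht_sset (w := - dot p d)) => //; first by evs; rewrite h10 sub0r.
move=> s11; set m11 := put _ _ _ _ in s11 *.
have f11 : fr [:: xg; ii] m m11 by apply: fr_put.
have g11 : get m11 xg 0 = - dot p d by rewrite /m11; fgets.
move: m11 s11 f11 g11 => m11 s11 f11 g11 {h10 f10 s10 m10}.
apply: ht_seq; apply: (ht_sum (f := fun i => p i * v i) (N := n.+1)) => //.
- by move=> m' s' _; exact: ev_n1.
- by move=> j hj; apply: (part v Vb).
- move=> j m' s' hj f' hj'; evs; arx j => //; arx j => //; frs.
  by rewrite hpp // hvi.
move=> m12 s12 f12 h12; rewrite -/(dot p v) in h12.
apply: (ht_map0 (f := fun i => - dot p d * v i + dot p v * d i) (N := n.+1)) => //.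
- by case: hv => ->.
- by case: hv => ->.
- by move=> m' s' _; exact: ev_n1.
- move=> j hj; have h1 := vb _ hj; have h2 := db _ hj.
  apply: leq_ltn_trans b3.
  have hn1 : `|- dot p d * v j + dot p v * d j| <=
    (n.+1 * Db)%N%:Z * Vb%:Z + (n.+1 * Vb)%N%:Z * Db%:Z.
    apply: (le_trans (ler_normD _ _)); rewrite !normrM normrN; apply: lerD;
    by apply: ler_pM => //; clear -h1 h2; lia.
  have : (n.+1 * Db * Vb + n.+1 * Vb * Db = 2 * (n.+1 * (Db * Vb)))%N by clear; lia.
  by clear -hn1; lia.
- move=> j m' s' hj f' hpos hj'; evs; arx j => //; arx j => //.
  rewrite hpos ltnn; frs; rewrite hvi // hd // h12 g11 //.
move=> m13 s13 f13 h13; apply: HQ => //.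
- by apply: fr_trans (fr_sub2 _ f11) (fr_trans (fr_sub2 _ f12) (fr_sub2 _ f13)); nin.
- by move=> i hi'; rewrite h13 ltnS hi'.
- by frs.
- by frs.
Qed.

(** The first factor bounds [Q] and the second [S + 1], so their product bounds [hi]; the third
    accounts for the coordinates [Q * v i + k * d i] with [k <= hi]. *)
Definition mstep_big (Vb Db : nat) : nat :=
  ((n.+1 * (Db * Db)) ^ 2 + 1) * (n.+1 * Vb + 1) * (Db + 1).

Lemma ht_mstep (Vb Db : nat) m (Q : memory -> Prop) : st m ->
  (forall i, (i <= n)%N -> get m vi i = v i) ->
  (forall i, (i <= n)%N -> get m vD i = d i) ->
  conb v -> (forall i, (i <= n)%N -> (`|v i| <= Vb)%N) ->
  (forall i, (i <= n)%N -> (`|d i| <= Db)%N) ->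
  (exists2 i, (i <= n)%N & d i < 0) ->
  (mstep_big Vb Db < 2 ^ b)%N ->
  (forall m' p, st m' ->
     fr [:: 0; ii; kk; vi; vU; vP; xS; xB; xQ; xlo; xhi; xmid; xf; xi; xt; xg; xh]%N m m' ->
     (forall i, (i <= n)%N -> get m' vP i = p i) -> isrow p -> dot p d < 0 ->
     (forall i, (i <= n)%N -> get m' vi i = - dot p d * v i + dot p v * d i) ->
     conb (fun i => - dot p d * v i + dot p v * d i) ->
     get m' xg 0 = - dot p d -> get m' xh 0 = dot p v -> Q m') ->
  ht (mstepP vi) m Q.
Proof.
move=> hs hvi hd cv vb db [i0 hi0 di0] big HQ.
have Db0 : (0 < Db)%N by have := db _ hi0; clear -di0; lia.
pose S := \sum_(i < n.+1) v i; pose X := \sum_(i < n.+1) d i * d i.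
have v0 i : (i <= n)%N -> 0 <= v i by exact: (conb_ge0 cv).
have Sb j : (j <= n.+1)%N -> (`|(\sum_(i < j) v i)%R| <= n.+1 * Vb)%N.
  move=> hj; apply: (@leq_trans (j * Vb)); last by rewrite leq_mul2r hj orbT.
  by apply: absz_sum => i hi; apply: vb; rewrite -ltnS (leq_trans hi).
have Xb j : (j <= n.+1)%N -> (`|(\sum_(i < j) d i * d i)%R| <= n.+1 * (Db * Db))%N.
  move=> hj; apply: (@leq_trans (j * (Db * Db))); last by rewrite leq_mul2r hj orbT.
  apply: (@absz_sum (fun i => d i * d i)) => i hi; rewrite abszM.
  by apply: leq_mul; apply: db; rewrite -ltnS (leq_trans hi).
have S0 : 0 <= S by apply: sumr_ge0 => i _; apply: v0; rewrite -ltnS.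
have X0 : 0 <= X by apply: sumr_ge0 => i _; rewrite -expr2 sqr_ge0.
have SB : S <= (n.+1 * Vb)%N%:Z by have := Sb _ (leqnn _); rewrite -/S; clear; lia.
have XB : X <= (n.+1 * (Db * Db))%N%:Z by have := Xb _ (leqnn _); rewrite -/X; clear; lia.
pose QQ := X * X + 1.
have Q0 : 0 < QQ by rewrite /QQ ltr_wpDl // mulr_ge0.
pose W := ((n.+1 * (Db * Db)) ^ 2 + 1)%N.
have QB : QQ <= W%:Z.
  by rewrite /QQ /W -mulnn PoszD PoszM lerD2r; apply: ler_pM.
pose hi := (S + 1) * QQ.
have hi_gt0 : 0 < hi by rewrite /hi pmulr_rgt0 // ltr_wpDl.
have hiB : hi <= ((n.+1 * Vb + 1) * W)%N%:Z.
  rewrite /hi PoszM PoszD; apply: ler_pM; [by rewrite addr_ge0|exact: ltW| |exact: QB].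
  by rewrite lerD2r.
have W0 : (0 < W)%N by rewrite /W addn1.
have bigE : mstep_big Vb Db = (W * (n.+1 * Vb + 1) * (Db + 1))%N by [].
have le1 (x : nat) : (x <= (n.+1 * Vb + 1) * W -> x < 2 ^ b)%N.
  move=> h; apply: leq_ltn_trans big; apply: (leq_trans h).
  by rewrite bigE [(W * _)%N]mulnC leq_pmulr // addn1.
have nbV : (n.+1 * Vb < 2 ^ b)%N by apply: le1; clear -W0; nia.
have nbD2 : (n.+1 * (Db * Db) < 2 ^ b)%N.
  apply: le1; apply: (@leq_trans W); last by rewrite leq_pmull // addn1.
  by rewrite /W -mulnn; case: (n.+1 * _)%N => // y; rewrite addn1 leqW // leq_pmulr.
have nbD : (n.+1 * Db < 2 ^ b)%N.
  by apply: leq_ltn_trans nbD2; rewrite leq_mul2l leq_pmulr.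
have nbDV : (2 * (n.+1 * (Db * Vb)) < 2 ^ b)%N.
  apply: leq_ltn_trans big; rewrite bigE.
  apply: (@leq_trans ((n.+1 * Vb + 1) * (Db + 1) * W)); last by clear; lia.
  apply: (@leq_trans ((n.+1 * Vb + 1) * (Db + 1) * 2)); last first.
    by apply: leq_mul => //; rewrite /W addn1 ltnS -mulnn !muln_gt0 Db0.
  by clear; nia.
have ub (k : int) i : 0 <= k <= hi -> (i <= n)%N -> (`|(QQ * v i + k * d i)%R| < 2 ^ b)%N.
  move=> /andP[k0 khi] hi'; apply: leq_ltn_trans big; rewrite bigE.
  have h1 := vb _ hi'; have h2 := db _ hi'; have h3 := v0 _ hi'.
  rewrite -lez_nat abszE.
  apply: (@le_trans _ _ (W%:Z * Vb%:Z + ((n.+1 * Vb + 1) * W)%N%:Z * Db%:Z)).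
    apply: (le_trans (ler_normD _ _)); rewrite !normrM; apply: lerD; apply: ler_pM => //;
      first [by rewrite gtr0_norm | by rewrite ger0_norm // (le_trans khi) | by clear -h1 h2; lia].
  by rewrite -!PoszM -PoszD lez_nat; clear; nia.
have i0S : v i0 <= S.
  rewrite /S (bigD1 (Ordinal (hi0 : (i0 < n.+1)%N))) //= lerDl.
  by apply: sumr_ge0 => i _; apply: v0; rewrite -ltnS.
(* At the right end coordinate [i0] is at most [QQ * S - (S + 1) * QQ < 0], because [v i0 <= S] and
   [d i0 <= -1]. *)
have hiC : ~~ conb (fun i => QQ * v i + hi * d i).
  apply/negP => /conb_ge0 /(_ hi0) h.
  have h1 : QQ * v i0 <= S * QQ by rewrite mulrC ler_pM2r.
  have h3 : hi * d i0 <= hi * (-1) by rewrite ler_pM2l //; clear -di0; lia.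
  by move: h3 h; rewrite /hi !mulrDl !mul1r; clear -h1 Q0; lia.
apply: ht_seq; apply: (ht_sum (f := v) (N := n.+1)) => //.
- by move=> m' s' _; exact: ev_n1.
- by move=> j hj; apply: leq_ltn_trans nbV; exact: Sb.
- by move=> j m' s' hj f' hj'; arx j => //; frs; rewrite hvi.
move=> m1 s1 f1 h1.
apply: ht_seq; apply: (ht_sum (f := fun i => d i * d i) (N := n.+1)) => //.
- by move=> m' s' _; exact: ev_n1.
- by move=> j hj; apply: leq_ltn_trans nbD2; exact: Xb.
- by move=> j m' s' hj f' hj'; evs; arx j => //; frs; rewrite hd.
move=> m2 s2 f2 h2; rewrite -/X in h2.
apply: ht_seq; apply: (ht_sset (w := QQ)) => //; first by evs; rewrite h2.
  apply: le1; rewrite -lez_nat abszE gtr0_norm //; apply: (le_trans QB).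
  by rewrite lez_nat leq_pmull // addn1.
move=> s3; apply: ht_seq; apply: (ht_sset (w := 0)) => //.
have hib : (`|hi| < 2 ^ b)%N by apply: le1; rewrite -lez_nat abszE gtr0_norm.
move=> s4; apply: ht_seq; apply: (ht_sset (w := hi)) => //.
  by evs; fgets; frs; rewrite h1.
set m5 := put _ _ _ _ => s5.
pose ks := [:: 0; ii; kk; vU; vP; xS; xB; xQ; xlo; xhi; xmid; xf; xi; xt; xg; xh]%N.
have f5 : fr ks m m5.
  by do 3!(apply: fr_put => //); apply: fr_trans (fr_sub2 _ f1) (fr_sub2 _ f2).
apply: ht_seq; apply: (ht_bsearch (q := QQ) (hi := hi)) => //.
- by move=> i hi'; frs; exact: hvi.
- by move=> i hi'; frs; exact: hd.
- by rewrite /m5; fgets.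
- by rewrite /m5; fgets.
- by rewrite /m5; fgets.
- apply/conbP => p hp; rewrite dot_lin mul0r addr0 mulr_ge0 ?(ltW Q0) //.
  by move/conbP: cv; apply.
move=> m6 lo s6 f6 /andP[l0 l1] d1 d2 h6 [x [hx hx']].
apply: ht_seq; apply: (ht_viol (u := fun i => QQ * v i + (lo + 1) * d i) (x := x)) => //.
  by move=> i; apply: ub; clear -l0 l1; lia.
move=> m7 p s7 f7 h7 hp pv.
have [pd cv'] : dot p d < 0 /\ conb (fun i => - dot p d * v i + dot p v * d i).
  apply: (maxstepP (Q := QQ) (lo := lo) (X := X)) => //.
  - by rewrite /QQ expr2 ltrDl.
  - by move=> p' hp'; exact: (isrow_dot_sqr _ hp').
apply: (ht_move (p := p) (Vb := Vb) (Db := Db)) => //.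
- by move=> i hi'; frs; exact: hvi.
- by move=> i hi'; frs; exact: hd.
move=> m8 s8 f8 h8 g8 e8; apply: (HQ _ p) => //; last by move=> i hi'; frs; exact: h7.
by apply: fr_trans (fr_sub2 _ f5) (fr_trans (fr_sub2 _ f6)
  (fr_trans (fr_sub2 _ f7) (fr_sub2 _ f8))); nin.
Qed.
End Search.

(** * Walking to an extreme ray *)

(* Fraction-free rank-one update: [xs] is the Gram determinant of the rows with [vP] added,
   and the division by the former one is exact. *)
Definition updP (a aD : nat) : prog := (
  forl ii (nX + #1) (
    suml xs jj (nX + #1) (a $[ sc ii * (nX + #1) + sc jj ] * vP $[ sc jj ]) ;;
    vY @[ sc ii ] ::= sc xs) ;;
  suml xs jj (nX + #1) (vP $[ sc jj ] * vY $[ sc jj ]) ;;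
  forl ii ((nX + #1) * (nX + #1)) (
    a @[ sc ii ] ::= (sc xs * a $[ sc ii ] -
      vY $[ sc ii / (nX + #1) ] *
      vY $[ sc ii - sc ii / (nX + #1) * (nX + #1) ]) / sc aD) ;;
  aD ::= sc xs)%P.

Ltac nin ::= first [by [] | match goal with
  hv : ?v = 1%N \/ ?v = 2%N |- _ => by case: hv => -> end
  | match goal with ha : (_ = vM /\ _ = xD) \/ _ |- _ => by case: ha => [[? ?]|[? ?]]; subst end].

Hypothesis nnB : (n.+1 * n.+1 <= B)%N.
Hypothesis nnb : (n.+1 * n.+1 < 2 ^ b)%N.

Definition mxof (F : nat -> int) : 'M[int]_(n.+1) := \matrix_(i, j) F (i * n.+1 + j)%N.
Definition rowof (p : nat -> int) : 'rV[int]_(n.+1) := \row_j p j.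

(** The entries of the old matrix are at most [D] and those of [p] at most 1 in absolute value, so
    the Gram determinant grows by a factor of at most [(n + 1) ^ 2] per row. This is the origin of
    the bound [Dm] on all Gram determinants. *)
Lemma ht_upd a aD k (M : 'M[int]_(k, n.+1)) p D m (Q : memory -> Prop) :
  (a = vM /\ aD = xD) \/ (a = vN /\ aD = xE) -> st m ->
  projm M (mxof (get m a)) D -> get m aD 0 = D ->
  (forall i, (i <= n)%N -> get m vP i = p i) ->
  (forall i, (i <= n)%N -> `|p i| <= 1) ->
  mxof (get m a) *m (rowof p)^T != 0 ->
  (n.+1 * (n.+1 * `|D|) < 2 ^ b)%N ->
  (forall m' D', st m' -> fr [:: ii; jj; xs; vY; a; aD] m m' ->
    projm (col_mx M (rowof p)) (mxof (get m' a)) D' -> get m' aD 0 = D' ->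
    (`|D'| <= n.+1 * (n.+1 * `|D|))%N -> Q m') ->
  ht (updP a aD) m Q.
Proof.
move=> ha hs hM hD hp p1 yn0 Db HQ.
pose F := get m a; pose A := mxof F.
have Fb i j : (i <= n)%N -> (j <= n)%N -> (`|F (i * n.+1 + j)%N| <= `|D|)%N.
  move=> hi hj; case: (hM) => _ _ D0.
  have := projm_le hM (Ordinal (hi : (i < n.+1)%N)) (Ordinal (hj : (j < n.+1)%N)).
  by rewrite mxE /= -/F; clear -D0; lia.
pose y i := \sum_(j < n.+1) F (i * n.+1 + j)%N * p j.
have yb i j : (i <= n)%N -> (j <= n.+1)%N ->
    (`|(\sum_(l < j) F (i * n.+1 + l)%N * p l)%R| <= n.+1 * `|D|)%N.
  move=> hi hj; apply: (@leq_trans (j * `|D|)); last by rewrite leq_mul2r hj orbT.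
  apply: (@absz_sum (fun l => F (i * n.+1 + l)%N * p l)) => l hl.
  have hl' : (l <= n)%N by rewrite -ltnS (leq_trans hl).
  rewrite abszM -[X in (_ <= X)%N]muln1; apply: leq_mul; first exact: Fb.
  by have := p1 _ hl'; clear; lia.
pose s := \sum_(j < n.+1) p j * y j.
have sb j : (j <= n.+1)%N -> (`|(\sum_(l < j) p l * y l)%R| <= n.+1 * (n.+1 * `|D|))%N.
  move=> hj; apply: (@leq_trans (j * (n.+1 * `|D|))); last by rewrite leq_mul2r hj orbT.
  apply: (@absz_sum (fun l => p l * y l)) => l hl.
  have hl' : (l <= n)%N by rewrite -ltnS (leq_trans hl).
  rewrite abszM -[X in (_ <= X)%N]mul1n; apply: leq_mul; last exact: yb.
  by have := p1 _ hl'; clear; lia.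
have yE i : (A *m (rowof p)^T) i ord0 = y i.
  by rewrite mxE; apply: eq_bigr => j _; rewrite !mxE.
have sE : (rowof p *m A *m (rowof p)^T) ord0 ord0 = s.
  by rewrite -mulmxA mxE; apply: eq_bigr => j _; rewrite yE mxE.
have hM2 := projm_step hM yn0; rewrite -/F -/A sE in hM2.
have yb' i : (i <= n)%N -> (`|y i| < 2 ^ b)%N.
  move=> hi; apply: leq_ltn_trans Db; apply: leq_trans (yb i n.+1 hi (leqnn _)) _.
  by rewrite leq_pmull.
pose I j m' := fr [:: ii; jj; xs; vY] m m' /\ forall i, (i < j)%N -> get m' vY i = y i.
apply: ht_seq; apply: (ht_for (I := I) (N := n.+1)) => //.
- by split; first exact: fr_put.
- by move=> j m' s' _; exact: (ev_n1 s').
- move=> j m' s' hj [f' h'] hj'.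
  apply: ht_seq; apply: (ht_sum (f := fun l => F (j * n.+1 + l)%N * p l) (N := n.+1)) => //.
  + by move=> m'' s'' _; exact: (ev_n1 s'').
  + move=> l hl; apply: leq_ltn_trans Db; apply: leq_trans (yb j l _ hl) _ => //.
    by rewrite leq_pmull.
  + move=> l m'' s'' hl f'' hl''; evs; arx (j * n.+1 + l)%N.
    by arx l => //; frs; rewrite hp.
  move=> m2 s2 f2 h2; apply: (ht_aset (i := j) (w := y j)) => //; [by evs; frs|by evs|exact: yb'|].
  move=> s3; split; first by fgets; frs.
  split.
    apply: fr_put => //; apply: fr_put => //; apply: fr_trans f' _.
    exact: fr_sub2 f2.
  move=> i; rewrite ltnS leq_eqVlt; fgets; rewrite eq_sym; case: eqP => [->//|_ /= hi].
  by frs; exact: h'.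
move=> m1 s1 [f1 h1] _.
apply: ht_seq; apply: (ht_sum (f := fun l => p l * y l) (N := n.+1)) => //.
- by move=> m'' s'' _; exact: (ev_n1 s'').
- by move=> l hl; apply: leq_ltn_trans Db; exact: sb.
- by move=> l m' s' hl f' hl'; evs; arx l => //; arx l => //; frs; rewrite hp // h1.
move=> m2 s2 f2 h2; rewrite -/s in h2.
pose f t := ((s * F t - y (t %/ n.+1)%N * y (t %% n.+1)%N) %/ D)%Z.
have fE (i j : nat) : (i <= n)%N -> (j <= n)%N ->
    f (i * n.+1 + j)%N = ((s * F (i * n.+1 + j)%N - y i * y j) %/ D)%Z.
  by move=> hi hj; rewrite /f modnMDl divnMDl // modn_small // divn_small // addn0.
have fM (i j : 'I_(n.+1)) : (\matrix_(i, j) ((s * A i j - (A *m (rowof p)^T) i ord0 *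
   (A *m (rowof p)^T) j ord0) %/ D)%Z) i j = f (i * n.+1 + j)%N.
  by rewrite mxE !yE mxE fE // -ltnS.
have sD : (`|s| < 2 ^ b)%N by apply: leq_ltn_trans Db; exact: sb.
apply: ht_seq; apply: (ht_map0 (f := f) (N := (n.+1 * n.+1)%N)) => //.
- by nin.
- by nin.
- by move=> m' s' _; evs; rewrite -PoszD addn1.
- move=> t ht; have hi : (t %/ n.+1 < n.+1)%N by rewrite ltn_divLR.
  have hj : (t %% n.+1 < n.+1)%N by rewrite ltn_mod.
  apply: leq_ltn_trans sD; rewrite (divn_eq t n.+1).
  have := projm_le hM2 (Ordinal hi) (Ordinal hj); rewrite fM /=.
  by case: hM2 => _ _ s0; clear -s0; lia.
- move=> t m' s' ht f' hpos ht'; evs.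
  have hi : (t %/ n.+1 < n.+1)%N by rewrite ltn_divLR.
  have hj : (t %% n.+1 < n.+1)%N by rewrite ltn_mod.
  arx t => //.
  arx (t %/ n.+1)%N; last by rewrite ht' -PoszD addn1 divz_nat.
  arx (t %% n.+1)%N; last first.
    rewrite ht' -PoszD addn1 divz_nat {1}(divn_eq t n.+1).
    by rewrite -PoszM PoszD addrC addKr.
  rewrite hpos ltnn; frs; rewrite hD h2 !h1 //.
move=> m3 s3 f3 h3.
apply: (ht_sset (w := s)) => //; first by evs; frs.
  by nin.
move=> s4; apply: (HQ _ s) => //.
- apply: fr_put; [|by nin|by rewrite !inE eqxx !orbT].
  by apply: fr_trans (fr_sub2 _ f1) (fr_trans (fr_sub2 _ f2) (fr_sub2 _ f3)); nin.
- suff -> : mxof (get (put m3 aD 0 s) a) = \matrix_(i, j) ((s * A i j - (A *m (rowof p)^T) i ord0 *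
   (A *m (rowof p)^T) j ord0) %/ D)%Z by [].
  apply/matrixP => i j; rewrite fM mxE getP; [|by nin|by nin].
  rewrite (_ : (aD == a) = false) /=; last by nin.
  by rewrite h3 (_ : (_ < _)%N) //; have := ltn_ord i; have := ltn_ord j; clear; nia.
- by rewrite getP ?eqxx //; nin.
- exact: sb.
Qed.

(** A positive diagonal entry certifies a nonzero vector of the null space with a positive
    coordinate. As the all-ones row makes its coordinates sum to 0, it also has a negative one, and
    the step along it is finite. *)
Definition colP : prog := (
  forl ii (nX + #1) (If (vN $[ sc ii * (nX + #1) + sc ii ]) (xj ::= sc ii) Skip) ;;
  forl ii (nX + #1) (vD @[ sc ii ] ::= vN $[ sc ii * (nX + #1) + sc xj ]))%P.

(** There are [o + 1] independent rows at the start and one more after each step, so [n - o] steps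
    lead to full rank. *)
Definition walkP : prog :=
  forl qq (nX - sc oo)%P (colP ;; mstepP vV ;; updP vN xE)%P.

Lemma ht_col k (M : 'M[int]_(k, n.+1)) D m (Q : memory -> Prop) :
  st m -> projm M (mxof (get m vN)) D -> (k < n.+1)%N ->
  (forall i j, (i <= n)%N -> (j <= n)%N -> (`|get m vN (i * n.+1 + j)| < 2 ^ b)%N) ->
  (forall m' (j : 'I_(n.+1)), st m' -> fr [:: ii; xj; vD] m m' ->
     0 < mxof (get m vN) j j ->
     (forall i : 'I_(n.+1), get m' vD i = mxof (get m vN) i j) -> Q m') ->
  ht colP m Q.
Proof.
move=> hs hM kn hb HQ; pose F := get m vN.
pose I j m' := fr [:: ii; xj] m m' /\
  ((exists x : nat, [/\ get m' xj 0 = x, (x <= n)%N & 0 < F (x * n.+1 + x)%N]) \/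
   (forall i, (i < j)%N -> F (i * n.+1 + i)%N <= 0)).
apply: ht_seq; apply: (ht_for (I := I) (N := n.+1)) => //.
- by split; [exact: fr_put | right].
- by move=> j m' s' _; exact: (ev_n1 s').
- move=> j m' s' hj [f' h'] hj'.
  have e1 : eval m' (vN $[ sc ii * (nX + #1) + sc ii ])%P = F (j * n.+1 + j)%N.
    by arx (j * n.+1 + j)%N; frs.
  apply: (ht_if s'); rewrite e1 => hF.
    apply: (ht_sset (w := j)) => //; first by evs.
      by clear -hj nb1; lia.
    move=> s2; split; first by fgets.
    split; first by do 2!(apply: fr_put => //).
    by left; exists j; split=> //; fgets.
  apply: ht_skip => //; split=> //; split; first exact: fr_put.
  case: h' => [[x [h1 h2 h3]]|h']; first by left; exists x; fgets.
  by right=> i; rewrite ltnS leq_eqVlt => /orP[/eqP->|/h'].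
move=> m1 s1 [f1 h1] _.
have [x [h2 h3 h4]] : exists x : nat, [/\ get m1 xj 0 = x, (x <= n)%N & 0 < F (x * n.+1 + x)%N].
  case: h1 => // h1; exfalso; have [j] := projm_lt hM kn.
  by rewrite mxE ltNge -/F h1.
apply: (ht_map0 (f := fun i => F (i * n.+1 + x)%N) (N := n.+1)) => //.
- by move=> m' s' _; exact: (ev_n1 s').
- by move=> j hj; apply: hb.
- by move=> j m' s' hj f' _ hj'; arx (j * n.+1 + x)%N; frs.
move=> m2 s2 f2 h5.
apply: (HQ _ (Ordinal (h3 : (x < n.+1)%N))) => //.
- by apply: fr_trans (fr_sub2 _ f1) (fr_sub2 _ f2).
- by rewrite mxE.
- by move=> i; rewrite h5 ltn_ord mxE.
Qed.

Lemma mstep_big_mono (V V' D D' : nat) : (V <= V')%N -> (D <= D')%N ->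
  (mstep_big V D <= mstep_big V' D')%N.
Proof.
move=> hV hD; rewrite /mstep_big; apply: leq_mul; last by rewrite leq_add2r.
apply: leq_mul; rewrite leq_add2r; last by rewrite leq_mul2l hV orbT.
by rewrite leq_sqr leq_mul2l /= leq_mul.
Qed.

Lemma mstep_big_D (V D : nat) : (n.+1 * (n.+1 * D) <= mstep_big V D)%N.
Proof.
rewrite /mstep_big -mulnA; apply: (@leq_trans ((n.+1 * (D * D)) ^ 2 + 1)).
  case: D => [|D]; first by rewrite !muln0.
  rewrite -mulnn; apply: leq_trans (leq_addr _ _).
  have -> : (n.+1 * (D.+1 * D.+1) * (n.+1 * (D.+1 * D.+1)) =
     n.+1 * (n.+1 * D.+1) * (D.+1 * D.+1 * D.+1))%N by clear; lia.
  by rewrite leq_pmulr.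
by rewrite leq_pmulr // muln_gt0 !addn1.
Qed.

Lemma rowsat_move k (M : 'M[int]_(k, n.+1)) v (d : nat -> int) (g f : int) :
  rowsat M v -> (forall l, \sum_(j < n.+1) M l j * d j = 0) ->
  rowsat M (fun i => g * v i + f * d i).
Proof.
move=> hM hd l; have [p [h1 h2]] := hM l; exists p; split=> //.
case: h2 => [h2|[h2 h3]]; [by left|right; split=> //].
rewrite dot_lin h3 mulr0 add0r (_ : dot p d = 0) ?mulr0 //.
by rewrite -[RHS](hd l); apply: eq_bigr => j _; rewrite h1.
Qed.

Lemma rowsat_col k (M : 'M[int]_(k, n.+1)) v p : rowsat M v ->
  ((forall j, (j <= n)%N -> p j = 1) \/ (isrow p /\ dot p v = 0)) ->
  rowsat (col_mx M (rowof p)) v.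
Proof.
move=> hM hp l; rewrite -(splitK l); case: (split l) => [l'|l'] /=.
  have [q [h1 h2]] := hM l'; exists q; split=> // j; by rewrite col_mxEu.
by exists p; split=> // j; rewrite col_mxEd mxE.
Qed.

(** Points are never reduced by common factors. If [v] is bounded by [V], a step combines [v] and
    [d] with coefficients at most [(n + 1) * Dm] and [(n + 1) * V]. This costs a factor
    [G = 2 * (n + 1) * Dm] per step, harmless over at most [n + 1] steps. *)
Lemma ht_walk (o k1 : nat) (M : 'M[int]_(k1, n.+1)) D v0 (V0 : nat) m (Q : memory -> Prop) :
  let Dm := ((n.+1 * n.+1) ^ n.+1)%N in
  k1 = o.+1 -> st m -> get m oo 0 = o -> (o <= n)%N ->
  projm M (mxof (get m vN)) D -> get m xE 0 = D ->
  (`|D| <= (n.+1 * n.+1) ^ o.+1)%N ->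
  (forall i, (i <= n)%N -> get m vV i = v0 i) -> conb v0 ->
  0 < \sum_(i < n.+1) v0 i -> (forall i, (i <= n)%N -> (`|v0 i| <= V0)%N) ->
  rowsat M v0 -> (exists l, forall j, M l j = 1) ->
  (mstep_big ((2 * n.+1 * Dm) ^ n.+1 * V0) Dm < 2 ^ b)%N ->
  (forall m' v (M' A' : 'M_(n.+1)) D', st m' ->
     fr [:: 0; ii; jj; kk; qq; vV; vU; vP; vD; vN; vY; xE; xS; xB; xQ; xlo; xhi;
            xmid; xf; xi; xt; xg; xh; xs; xj]%N m m' ->
     (forall i, (i <= n)%N -> get m' vV i = v i) -> conb v ->
     0 < \sum_(i < n.+1) v i -> rowsat M v ->
     projm M' A' D' -> rowsat M' v -> Q m') ->
  ht walkP m Q.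
Proof.
move=> Dm ek1; subst k1 => hs ho on hM hD Db hv0 cv0 sv0 v0b hr [l0 hl0] big HQ.
pose ks := [:: 0; ii; jj; kk; qq; vV; vU; vP; vD; vN; vY; xE; xS; xB; xQ; xlo; xhi;
            xmid; xf; xi; xt; xg; xh; xs; xj]%N.
pose G := (2 * n.+1 * Dm)%N.
have Dm0 : (0 < Dm)%N by rewrite expn_gt0.
have G0 : (0 < G)%N by rewrite !muln_gt0.
(* The equation [M = X *m M'] records that the initial rows stay in the row space, so every later
   direction is annihilated by [M] and the point remains tight on its rows. *)
pose I q m' := fr ks m m' /\ exists v k' (M' : 'M[int]_(k', n.+1)) D' X,
  (k' = o.+1 + q)%N /\ [/\ forall i, (i <= n)%N -> get m' vV i = v i, conb v,
    0 < \sum_(i < n.+1) v i &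
    forall i, (i <= n)%N -> (`|v i| <= G ^ q * V0)%N] /\
  [/\ rowsat M v, rowsat M' v & M = X *m M'] /\
  [/\ projm M' (mxof (get m' vN)) D', get m' xE 0 = D' & (`|D'| <= (n.+1 * n.+1) ^ k')%N].
apply: (ht_for (I := I) (N := (n - o)%N)) => //.
- by clear -B_ge; lia.
- by clear -b_ge; lia.
- split; first exact: fr_put.
  exists v0, o.+1, M, D, 1%:M; split; first by rewrite addn0.
  split; first by split=> // i hi; [fgets; exact: hv0|rewrite expn0 mul1n; exact: v0b].
  split; first by split=> //; rewrite mul1mx.
  split=> //; last by fgets.
  rewrite (_ : mxof _ = mxof (get m vN)) //.
  by apply/matrixP => i j; rewrite !mxE; fgets.
- move=> j m' s' [f' _]; evs; rewrite (f' oo 0%N) // ho.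
  by clear -on; lia.
- move=> q m' s' hq [f' [v [k' [M' [D' [X [ek [[hv cv sv vb] [[r1 r2 eM] [hM' hD' Db']]]]]]]]]] hqq.
  have kN : (k' < n.+1)%N by rewrite ek; clear -hq; lia.
  have Dp : 0 < D' by case: hM'.
  have DDm : (`|D'| <= Dm)%N.
    by apply: leq_trans Db' _; rewrite leq_pexp2l // ltnW.
  have Ab i j : `|mxof (get m' vN) i j| <= Dm%:Z.
    by apply: le_trans (projm_le hM' i j) _; clear -DDm; lia.
  have bigD : (n.+1 * (n.+1 * Dm) < 2 ^ b)%N by apply: leq_ltn_trans (mstep_big_D _ _) big.
  apply: ht_seq; apply: (ht_col s' hM' kN).
    move=> i j hi hj.
    have := Ab (Ordinal (hi : (i < n.+1)%N)) (Ordinal (hj : (j < n.+1)%N)).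
    by rewrite mxE /= => h; clear -h bigD; nia.
  move=> m1 jc s1 f1 hjc hd; set A := mxof (get m' vN) in hM' Ab hjc hd.
  pose d i := get m1 vD i.
  have MA : M *m A = 0 by rewrite eM -mulmxA (projm_kill hM') mulmx0.
  have killd k1 (M1 : 'M[int]_(k1, n.+1)) : M1 *m A = 0 ->
      forall l, \sum_(j < n.+1) M1 l j * d j = 0.
    move=> h l; have := congr1 (fun Z : 'M_(k1, n.+1) => Z l jc) h; rewrite !mxE => h0.
    by rewrite -[RHS]h0; apply: eq_bigr => j _; rewrite /d hd.
  have sd : \sum_(j < n.+1) d j = 0.
    by rewrite -[RHS](killd _ _ MA l0); apply: eq_bigr => j _; rewrite hl0 mul1r.
  have db i : (i <= n)%N -> (`|d i| <= Dm)%N.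
    move=> hi; have := Ab (Ordinal (hi : (i < n.+1)%N)) jc; rewrite -hd /d /=.
    by clear; lia.
  have dneg : exists2 i, (i <= n)%N & d i < 0.
    case: (pickP (fun i : 'I_(n.+1) => d i < 0)) => [i hi|h0].
      by exists i => //; rewrite -ltnS.
    exfalso; move/eqP: sd; rewrite gt_eqF // (bigD1 jc) //= ltr_wpDr //.
      by apply: sumr_ge0 => i _; rewrite leNgt h0.
    by rewrite /d hd.
  have Gq : (G ^ q <= G ^ n.+1)%N by rewrite leq_pexp2l //; clear -hq; lia.
  have big' : (mstep_big (G ^ q * V0) Dm < 2 ^ b)%N.
    by apply: leq_ltn_trans big; apply: mstep_big_mono => //; rewrite leq_mul2r Gq orbT.
  apply: ht_seq; apply: (ht_mstep (v := v) (d := d) _ s1 _ _ cv vb db dneg big') => //.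
  + by right.
  + by move=> i hi; frs; exact: hv.
  move=> m2 p s2 f2 h2 hp pd hv2 cv2 _ _.
  have f12 : fr ks m' m2 by apply: fr_trans (fr_sub2 _ f1) (fr_sub2 _ f2).
  have N2 : get m2 vN =1 get m' vN by move=> i; frs.
  have A2 : mxof (get m2 vN) = A by apply/matrixP => i j; rewrite !mxE N2.
  apply: (ht_upd (M := M') (p := p) (D := D') _ s2) => //.
  + by right.
  + by rewrite A2.
  + by frs.
  + by move=> i hi; exact: (isrow_le1 hp).
  (* The new row is independent of the old ones: [dot p d < 0], while a row with [A *m p^T = 0]
     vanishes on every column of [A], such as [d]. *)
  + rewrite A2; apply/negP => /eqP h0.
    have : (rowof p *m A) ord0 jc = 0.
      have -> : rowof p *m A = (A *m (rowof p)^T)^T by rewrite trmx_mul trmxK (projm_sym hM').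
      by rewrite h0 trmx0 mxE.
    rewrite mxE (eq_bigr (fun i : 'I_(n.+1) => p i * d i)) => [h|i _].
      by move: pd; rewrite /dot h ltxx.
    by rewrite mxE /d hd.
  + by apply: leq_ltn_trans bigD; rewrite !leq_mul2l DDm !orbT.
  move=> m3 D3 s3 f3 hM3 hD3 D3b.
  split; first by frs.
  split.
    by apply: fr_put => //; apply: fr_trans f' (fr_trans f12 (fr_sub2 _ f3)).
  exists (fun i => - dot p d * v i + dot p v * d i), (k' + 1)%N, (col_mx M' (rowof p)), D3, (row_mx X 0).
  split; first by rewrite ek addn1 addnS.
  split; last split.
  + split=> //.
    * by move=> i hi; fgets; frs; exact: hv2.
    * rewrite big_split /= -!mulr_sumr sd mulr0 addr0 mulr_gt0 //.
      by rewrite oppr_gt0.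
    * move=> i hi; have h1 := vb _ hi; have h3 := db _ hi.
      have h4 : `|dot p d| <= (n.+1 * Dm)%N%:Z.
        by apply: (isrow_dot_le hp) => i' hi'; have := db _ hi'; clear; lia.
      have h5 : `|dot p v| <= (n.+1 * (G ^ q * V0))%N%:Z.
        by apply: (isrow_dot_le hp) => i' hi'; have := vb _ hi'; clear; lia.
      rewrite -lez_nat abszE; apply: (le_trans (ler_normD _ _)); rewrite !normrM normrN.
      apply: (@le_trans _ _ ((n.+1 * Dm)%N%:Z * (G ^ q * V0)%N%:Z +
                             (n.+1 * (G ^ q * V0))%N%:Z * Dm%:Z)).
        by apply: lerD; apply: ler_pM => //; rewrite -abszE lez_nat.
      rewrite -!PoszM -PoszD lez_nat expnS -(mulnA G); move: (G ^ q * V0)%N => g'.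
      rewrite /G; clear; lia.
  + split.
    * by apply: rowsat_move => // l; exact: killd.
    * apply: rowsat_col; first by apply: rowsat_move => //; apply: killd; exact: projm_kill hM'.
      by right; split=> //; rewrite dot_lin; ring.
    * by rewrite mul_row_col mul0mx addr0.
  + split=> //.
    * rewrite (_ : mxof _ = mxof (get m3 vN)) //.
      by apply/matrixP => i j; rewrite !mxE; fgets.
    * by fgets.
    * apply: leq_trans D3b _; rewrite addn1 expnS mulnA.
      exact: leq_mul.
move=> m' s' [f' [v [k' [M' [D' [X [ek [[hv cv sv vb] [[r1 r2 eM] [hM' hD' Db']]]]]]]]]] hqq.
have {}ek : k' = n.+1 by rewrite ek addSn subnKC.
subst k'; apply: (HQ m' v M' (mxof (get m' vN)) D') => //.
Qed.

(** * Peeling off extreme rays *)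

(** Replacing [w] by [xg * w - xh * r] multiplies the denominator by [xg], hence also the older
    masses and the marginals. [vD] holds [- r], whence the changes of sign. A ray with last
    coordinate 0 gets mass 0; it only uses up excess coverage. *)
Definition recordP : prog := (
  xL ::= sc xL * sc xg ;;
  forl ii nX (vR @[ sc ii ] ::= vR $[ sc ii ] * sc xg) ;;
  forl ii (sc xn) (vX @[ sc ii ] ::= vX $[ sc ii ] * sc xg) ;;
  vX @[ sc xn ] ::= sc xh * (#0 - vD $[ nX ]) ;;
  forl ii nX (vB @[ sc xn * nX + sc ii ] ::= #0 - vD $[ sc ii ]) ;;
  xn ::= sc xn + #1)%P.

(** The row made tight by [mstepP vW] stays in [vP] and joins [vM] only in the next round; before
    the first round [vP] is the all-ones row. Once [w = 0], the remaining rounds change nothing of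
    importance. *)
Definition outer_body : prog := (
  suml xS ii (nX + #1) (vW $[ sc ii ]) ;;
  If (sc xS) (
    updP vM xD ;;
    forl ii (nX + #1) (vV @[ sc ii ] ::= vW $[ sc ii ]) ;;
    forl ii ((nX + #1) * (nX + #1)) (vN @[ sc ii ] ::= vM $[ sc ii ]) ;;
    xE ::= sc xD ;;
    walkP ;;
    forl ii (nX + #1)
      (If (vV $[ sc ii ]) (vD @[ sc ii ] ::= #0 - #1) (vD @[ sc ii ] ::= #0)) ;;
    mstepP vW ;;
    recordP) Skip)%P.

Definition outerP : prog := forl oo (nX + #1)%P outer_body.

Section Outer.

Variables (y rh : nat -> rat).
Hypothesis y_le2 : forall e, (e < n)%N -> y e <= 2%:R.
Hypothesis rh01 : forall e, (e < n)%N -> 0 <= rh e <= 1.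
Hypothesis hPP : weak_mfmc R PP.

(* [w / L] is the part of the input that is not yet decomposed; the sets with
   bits [bit i] have been recorded with masses [X i / L]. *)
Definition recs (L : int) (w : nat -> int) (c : nat) (X : nat -> int)
    (bit : nat -> nat -> int) (Rr : nat -> int) : Prop :=
  [/\ 0 < L /\ L = \sum_(i < c) X i + w n,
    forall e, (e < n)%N ->
      (\sum_(i < c) X i * bit i e + w e)%:~R <= L%:~R * y e,
    forall e, (e < n)%N -> (Rr e)%:~R = L%:~R * rh e,
    forall i, (i < c)%N -> 0 <= X i /\
      forall e, (e < n)%N -> bit i e = 0 \/ bit i e = 1 &
    forall i, (i < c)%N -> 0 < X i -> forall P, P \in PP ->
      exists2 e, e \in P & bit i (enum_rank e) = 1].

(** The ray takes [f * r e] away from coordinate [e], and the new set adds coverage [f * r n * r e],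
    which is no more since [r] is a 0/1 vector. A set of positive mass has [r n = 1], so membership
    of [r] in the cone makes it meet every member of [PP]. *)
Lemma recs_step L w c X bit Rr g f r w' X' bit' Rr' :
  recs L w c X bit Rr -> conb r -> (forall i, r i = 0 \/ r i = 1) ->
  0 < g -> 0 <= f ->
  (forall i, (i <= n)%N -> w' i = g * w i - f * r i) ->
  (forall i, (i < c)%N -> X' i = X i * g) -> X' c = f * r n ->
  (forall i e, (i < c)%N -> (e < n)%N -> bit' i e = bit i e) ->
  (forall e, (e < n)%N -> bit' c e = r e) ->
  (forall e, (e < n)%N -> Rr' e = Rr e * g) ->
  recs (L * g) w' c.+1 X' bit' Rr'.
Proof.
move=> [[L0 eL] hy hR hX hH] cr r01 g0 f0 ew eX eXc eb ebc eR; split.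
- split; first exact: mulr_gt0.
  have eS : \sum_(i < c) X' i = (\sum_(i < c) X i) * g.
    by rewrite mulr_suml; apply: eq_bigr => i _; exact: eX.
  by rewrite big_ord_recr /= eXc ew // {1}eL eS; ring.
- move=> e en; rewrite big_ord_recr /= eXc ebc // ew ?(ltnW en) //.
  rewrite (eq_bigr (fun i : 'I_c => X i * bit i e * g)) => [|i _]; last first.
    by rewrite eX // eb // mulrAC.
  rewrite -mulr_suml [(L * g)%:~R]intrM [leRHS]mulrAC.
  apply: (@le_trans _ _ ((\sum_(i < c) X i * bit i e + w e)%:~R * g%:~R)); last first.
    by rewrite ler_pM2r ?ltr0z // hy.
  rewrite -intrM ler_int mulrDl -addrA lerD2l.
  have h : f * r n * r e <= f * r e.
    by case: (r01 n) => ->; case: (r01 e) => ->; rewrite ?mulr0 ?mulr1 ?mul0r.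
  by move: h; rewrite [g * _]mulrC; clear; lia.
- by move=> e en; rewrite eR // !intrM hR // mulrAC.
- move=> i; rewrite ltnS leq_eqVlt => /orP[/eqP->|ic].
    rewrite eXc; split; first by case: (r01 n) => ->; rewrite ?mulr0 ?mulr1.
    by move=> e en; rewrite ebc.
  have [h1 h2] := hX i ic; rewrite eX //; split; first by rewrite mulr_ge0 // ltW.
  by move=> e en; rewrite eb // ; exact: h2.
- move=> i; rewrite ltnS leq_eqVlt => /orP[/eqP->|ic].
    rewrite eXc => h P hP.
    have rn : r n = 1 by case: (r01 n) h => -> //; rewrite mulr0 ltxx.
    case/andP: (cr) => _ /forallP /(_ P); rewrite hP /= rn => hs.
    case: (pickP (fun e => (e \in P) && (r (enum_rank e) == 1))) => [e /andP[eP /eqP re]|h0].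
      by exists e => //; rewrite ebc.
    exfalso; move: hs; rewrite big1 // => e eP.
    by case: (r01 (enum_rank e)) => // re; have := h0 e; rewrite eP re eqxx.
  rewrite eX // pmulr_lgt0 // => h P hP; have [e eP be] := hH i ic h P hP.
  by exists e => //; rewrite eb.
Qed.

(** The bound does not come from counting steps: [w / L] is what is left of a vector with entries at
    most 2 and last coordinate 1. So [w] stays in proportion to [L], although it is rescaled in
    every round. *)
Lemma recs_bound L w c X bit Rr i : recs L w c X bit Rr -> conb w -> (i <= n)%N ->
  (`|w i| <= 2 * `|L|)%N.
Proof.
move=> [[L0 eL] hy hR hX hH] cw hi; have w0 := conb_ge0 cw hi.
have X0 (bt : nat -> int) : (forall i, (i < c)%N -> 0 <= bt i) -> 0 <= \sum_(i < c) X i * bt i.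
  by move=> hb; apply: sumr_ge0 => j _; apply: mulr_ge0; [exact: (hX _ _).1|exact: hb].
move: hi; rewrite leq_eqVlt => /orP[/eqP e|hi].
  have S0 : 0 <= \sum_(i < c) X i by apply: sumr_ge0 => j _; exact: (hX _ _).1.
  by move: S0 eL; rewrite e in w0 *; move: (\sum_(_ < _) _) => S; clear -w0 L0; lia.
have h1 : 0 <= \sum_(j < c) X j * bit j i.
  by apply: (X0 (fun j => bit j i)) => j jc; have [_ /(_ i hi)] := hX j jc; case=> ->.
have h2 : (w i)%:~R <= (L * 2)%:~R :> rat.
  apply: (@le_trans _ _ (L%:~R * y i)); last first.
    by rewrite intrM ler_pM2l ?ltr0z // y_le2.
  by apply: le_trans (hy i hi); rewrite ler_int lerDr.
by move: h2; rewrite ler_int; clear -w0 L0; lia.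
Qed.

Lemma recs_boundX L w c X bit Rr i : recs L w c X bit Rr -> 0 <= w n -> (i < c)%N ->
  0 <= X i <= L.
Proof.
move=> [[L0 eL] hy hR hX hH] wn hi; rewrite (hX i hi).1 eL.
rewrite (bigD1 (Ordinal hi)) //= -addrA lerDl addr_ge0 // sumr_ge0 // => j _.
exact: (hX _ _).1.
Qed.

Lemma recs_boundR L w c X bit Rr e : recs L w c X bit Rr -> (e < n)%N -> (`|Rr e| <= `|L|)%N.
Proof.
move=> [[L0 _] _ hR _ _] hi; have /andP[r0 r1] := rh01 hi.
have h1 : 0 <= (Rr e)%:~R :> rat by rewrite hR // mulr_ge0 // ler0z ltW.
have h2 : (Rr e)%:~R <= L%:~R :> rat.
  by rewrite hR // -[leRHS]mulr1 ler_pM2l ?ltr0z.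
by move: h1 h2; rewrite ler0z ler_int; clear -L0; lia.
Qed.

Lemma rowsat_comb k (M : 'M[int]_(k, n.+1)) w r (a c : int) :
  rowsat M w -> rowsat M r -> rowsat M (fun i => a * w i + c * r i).
Proof.
move=> hw hr l; have [p [h1 h2]] := hw l; have [q [h3 h4]] := hr l.
exists p; split=> //; case: h2 => [h2|[h2 h5]]; first by left.
have epq j : (j <= n)%N -> p j = q j.
  by move=> hj; rewrite -(h1 (Ordinal (hj : (j < n.+1)%N))) h3.
case: h4 => [h4|[h4 h6]]; first by left=> j hj; rewrite epq // h4.
by right; split=> //; rewrite dot_lin h5 (eq_dotl _ epq) h6; ring.
Qed.

Lemma rowsat_supp k (M : 'M[int]_(k, n.+1)) v :
  rowsat M v -> (forall p, isrow p -> dot p v = 0 -> dot p (supp v) = 0) ->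
  rowsat M (supp v).
Proof.
move=> hv hs l; have [p [h1 h2]] := hv l; exists p; split=> //.
case: h2 => [h2|[h2 h3]]; [by left|by right; split=> //; exact: hs].
Qed.

Variable L0 : nat.
Hypothesis L0_gt0 : (0 < L0)%N.
Let Dm := ((n.+1 * n.+1) ^ n.+1)%N.
(** Twice the largest denominator: it starts at [L0] or less and is multiplied by at most [n + 1] in
    each of the [n + 1] rounds. *)
Let V0 := (2 * (L0 * n.+1 ^ n.+1))%N.
Hypothesis big : (mstep_big ((2 * n.+1 * Dm) ^ n.+1 * V0) Dm < 2 ^ b)%N.

Lemma mstep_big_V (V D : nat) : (V <= mstep_big V D)%N.
Proof.
rewrite /mstep_big; apply: (@leq_trans (n.+1 * V + 1)).
  by apply: leq_trans (leq_addr _ _); rewrite leq_pmull.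
by rewrite mulnAC leq_pmull // muln_gt0 !addn1.
Qed.

Lemma V0_lt : (V0 < 2 ^ b)%N.
Proof.
apply: leq_ltn_trans big; apply: leq_trans (mstep_big_V _ _).
by rewrite leq_pmull // expn_gt0 !muln_gt0 expn_gt0.
Qed.

Lemma mstep_big_1 : (mstep_big V0 1 < 2 ^ b)%N.
Proof.
apply: leq_ltn_trans big; apply: mstep_big_mono; last by rewrite expn_gt0.
by rewrite leq_pmull // expn_gt0 !muln_gt0 expn_gt0.
Qed.

Lemma fr_get ks m m' k : fr ks m m' -> k \notin ks -> (0 < k < nids)%N ->
  get m' k = get m k.
Proof.
move=> h hk hv; apply: functional_extensionality => i; apply: h => //.
exact: valid0.
Qed.

Definition bits (m : memory) (i e : nat) : int := get m vB (i * n + e)%N.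

Lemma ht_record m (L : int) (w : nat -> int) (c : nat) (g f : int) (r w' : nat -> int) (Q : memory -> Prop) :
  st m -> get m xn 0 = c -> (c <= n)%N -> get m xL 0 = L -> get m xg 0 = g ->
  get m xh 0 = f -> (forall i, (i <= n)%N -> get m vD i = - r i) ->
  recs L w c (get m vX) (bits m) (get m vR) ->
  conb r -> (forall i, r i = 0 \/ r i = 1) -> 0 < g -> 0 <= f ->
  (forall i, (i <= n)%N -> w' i = g * w i - f * r i) -> conb w ->
  conb w' -> (`|L * g| < (2 ^ b)%N%:Z) ->
  (forall m', st m' -> fr [:: ii; xL; vR; vX; vB; xn] m m' ->
     get m' xn 0 = c.+1 -> get m' xL 0 = L * g ->
     recs (L * g) w' c.+1 (get m' vX) (bits m') (get m' vR) -> Q m') ->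
  ht recordP m Q.
Proof.
move=> hs hc cn hL hg hf hd hr cr r01 g0 f0 ew' cw cw' Lg HQ.
have L1 : 0 < L by case: hr => [[]].
pose X' i := if i == c then f * r n else get m vX i * g.
pose bit' i e := if i == c then r e else bits m i e.
pose R' e := get m vR e * g.
have hr' : recs (L * g) w' c.+1 X' bit' R'.
  apply: (recs_step hr cr r01 g0 f0 ew') => //.
  - by move=> i ic; rewrite /X' ltn_eqF.
  - by rewrite /X' eqxx.
  - by move=> i e ic _; rewrite /bit' ltn_eqF.
  - by move=> e _; rewrite /bit' eqxx.
have Lgb : (`|(L * g)%R| < 2 ^ b)%N by clear -Lg; lia.
have w'n : 0 <= w' n by apply: (conb_ge0 cw').
have X'b i : (i < c.+1)%N -> (`|X' i| < 2 ^ b)%N.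
  by move=> ic; have := recs_boundX hr' w'n ic; move=> h; clear -h Lgb; lia.
have cb : (c.+1 <= B)%N by clear -cn B_ge; lia.
have cb' : (c.+1 < 2 ^ b)%N by clear -cn b_ge; lia.
apply: ht_seq; apply: (ht_sset (w := L * g)) => //; first by evs; rewrite hL hg.
set m1 := put _ _ _ _ => s1.
have f1 : fr [:: xL] m m1 by apply: fr_put.
have L1' : get m1 xL 0 = L * g by rewrite /m1; fgets.
move: m1 s1 f1 L1' => m1 s1 f1 L1'.
apply: ht_seq; apply: (ht_map0 (f := R') (N := n)) => //.
- exact: ltnW.
- exact: ltnW.
- by move=> m' s' _; evs.
- by move=> j hj; apply: leq_ltn_trans Lgb; exact: (recs_boundR hr').
- by move=> j m' s' hj f' hp hj'; evs; arx j => //; rewrite hp ltnn; frs; rewrite hg.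
move=> m2 s2 f2 h2.
apply: ht_seq; apply: (ht_map0 (f := X') (N := c)) => //.
- exact: ltnW.
- exact: ltnW.
- by move=> m' s' f'; evs; frs.
- by move=> j hj; apply: X'b; exact: ltnW.
- move=> j m' s' hj f' hp hj'; evs; arx j => //; rewrite hp ltnn; frs.
  by rewrite hg /X' ltn_eqF.
move=> m3 s3 f3 h3.
apply: ht_seq; apply: (ht_aset (i := c) (w := X' c)) => //.
- by evs; frs.
- by evs; arx (nelts E) => //; frs; rewrite hf hd // sub0r opprK /X' eqxx.
- exact: X'b.
set m4 := put _ _ _ _ => s4.
have f4 : fr [:: vX] m3 m4 by apply: fr_put.
have h4 i : (i < c.+1)%N -> get m4 vX i = X' i.
  rewrite ltnS leq_eqVlt /m4; fgets; rewrite eq_sym; case: eqP => [->//|_ /= ic].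
  by rewrite h3 ic.
move: m4 s4 f4 h4 => m4 s4 f4 h4.
apply: ht_seq; apply: (ht_map (f := r) (N := n) (o := (c * n)%N) ) => //.
- exact: ltnW.
- exact: ltnW.
- by move=> m' s' _; evs.
- move=> j hj; case: (r01 j) => ->; first exact: lt0b.
  by clear -b_ge; lia.
- move=> j m' s' hj f' hp hj'; split; last first.
    by evs; arx j => //; frs; rewrite hd ?sub0r ?opprK // ltnW.
  by evs; frs; rewrite hj' hc; clear; lia.
move=> m5 s5 f5 h5.
apply: (ht_sset (w := c.+1)) => //.
  by evs; frs; rewrite hc; clear; lia.
move=> s6; apply: HQ => //.
- apply: fr_put => //; apply: fr_trans (fr_sub2 _ f1) (fr_trans (fr_sub2 _ f2)
    (fr_trans (fr_sub2 _ f3) (fr_trans (fr_sub2 _ f4) (fr_sub2 _ f5)))) => //.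
- by fgets.
- by fgets; frs.
have gX i : (i < c.+1)%N -> get (put m5 xn 0 c.+1) vX i = X' i.
  by move=> ic; fgets; frs; exact: h4.
have gR e : (e < n)%N -> get (put m5 xn 0 c.+1) vR e = R' e.
  by move=> en; fgets; frs; rewrite h2 en.
have gB i e : (i < c.+1)%N -> (e < n)%N -> bits (put m5 xn 0 c.+1) i e = bit' i e.
  rewrite ltnS leq_eqVlt /bits /bit' => ic en; fgets; rewrite h5 //.
  case: eqP ic => [->|_] /= ic; first by rewrite leq_addr ltn_add2l en /= addKn.
  rewrite (_ : (c * n <= i * n + e)%N = false) /=; first by frs.
  by apply/negbTE; rewrite -ltnNge; clear -ic en; nia.
apply: (recs_step (r := r) hr cr r01 g0 f0 ew') => //.
- by move=> i ic; have ic' : (i < c.+1)%N := ltnW ic; rewrite gX // /X' ltn_eqF.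
- by rewrite gX // /X' eqxx.
- by move=> i e ic en; have ic' : (i < c.+1)%N := ltnW ic; rewrite gB // /bit' ltn_eqF.
- by move=> e en; rewrite gB // /bit' eqxx.
Qed.

(** After [o] rounds [M] has [o] rows, and the pending row [p] is independent of them. For
    [o = n + 1] this is impossible, which leaves [w = 0]. The all-ones row is sought in
    [col_mx M (rowof p)] because before the first round it is itself the pending one. *)
Definition outerI (o : nat) (m : memory) : Prop :=
  exists (L : int) (w : nat -> int) (c : nat),
  [/\ get m xn 0 = c /\ (c <= o)%N, get m xL 0 = L /\ (`|L| <= L0 * n.+1 ^ o)%N,
    (forall i, (i <= n)%N -> get m vW i = w i) /\ conb w,
    recs L w c (get m vX) (bits m) (get m vR) &
    \sum_(i < n.+1) w i = 0 \/
    0 < \sum_(i < n.+1) w i /\ exists k (M : 'M[int]_(k, n.+1)) D p, k = o /\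
    [/\ projm M (mxof (get m vM)) D,
       get m xD 0 = D /\ (`|D| <= (n.+1 * n.+1) ^ o)%N,
       rowsat M w,
       (forall i, (i <= n)%N -> get m vP i = p i) /\ (forall i, (i <= n)%N -> `|p i| <= 1) /\
       ((forall j, (j <= n)%N -> p j = 1) \/ (isrow p /\ dot p w = 0)) &
       mxof (get m vM) *m (rowof p)^T != 0 /\
       exists l, forall j, col_mx M (rowof p) l j = 1]].

Lemma ht_outer_body (o : nat) m (Q : memory -> Prop) :
  st m -> outerI o m -> (o < n.+1)%N -> get m oo 0 = o ->
  (forall m', st m' -> get m' oo 0 = o -> outerI o.+1 m' -> Q m') ->
  ht outer_body m Q.
Proof.
move=> hs [L [w [c [[hc co] [hL Lb] [hw cw] hr hI]]]] on ho HQ.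
have L1 : 0 < L by case: hr => [[]].
have LV : (2 * `|L| <= V0)%N.
  rewrite leq_mul2l /=; apply: leq_trans Lb _; rewrite leq_mul2l leq_pexp2l ?orbT //.
  exact: ltnW.
have wb i : (i <= n)%N -> (`|w i| <= V0)%N.
  by move=> hi; apply: leq_trans (recs_bound hr cw hi) LV.
have wb' i : (i <= n)%N -> (`|w i| < 2 ^ b)%N.
  by move=> hi; apply: leq_ltn_trans (wb _ hi) V0_lt.
have VN : (n.+1 * V0 < 2 ^ b)%N.
  apply: leq_ltn_trans mstep_big_1; rewrite /mstep_big mulnAC.
  by apply: (@leq_trans (n.+1 * V0 + 1)); rewrite ?leq_addr // leq_pmull // muln_gt0 !addn1.
apply: ht_seq; apply: (ht_sum (f := w) (N := n.+1)) => //.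
- by move=> m' s' _; exact: (ev_n1 s').
- move=> j hj; apply: leq_ltn_trans VN; apply: (@leq_trans (j * V0)); last by rewrite leq_mul2r hj orbT.
  by apply: absz_sum => i hi; apply: wb; rewrite -ltnS (leq_trans hi).
- by move=> j m' s' hj f' hj'; arx j => //; frs; rewrite hw.
move=> m1 s1 f1 h1.
apply: (ht_if s1); evs; rewrite h1; last first.
  move=> sw; apply: ht_skip => //; apply: HQ => //; first by frs.
  exists L, w, c; split.
  - by frs; split=> //; exact: leqW.
  - frs; split=> //; apply: leq_trans Lb _; rewrite leq_mul2l expnS leq_pmull ?orbT //.
  - by split=> // i hi; frs; exact: hw.
  - by rewrite (_ : bits m1 = bits m) ?(fr_get f1) // /bits (fr_get f1).
  - left; apply/eqP; rewrite eq_le sw /= sumr_ge0 // => i _.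
    by apply: (conb_ge0 cw); rewrite -ltnS.
move=> sw.
case: hI => [s0|[_ [k [M [D [p [ek [hM [hD Db] hrw [hp [p1 pt]] [Ap [l0 hl0]]]]]]]]]].
  by rewrite s0 ltxx in sw.
have M1 : mxof (get m1 vM) = mxof (get m vM).
  by apply/matrixP => i j; rewrite !mxE; frs.
have Dp : 0 < D by case: hM.
have DmE : (`|D| * (n.+1 * n.+1) <= Dm)%N.
  apply: (@leq_trans ((n.+1 * n.+1) ^ o.+1)); first by rewrite expnSr leq_mul2r Db orbT.
  by rewrite /Dm leq_pexp2l.
have bigD : (n.+1 * (n.+1 * Dm) < 2 ^ b)%N by apply: leq_ltn_trans (mstep_big_D _ _) big.
apply: ht_seq; apply: (ht_upd (M := M) (p := p) (D := D) _ s1) => //.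
- by left.
- by rewrite M1.
- by frs.
- by move=> i hi; frs; exact: hp.
- by rewrite M1.
- apply: leq_ltn_trans bigD; rewrite mulnA mulnC; apply: (leq_trans DmE).
  by rewrite mulnA leq_pmull.
move=> m2 D2 s2 f2 hM2 hD2 D2b; set M2 := col_mx M (rowof p) in hM2 *.
have Db2 : (`|D2| <= (n.+1 * n.+1) ^ o.+1)%N.
  by apply: leq_trans D2b _; rewrite mulnA expnS; apply: leq_mul.
have Db2m : (`|D2| <= Dm)%N by apply: leq_trans Db2 _; rewrite /Dm leq_pexp2l.
have Dmb : (Dm < 2 ^ b)%N.
  by apply: leq_ltn_trans bigD; rewrite mulnA leq_pmull.
have hrw2 : rowsat M2 w by exact: rowsat_col.
have Mb i j : (i <= n)%N -> (j <= n)%N -> (`|get m2 vM (i * n.+1 + j)| < 2 ^ b)%N.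
  move=> hi hj; have := projm_le hM2 (Ordinal (hi : (i < n.+1)%N)) (Ordinal (hj : (j < n.+1)%N)).
  by rewrite mxE /= => h; apply: leq_ltn_trans Dmb; clear -h Db2m; lia.
apply: ht_seq; apply: (ht_map0 (f := w) (N := n.+1)) => //.
- by move=> m' s' _; exact: (ev_n1 s').
- by move=> j m' s' hj f' _ hj'; arx j => //; frs; rewrite hw.
move=> m3 s3 f3 h3.
apply: ht_seq; apply: (ht_map0 (f := get m2 vM) (N := (n.+1 * n.+1)%N)) => //.
- by move=> m' s' _; evs; rewrite -PoszD addn1.
- move=> t ht; rewrite (divn_eq t n.+1); apply: Mb; rewrite -ltnS ?ltn_mod //.
  by rewrite ltn_divLR.
- by move=> j m' s' hj f' _ hj'; arx j => //; frs.
move=> m4 s4 f4 h4.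
apply: ht_seq; apply: (ht_sset (w := D2)) => //; first by evs; frs.
  exact: leq_ltn_trans Db2m Dmb.
move=> s5; set m5 := put _ _ _ _ in s5 *.
have f5 : fr [:: xE] m4 m5 by exact: fr_put.
have D5 : get m5 xE 0 = D2 by rewrite /m5; fgets.
move: m5 s5 f5 D5 => m5 s5 f5 D5.
have A5 : mxof (get m5 vN) = mxof (get m2 vM).
  apply/matrixP => i j; rewrite !mxE; frs; rewrite h4 (_ : (_ < _)%N) //.
  by have := ltn_ord i; have := ltn_ord j; clear; nia.
have on' : (o <= n)%N by rewrite -ltnS.
apply: ht_seq; apply: (ht_walk (o := o) (M := M2) (D := D2) (v0 := w) (V0 := V0)) => //.
- by rewrite ek addn1.
- by frs.
- by rewrite A5.
- by move=> i hi; frs; rewrite h3 ltnS hi.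
- by exists l0.
move=> m6 v M' A' D' s6 f6 hv cv sv hMv hM' hMv'.
have tight := supp_tight hPP cv hM' hMv'.
have hMr : rowsat M2 (supp v) by exact: rowsat_supp.
have cr := conb_supp cv.
have r01 i : supp v i = 0 \/ supp v i = 1.
  by rewrite /supp; case: (0 < v i); [right|left].
pose d i := - supp v i.
pose I2 j m' := fr [:: ii; vD] m6 m' /\ forall i, (i < j)%N -> get m' vD i = d i.
apply: ht_seq; apply: (ht_for (I := I2) (N := n.+1)) => //.
- by split; first exact: fr_put.
- by move=> j m' s' _; exact: (ev_n1 s').
- move=> j m' s' hj [f' h'] hj'.
  have e1 : eval m' (vV $[ sc ii ])%P = v j.
    by arx j => //; frs; rewrite hv.
  have hset x (vx : expr) : eval m' vx = x -> x = d j ->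
      ht (aset vD (sc ii) vx) m' (fun m'' => get m'' ii 0 = j /\ I2 j.+1 (put m'' ii 0 j.+1)).
    move=> hx xd; apply: (ht_aset (i := j) (w := d j)) => //; first by evs.
    - by rewrite hx.
    - by rewrite /d; case: (r01 j) => ->; rewrite ?oppr0 //; clear -b_ge; lia.
    move=> s''; split; first by fgets.
    split; first by do 2!(apply: fr_put => //).
    move=> i; rewrite ltnS leq_eqVlt; fgets; rewrite eq_sym; case: eqP => [->//|_ /= hi].
    exact: h'.
  apply: (ht_if s'); rewrite e1 => hvj; first by apply: (hset (-1)) => //; rewrite /d /supp hvj.
  by apply: (hset 0) => //; rewrite /d /supp ltNge hvj.
move=> m7 s7 [f7 h7] _.
have [i1 hi1 vi1] : exists2 i, (i <= n)%N & 0 < v i.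
  case: (pickP (fun i : 'I_(n.+1) => 0 < v i)) => [i hi|h0]; first by exists i => //; rewrite -ltnS.
  exfalso; move: sv; rewrite ltNge sumr_le0 // => i _.
  by have := h0 i; rewrite ltNge => /negbT; rewrite negbK.
have dotd q : dot q d = - dot q (supp v).
  by rewrite /dot -sumrN; apply: eq_bigr => i _; rewrite /d mulrN.
apply: ht_seq; apply: (ht_mstep (v := w) (d := d) (Vb := V0) (Db := 1) _ s7) => //.
- by left.
- by move=> i hi; frs; exact: hw.
- by move=> i _; rewrite /d; case: (r01 i) => ->.
- by exists i1 => //; rewrite /d /supp vi1.
- exact: mstep_big_1.
move=> m8 q s8 f8 hq rq qd hw8 cw8 g8 f8'.
pose g := dot q (supp v); pose f := dot q w.
have g0 : 0 < g by rewrite /g -oppr_lt0 -dotd.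
have f0 : 0 <= f by move/conbP: cw; apply.
rewrite dotd opprK -/g in g8 hw8 cw8; rewrite -/f in f8' hw8 cw8.
(* Both [q] and [supp v] have entries of absolute value at most 1, so the denominator grows by a
   small factor whatever the sizes met during the walk. *)
have gn : (`|g| <= n.+1)%N.
  have := isrow_dot_le (d := supp v) (X := 1) rq.
  rewrite muln1 -/g => h; suff : `|g| <= n.+1%:Z by clear; lia.
  by apply: h => i _; case: (r01 i) => ->.
have Lgb : (`|(L * g)%R| <= L0 * n.+1 ^ o.+1)%N.
  by rewrite abszM expnSr mulnA; apply: leq_mul.
pose w' i := g * w i + f * d i.
have ew' i : (i <= n)%N -> w' i = g * w i - f * supp v i by rewrite /w' /d mulrN.
have hr8 : recs L w c (get m8 vX) (bits m8) (get m8 vR).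
  have fm8 : fr [:: 0; ii; jj; kk; qq; vV; vW; vU; vP; vD; vN; vM; vY; xD; xE; xS; xB; xQ; xlo;
      xhi; xmid; xf; xi; xt; xg; xh; xs; xj]%N m m8.
    apply: fr_trans (fr_sub2 _ f1) (fr_trans (fr_sub2 _ f2) (fr_trans (fr_sub2 _ f3)
      (fr_trans (fr_sub2 _ f4) (fr_trans (fr_sub2 _ f5) (fr_trans (fr_sub2 _ f6)
      (fr_trans (fr_sub2 _ f7) (fr_sub2 _ f8))))))) => //.
  by rewrite (_ : bits m8 = bits m) ?(fr_get fm8) // /bits (fr_get fm8).
apply: (ht_record (L := L) (w := w) (c := c) (g := g) (f := f) (r := supp v) (w' := w')) => //.
- by frs.
- by apply: leq_trans co _.
- by frs.
- by move=> i hi; frs; rewrite h7.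
- have := leq_ltn_trans (leq_trans Lgb _) V0_lt; rewrite -ltz_nat abszE; apply.
  by rewrite /V0 mul2n -addnn; apply: leq_trans (leq_addr _ _); rewrite leq_mul2l leq_pexp2l ?orbT.
move=> m9 s9 f9 c9 L9 hr9.
apply: HQ => //; first by frs.
exists (L * g), w', c.+1; split=> //.
- by split=> // i hi; frs; rewrite hw8.
have w'0 i : (i <= n)%N -> 0 <= w' i by apply: (conb_ge0 cw8).
case: (ltrP 0 (\sum_(i < n.+1) w' i)) => sw'; last first.
  left; apply/eqP; rewrite eq_le sw' /= sumr_ge0 // => i _.
  by apply: w'0; rewrite -ltnS.
right; split=> //.
have hMw' : rowsat M2 w'.
  rewrite /w' /d => l; have := @rowsat_comb _ M2 w (supp v) g (- f) hrw2 hMr l.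
  move=> [q' [q1 q2]]; exists q'; split=> //; case: q2 => [q2|[q2 q3]]; [by left|right; split=> //].
  by rewrite -q3; apply: eq_dotr => i _; rewrite mulrN mulNr.
have qw' : dot q w' = 0 by rewrite dot_lin dotd -/f -/g; ring.
have A9 : mxof (get m9 vM) = mxof (get m2 vM) by apply/matrixP => i j; rewrite !mxE; frs.
exists (k + 1)%N, M2, D2, q; split; first by rewrite ek addn1.
split=> //.
- by rewrite A9.
- by split=> //; frs.
- split; first by move=> i hi; frs; exact: hq.
  split; first by move=> i hi; exact: (isrow_le1 rq).
  by right.
- split; last by exists (lshift 1 l0) => j; rewrite col_mxEu.
  (* The tight rows of [M2] vanish at the ray as well as at [w'], whereas [q] vanishes at [w'] and
     takes the value [g > 0] at the ray. *)
  rewrite A9; apply: (indep_outer hM2 hMw' qw' _ sw' hMr).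
  by rewrite gt_eqF.
Qed.

Lemma outerI_put o m (v : int) : outerI o m -> outerI o (put m oo 0 v).
Proof.
have f1 : fr [:: oo] m (put m oo 0 v) by exact: fr_put.
rewrite /outerI; rewrite (_ : bits (put m oo 0 v) = bits m); last by rewrite /bits (fr_get f1).
by rewrite !(fr_get f1).
Qed.

Lemma ht_outer m (Q : memory -> Prop) : st m -> outerI 0 m ->
  (forall m' c L, st m' -> get m' xn 0 = Posz c -> (c <= n.+1)%N -> get m' xL 0 = L ->
    (`|L| < 2 ^ b)%N ->
    recs L (fun=> 0) c (get m' vX) (bits m') (get m' vR) -> Q m') ->
  ht outerP m Q.
Proof.
move=> hs I0 HQ; apply: (ht_for (I := outerI) (N := n.+1)) => //.
- exact: outerI_put.
- by move=> j m' s' _; exact: (ev_n1 s').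
- move=> j m' s' hj hI hj'; apply: (ht_outer_body s' hI hj hj') => m'' s'' hj'' hI'.
  by split=> //; exact: outerI_put.
move=> m' s' [L [w [c [[hc co] [hL Lb] [hw cw] hr hI]]]] _.
have w0 i : (i <= n)%N -> w i = 0.
  case: hI => [sw hi|[sw [k [M [D [p [ek [hM _ _ _ [Ap _]]]]]]]]].
    have w0 (j : 'I_(n.+1)) : true -> 0 <= w j by move=> _; apply: (conb_ge0 cw); rewrite -ltnS.
    exact: (psumr_eq0P w0 sw (i := Ordinal (hi : (i < n.+1)%N))).
  by move: Ap; rewrite (projm_full hM ek) mul0mx eqxx.
have LV : (`|L| < 2 ^ b)%N.
  apply: leq_ltn_trans V0_lt; apply: (leq_trans Lb); rewrite /V0 mul2n -addnn.
  exact: leq_addr.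
apply: (HQ _ c L) => //.
case: hr => [[r0 r1] r2 r3 r4 r5]; split=> //.
- by split=> //; rewrite r1 w0.
- by move=> e en; have := r2 e en; rewrite w0 // ltnW.
Qed.
End Outer.

(** * Correcting the marginals *)

(* An element splits at most one set, hence [2 * n + 1] sets at the end. *)
Definition flip_body : prog := (
  If (#1 - (vB $[ sc ii * nX + sc kk ] - sc xb) * (vB $[ sc ii * nX + sc kk ] - sc xb))
    (If (sc xc - vX $[ sc ii ] + #1)
      (vB @[ sc ii * nX + sc kk ] ::= #1 - sc xb ;;
       xc ::= sc xc - vX $[ sc ii ])
      (If (sc xc) (
        forl jj nX (vB @[ sc xn * nX + sc jj ] ::= vB $[ sc ii * nX + sc jj ]) ;;
        vB @[ sc xn * nX + sc kk ] ::= #1 - sc xb ;;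
        vX @[ sc xn ] ::= sc xc ;;
        vX @[ sc ii ] ::= vX $[ sc ii ] - sc xc ;;
        xc ::= #0 ;;
        xn ::= sc xn + #1) Skip)) Skip)%P.

(** [xb] is the bit to be changed, 1 if the element is covered too much, and [xc] the mass still to
    be changed. The range of the loop is frozen in [xm]: a set split off is appended with its bit
    already changed. *)
Definition flip_elt : prog := (
  suml xc ii (sc xn) (vX $[ sc ii ] * vB $[ sc ii * nX + sc kk ]) ;;
  xc ::= sc xc - vR $[ sc kk ] ;;
  If (#0 - sc xc) (xc ::= #0 - sc xc ;; xb ::= #0) (xb ::= #1) ;;
  xm ::= sc xn ;;
  forl ii (sc xm) flip_body)%P.

Definition flipP : prog := forl kk nX flip_elt.

(** Total mass, marginals and missed mass are all of this form, so one formula describes the effect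
    of a toggle or a merge on all of them. *)
Definition mass (c : nat) (X : nat -> int) (T : nat -> {set E}) (phi : {set E} -> int) : int :=
  \sum_(i < c) X i * phi (T i).

Definition hit (e : E) (S : {set E}) : int := (e \in S)%:Z.
Definition miss (P S : {set E}) : int := (S :&: P == set0)%:Z.
Definition toggle (bb : bool) (e : E) (S : {set E}) : {set E} :=
  if bb then S :\ e else e |: S.

Lemma mass_toggle c X T T' i0 phi S' : (i0 < c)%N ->
  T' i0 = S' -> (forall i, i != i0 -> T' i = T i) ->
  mass c X T' phi = mass c X T phi + X i0 * (phi S' - phi (T i0)).
Proof.
move=> ic e1 e2; rewrite /mass (bigD1 (Ordinal ic)) //= [in RHS](bigD1 (Ordinal ic)) //= e1.
rewrite (eq_bigr (fun i : 'I_c => X i * phi (T i))); first by ring.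
by move=> i; rewrite -val_eqE /= => hi; rewrite e2.
Qed.

Lemma mass_split c X X' T T' i0 phi S' cc : (i0 < c)%N ->
  T' c = S' -> (forall i, (i < c)%N -> T' i = T i) ->
  X' c = cc -> X' i0 = X i0 - cc -> (forall i, (i < c)%N -> i != i0 -> X' i = X i) ->
  mass c.+1 X' T' phi = mass c X T phi + cc * (phi S' - phi (T i0)).
Proof.
move=> ic e1 e2 e3 e4 e5; rewrite /mass big_ord_recr /= e1 e3.
rewrite (bigD1 (Ordinal ic)) //= [in RHS](bigD1 (Ordinal ic)) //= e4 e2 //.
rewrite (eq_bigr (fun i : 'I_c => X i * phi (T i))); first by ring.
by move=> i; rewrite -val_eqE /= => hi; rewrite e5 // e2.
Qed.

(** [cc] is the mass still to be toggled. While [e0] is being removed, the toggles to come can make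
    at most [cc] more mass miss a [P] containing [e0]; this reserve turns the bound on the missed
    mass into an invariant. *)
Definition flipinv (L : int) (s : E -> int) (UB : {set E} -> int) (e0 : E) (bb : bool)
    (Re : int) (c : nat) X T (cc : int) : Prop :=
  [/\ mass c X T (fun=> 1) = L,
    forall e, e != e0 -> mass c X T (hit e) = s e,
    mass c X T (hit e0) = Re + (bb%:Z *+ 2 - 1) * cc &
    forall P, P \in PP -> mass c X T (miss P) + (e0 \in P)%:Z * bb%:Z * cc <= UB P].

(** Toggling mass [cc - cc'] of the set [S] leaves the other marginals alone. Only the removal of an
    [e0] in [P] can make [S] miss [P], and the reserve then shrinks by the same amount. *)
Lemma flipinv_step L s UB e0 bb Re c X T (cc : int) c' X' T' (cc' : int) (S : {set E}) :
  flipinv L s UB e0 bb Re c X T cc -> 0 <= cc - cc' -> (e0 \in S) = bb ->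
  (forall phi, mass c' X' T' phi =
     mass c X T phi + (cc - cc') * (phi (toggle bb e0 S) - phi S)) ->
  flipinv L s UB e0 bb Re c' X' T' cc'.
Proof.
move=> [h1 h2 h3 h4] d0 e0S hm; split.
- by rewrite hm h1 subrr mulr0 addr0.
- move=> e ee0; rewrite hm h2 // /hit /toggle.
  by case: (bb); rewrite !inE ?(negbTE ee0) subrr mulr0 addr0.
- rewrite hm h3 /hit e0S /toggle; case: (bb); rewrite !inE eqxx /=; ring.
- move=> P hP; have := h4 P hP; rewrite hm.
  have h : miss P (toggle bb e0 S) - miss P S <= (e0 \in P)%:Z * bb%:Z.
    clear h1 h2 h3 h4 hm; rewrite /miss /toggle; case: (boolP (e0 \in P)) => eP; case: bb e0S => e0S.
    - by rewrite mulr1; do 2!case: eqP.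
    - rewrite mulr0 subr_le0; case: eqP => //= h; exfalso.
      by move/setP/(_ e0): h; rewrite !inE eqxx eP.
    - have -> : (S :\ e0) :&: P = S :&: P.
        apply/setP => e; rewrite !inE; case: eqP => [->|//].
        by rewrite (negbTE eP) !andbF.
      by rewrite subrr.
    - have -> : (e0 |: S) :&: P = S :&: P.
        apply/setP => e; rewrite !inE; case: eqP => [->|//].
        by rewrite (negbTE eP) !andbF.
      by rewrite subrr.
  move: (mass _ _ _ _) (miss P _ - _) ((e0 \in P)%:Z * bb%:Z) (UB P) h d0 => a d f u.
  by clear; nia.
Qed.

Definition tset (m : memory) (i : nat) : {set E} :=
  [set e | get m vB (i * n + enum_rank e)%N != 0].

Definition good (L : int) (c : nat) (m : memory) : Prop :=
  get m xn 0 = c /\ forall i, (i < c)%N -> 0 <= get m vX i <= L /\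
    forall e, (e < n)%N -> get m vB (i * n + e)%N = 0 \/ get m vB (i * n + e)%N = 1.

Lemma idx_inj i j e f : (e < n)%N -> (f < n)%N -> (i * n + e == j * n + f)%N = (i == j) && (e == f).
Proof.
move=> he hf; apply/eqP/andP => [h|[/eqP-> /eqP->] //].
have h1 : i = j.
  by have := congr1 (fun x => (x %/ n)%N) h; rewrite !divnMDl ?divn_small ?addn0 //; lia.
by split; apply/eqP => //; subst j; move/addnI: h.
Qed.

Lemma bit_hit c L m i (e : E) : good L c m -> (i < c)%N ->
  get m vB (i * n + enum_rank e)%N = hit e (tset m i).
Proof.
move=> [_ h] ic; have [_ /(_ _ (ltn_ord (enum_rank e)))] := h i ic.
by rewrite /hit inE; case=> ->.
Qed.

Lemma eq_tset m m' i : (forall e, (e < n)%N -> get m' vB (i * n + e)%N = get m vB (i * n + e)%N) ->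
  tset m' i = tset m i.
Proof. by move=> h; apply/setP => e; rewrite !inE h. Qed.

Lemma tset_put m j (e0 : E) (bb : bool) i :
  tset (put m vB (j * n + enum_rank e0) (1 - bb%:Z)) i =
  if i == j then toggle bb e0 (tset m j) else tset m i.
Proof.
apply/setP => e; rewrite inE; fgets; rewrite idx_inj // (eq_sym j).
case: (i =P j) => [->|_] /=; last by rewrite inE.
rewrite (_ : (enum_rank e0 == enum_rank e :> nat) = (e == e0)).
  by rewrite /toggle; case: bb; rewrite !inE; case: (e =P e0).
by rewrite eq_sym; apply/eqP/eqP => [/val_inj/enum_rank_inj|->].
Qed.

Section Element.
Variables (L : int) (s : E -> int) (UB : {set E} -> int) (e0 : E) (bb : bool) (Re : int)
  (c0 : nat) (m0 : memory).
Hypothesis L_lt : (`|L| < 2 ^ b)%N.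
Hypothesis c0_le : (c0 <= 2 * n)%N.

(** A split exhausts [cc]. So as long as [cc] is positive, no set has been appended and all sets
    visited have the changed bit. *)
Definition flipI (j : nat) (m : memory) : Prop :=
  fr [:: ii; jj; vB; xc; vX; xn] m0 m /\ exists (c : nat) (cc : int),
    [/\ good L c m, get m xc 0 = cc /\ 0 <= cc <= L,
     flipinv L s UB e0 bb Re c (get m vX) (tset m) cc,
     (c0 <= c <= c0.+1)%N &
     0 < cc -> c = c0 /\ forall i, (i < j)%N -> (e0 \in tset m i) = ~~ bb].

Lemma flipI_put j m (v : int) : flipI j m -> flipI j (put m ii 0 v).
Proof.
move=> [f1 [c [cc [[g1 g2] [h1 h2] h3 h4 h5]]]].
have f2 : fr [:: ii] m (put m ii 0 v) by exact: fr_put.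
have tE : tset (put m ii 0 v) = tset m by rewrite /tset (fr_get f2).
split; first exact: fr_put.
exists c, cc; rewrite tE (fr_get f2 (k := vX)) //; split=> //.
- by split; [fgets|rewrite !(fr_get f2)].
- by split=> //; fgets.
Qed.

Lemma ht_flip_body j m (Q : memory -> Prop) : st m -> (j < c0)%N ->
  flipI j m -> get m ii 0 = j -> get m0 xb 0 = bb%:Z -> get m0 kk 0 = enum_rank e0 ->
  (forall m', st m' -> flipI j.+1 m' -> get m' ii 0 = j -> Q m') ->
  ht flip_body m Q.
Proof.
move=> hs jc [f1 [c [cc [hg [hcc ccL] hf hc hp]]]] hii hbb hkk HQ.
have jc' : (j < c)%N by clear -jc hc; lia.
have [_ /(_ j jc') [X0L bits01]] := hg.
pose S := tset m j; pose X := get m vX j.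
have bE : get m vB (j * n + enum_rank e0)%N = hit e0 S by exact: bit_hit hg jc'.
have kkE : get m kk 0 = enum_rank e0 by frs.
have xbE : get m xb 0 = bb%:Z by frs.
have evb m' : st m' -> get m' ii 0 = j -> get m' kk 0 = enum_rank e0 ->
    eval m' (sc ii * nX + sc kk)%P = (j * n + enum_rank e0)%N.
  by move=> s' h1 h2; evs; rewrite h1 h2; clear; lia.
have bb01 : (`|(1 - bb%:Z)%R| < 2 ^ b)%N by case: (bb); clear -b_ge; lia.
apply: (ht_if hs); evs; rewrite (ev_ar vB hs (evb m hs hii kkE)) bE xbE => gd; last first.
  apply: ht_skip => //; apply: HQ => //; split=> //.
  exists c, cc; split=> // /hp [h1 h2]; split=> // i; rewrite ltnS leq_eqVlt => /orP[/eqP->|/h2 //].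
  by move: gd; rewrite /hit -/S; case: (e0 \in S); case: (bb).
have e0S : (e0 \in S) = bb by move: gd; rewrite /hit; case: (e0 \in S); case: (bb).
apply: (ht_if hs); evs; arx j => //; rewrite hcc -/X => gX.
  apply: ht_seq; apply: (ht_aset (i := j * n + enum_rank e0) (w := 1 - bb%:Z)) => //.
  - exact: evb.
  - by evs; rewrite xbE.
  move=> s2; set m2 := put _ _ _ _ in s2 *.
  have X2 : get m2 vX = get m vX.
    have f2 : fr [:: vB] m m2 by exact: fr_put.
    by rewrite (fr_get f2).
  apply: (ht_sset (w := cc - X)) => //.
  - by evs; arx j; rewrite ?X2; [rewrite /m2; fgets; rewrite hcc|rewrite /m2; fgets].
  - by clear -X0L ccL L_lt gX; rewrite -/X in X0L *; lia.
  move=> s3; set m3 := put _ _ _ _ in s3 *.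
  have f3 : fr [:: xc] m2 m3 by exact: fr_put.
  have T3 i : tset m3 i = if i == j then toggle bb e0 S else tset m i.
    by rewrite -tset_put; apply: eq_tset => e en; frs.
  have X3 : get m3 vX = get m vX by rewrite (fr_get f3).
  apply: HQ => //; last by rewrite /m3 /m2; fgets.
  split; first by do 2!(apply: fr_put => //).
  exists c, (cc - X); split=> //.
  - case: hg => g1 g2; split; first by rewrite /m3 /m2; fgets.
    move=> i ic; rewrite X3; have [h1 h2] := g2 i ic; split=> // e en.
    rewrite /m3 /m2; fgets; case: ifP => _; last exact: h2.
    by case: (bb); [left|right].
  - split; first by rewrite /m3; fgets.
    by clear -gX X0L ccL; rewrite -/X in X0L *; lia.
  - rewrite X3; apply: (flipinv_step hf (S := S)) => //.
      by clear -X0L; rewrite -/X in X0L; lia.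
    move=> phi; rewrite (@mass_toggle c (get m vX) (tset m) (tset m3) j phi (toggle bb e0 S)) //.
    + by congr (_ + _ * _); rewrite /X; ring.
    + by rewrite T3 eqxx.
    + by move=> i ij; rewrite T3 (negbTE ij).
  - move=> h; have [|h1 h2] := hp; first by clear -h X0L; rewrite -/X in X0L; lia.
    split=> // i; rewrite ltnS leq_eqVlt T3; case: eqP => [_ _|_ /= /h2 //].
    by rewrite /toggle; case: (bb); rewrite !inE eqxx.
have cX : cc < X by clear -gX; lia.
apply: (ht_if hs); evs; rewrite hcc => cc0; last first.
  apply: ht_skip => //; apply: HQ => //; split=> //.
  by exists c, cc; split=> //; rewrite ltNge cc0.
have [ec hlt] := hp cc0; subst c.
have cB : (c0.+1 <= B)%N by clear -c0_le B_ge; lia.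
have cb : (c0.+1 < 2 ^ b)%N by clear -c0_le b_ge; lia.
have f01 e : (e < n)%N -> get m vB (j * n + e) = 0 \/ get m vB (j * n + e) = 1 by exact: bits01.
apply: ht_seq; apply: (ht_map (f := fun e => get m vB (j * n + e)%N) (N := n) (o := (c0 * n)%N) ) => //.
- exact: ltnW.
- exact: ltnW.
- by move=> m' s' _; evs.
- by move=> e en; case: (f01 e en) => ->; clear -b_ge; lia.
- move=> e m' s' en f' hp' he'; split.
    by evs; frs; rewrite he' (proj1 hg); clear; lia.
  arx (j * n + e)%N.
  rewrite hp' // (_ : (c0 * n <= j * n + e)%N = false) //.
  by apply/negbTE; rewrite -ltnNge; clear -jc en; nia.
move=> m2 s2 f2 h2.
have T2 i : tset m2 i = if i == c0 then S else tset m i.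
  apply/setP => e; rewrite inE h2 //.
  case: (i =P c0) => [->|/eqP ic].
    by rewrite leq_addr ltn_add2l ltn_ord addKn /S inE.
  rewrite inE; case: ifP => // /andP[h3 h4]; exfalso; have he : (enum_rank e < n)%N := ltn_ord _.
  move: (nat_of_ord _) he h3 h4 => r he h3 h4.
  move: ic; rewrite neq_ltn => /orP[ic|ic].
    by move: h3; rewrite leqNgt => /negP; apply; clear -ic he; nia.
  by move: h4; rewrite ltnNge => /negP; apply; clear -ic; nia.
have ge2 k : k \notin [:: vB; jj] -> (0 < k < nids)%N -> get m2 k = get m k.
  by move=> h3 h4; rewrite (fr_get f2).
apply: ht_seq; apply: (ht_aset (i := c0 * n + enum_rank e0) (w := 1 - bb%:Z)) => //.
- by evs; frs; rewrite (proj1 hg) hkk; clear; lia.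
- by evs; frs; rewrite hbb.
move=> s3; set m3 := put _ _ _ _ in s3 *.
have f3 : fr [:: vB] m2 m3 by exact: fr_put.
have T3 i : tset m3 i = if i == c0 then toggle bb e0 S else tset m i.
  by rewrite /m3 tset_put !T2 eqxx; case: eqP.
have hX3 : get m3 vX = get m vX by rewrite (fr_get f3) // ge2.
have b3 i e : (i < c0.+1)%N -> (e < n)%N ->
    get m3 vB (i * n + e) = 0 \/ get m3 vB (i * n + e) = 1.
  move=> ic en; rewrite /m3; fgets; case: ifP => _; first by case: (bb); [left|right].
  rewrite h2 //; case: ifP => [/andP[h3 h4]|h3].
    by apply: f01; clear -h4; lia.
  have [_ hg2] := hg; case: (ltnP i c0) => ic0; first exact: (hg2 i ic0).2.
  move: h3; have -> : i = c0 by clear -ic ic0; lia.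
  by rewrite leq_addr ltn_add2l en.
have c3 : get m3 xn 0 = c0 by frs; exact: (proj1 hg).
have i3 : get m3 ii 0 = j by frs.
have cc3 : get m3 xc 0 = cc by frs.
have f03 : fr [:: ii; jj; vB; xc; vX; xn] m0 m3.
  by apply: fr_trans f1 (fr_trans (fr_sub2 _ f2) (fr_sub2 _ f3)).
move: m3 s3 {f3} T3 hX3 b3 c3 i3 cc3 f03 => m3 s3 T3 hX3 b3 c3 i3 cc3 f03.
apply: ht_seq; apply: (ht_aset (i := c0) (w := cc)) => //.
- by evs.
- by evs.
- by clear -ccL L_lt; lia.
move=> s4; apply: ht_seq; apply: (ht_aset (i := j) (w := X - cc)) => //.
- by evs; fgets.
- evs; arx j; last by fgets.
  by fgets; rewrite gtn_eqF // hX3 cc3.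
- by clear -ccL L_lt X0L cX cc0; rewrite -/X in X0L; lia.
move=> s5; apply: ht_seq; apply: (ht_sset (w := 0)) => //.
move=> s6; apply: (ht_sset (w := c0.+1)) => //.
  by evs; fgets; rewrite c3; clear; lia.
set m7 := put _ _ _ _ => s7.
have T7 i : tset m7 i = tset m3 i by apply: eq_tset => e en; rewrite /m7; fgets.
have X7 i : get m7 vX i = if j == i then X - cc else if c0 == i then cc else get m vX i.
  by rewrite /m7; fgets; rewrite hX3.
apply: HQ => //; last by rewrite /m7; fgets.
split; first by do 4!(apply: fr_put => //).
exists c0.+1, 0; split=> //.
- split; first by rewrite /m7; fgets.
  move=> i ic; split; last by move=> e en; rewrite /m7; fgets; exact: b3.
  have [_ hg2] := hg; rewrite X7; case: eqP => [_|/eqP ij].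
    by clear -X0L cX ccL; rewrite -/X in X0L; lia.
  case: eqP => // /eqP ic0; apply: (hg2 i _).1.
  by clear -ic ic0; lia.
- split; first by rewrite /m7; fgets.
  by rewrite lexx /=; clear -ccL; lia.
- apply: (flipinv_step hf (S := S)) => //; first by rewrite subr0 ltW.
  move=> phi; rewrite subr0; apply: (mass_split (i0 := j)) => //.
  + by rewrite T7 T3 eqxx.
  + by move=> i ic; rewrite T7 T3 ltn_eqF.
  + by rewrite X7 ltn_eqF // eqxx.
  + by rewrite X7 eqxx.
  + by move=> i ic ij; rewrite X7 eq_sym (negbTE ij) gtn_eqF.
- by rewrite leqnSn leqnn.
Qed.
End Element.

Lemma good_fr L c ks m m' : fr ks m m' -> vX \notin ks -> vB \notin ks -> xn \notin ks ->
  good L c m -> good L c m'.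
Proof. by move=> f h1 h2 h3; rewrite /good !(fr_get f). Qed.

Lemma tset_fr ks m m' : fr ks m m' -> vB \notin ks -> tset m' = tset m.
Proof. by move=> f h; rewrite /tset (fr_get f). Qed.

Lemma mass_sum L c m (e : E) j : good L c m -> (j <= c)%N ->
  mass c (get m vX) (tset m) (fun=> 1) = L ->
  0 <= \sum_(i < j) get m vX i * get m vB (i * n + enum_rank e)%N <= L.
Proof.
move=> hg jc hL; have hX i : (i < c)%N -> 0 <= get m vX i.
  by move=> ic; have [_ h] := hg; case/andP: (h i ic).1.
have hb i : (i < c)%N -> 0 <= get m vX i * get m vB (i * n + enum_rank e)%N <= get m vX i.
  move=> ic; have := hX i ic; rewrite (bit_hit _ hg ic) /hit.
  by case: (e \in _); rewrite ?mulr1 ?mulr0 lexx ?andbT.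
have ij (i : 'I_j) : (i < c)%N by apply: leq_trans jc.
apply/andP; split; first by apply: sumr_ge0 => i _; case/andP: (hb i (ij i)).
rewrite -hL /mass -(subnKC jc) big_split_ord /=.
apply: ler_wpDr; last by apply: ler_sum => i _; rewrite mulr1; case/andP: (hb i (ij i)).
by apply: sumr_ge0 => i _; rewrite mulr1 hX // -ltn_subRL.
Qed.

(** The positive part: only elements covered too much are removed from sets, and only removals can
    add to the missed mass. *)
Definition excess (z : int) : int := if 0 <= z then z else 0.

Lemma ht_flip_elt L c0 (e0 : E) m (Q : memory -> Prop) :
  st m -> get m kk 0 = enum_rank e0 -> good L c0 m -> (c0 <= 2 * n)%N ->
  0 < L -> (`|L| < 2 ^ b)%N -> mass c0 (get m vX) (tset m) (fun=> 1) = L ->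
  0 <= get m vR (enum_rank e0) <= L ->
  (forall m' c, st m' -> fr [:: ii; jj; vB; vX; xc; xn; xb; xm] m m' ->
     good L c m' -> (c <= c0.+1)%N -> mass c (get m' vX) (tset m') (fun=> 1) = L ->
     mass c (get m' vX) (tset m') (hit e0) = get m vR (enum_rank e0) ->
     (forall e, e != e0 -> mass c (get m' vX) (tset m') (hit e) =
        mass c0 (get m vX) (tset m) (hit e)) ->
     (forall P, P \in PP -> mass c (get m' vX) (tset m') (miss P) <=
        mass c0 (get m vX) (tset m) (miss P) + (e0 \in P)%:Z *
          excess (mass c0 (get m vX) (tset m) (hit e0) - get m vR (enum_rank e0))) ->
     Q m') ->
  ht flip_elt m Q.
Proof.
move=> hs hkk hg c0n L1 Lb hL R01 HQ.
have cB : (c0 <= B)%N by clear -c0n B_ge; lia.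
have cb : (c0 < 2 ^ b)%N by clear -c0n b_ge; lia.
set Re := get m vR (enum_rank e0) in R01 HQ *.
set S := mass c0 (get m vX) (tset m) (hit e0) in HQ *.
have eS : \sum_(i < c0) get m vX i * get m vB (i * n + enum_rank e0)%N = S.
  by apply: eq_bigr => i _; rewrite (bit_hit _ hg).
have S01 : 0 <= S <= L by rewrite -eS; apply: mass_sum hL.
apply: ht_seq; apply: (ht_sum (f := fun i => get m vX i * get m vB (i * n + enum_rank e0)%N) (N := c0)) => //.
- by move=> m' s' f'; evs; frs; exact: (proj1 hg).
- move=> j jc; have /andP[h1 h2] := mass_sum e0 hg jc hL.
  rewrite -ltz_nat abszE ger0_norm //; apply: le_lt_trans h2 _.
  by clear -Lb; lia.
- move=> j m' s' jc f' hj; evs; arx j => //; arx (j * n + enum_rank e0)%N.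
  by frs.
move=> m1 s1 f1 h1; rewrite eS in h1.
apply: ht_seq; apply: (ht_sset (w := S - Re)) => //.
- by evs; arx (nat_of_ord (enum_rank e0)) => //; frs; rewrite h1.
- by clear -S01 R01 Lb; lia.
move=> s2; set m2 := put _ _ _ _ in s2 *.
have f2 : fr [:: xc; ii] m m2 by exact: fr_put.
have h2 : get m2 xc 0 = S - Re by rewrite /m2; fgets.
move: m2 s2 f2 h2 => m2 s2 f2 h2.
pose bb := (Re <= S); pose cc := if bb then S - Re else Re - S.
have cc0 : 0 <= cc <= L by rewrite /cc /bb; case: (lerP Re S) => h; clear -S01 R01 h; lia.
have hbb m3 Q' : st m2 -> m3 = m2 ->
   (forall m', st m' -> fr [:: xc; xb] m2 m' -> get m' xc 0 = cc -> get m' xb 0 = bb%:Z -> Q' m') ->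
   ht (If (#0 - sc xc) (xc ::= #0 - sc xc ;; xb ::= #0) (xb ::= #1))%P m3 Q'.
  move=> _ -> HQ'; apply: (ht_if s2); evs; rewrite h2 => gd.
    have bf : bb = false by apply/negbTE; rewrite -ltNge; clear -gd; lia.
    apply: ht_seq; apply: (ht_sset (w := cc)) => //.
    - by evs; rewrite h2 /cc bf; clear; lia.
    - by clear -cc0 Lb; lia.
    move=> s3; apply: (ht_sset (w := 0)) => // s4; apply: HQ' => //.
    - by do 2!(apply: fr_put => //).
    - by fgets.
    - by fgets; rewrite bf.
  have bt : bb by rewrite /bb; clear -gd; lia.
  apply: (ht_sset (w := 1)) => //; first by clear -b_ge; lia.
  move=> s4; apply: HQ' => //; first exact: fr_put.
  - by fgets; rewrite h2 /cc bt.
  - by fgets; rewrite bt.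
apply: ht_seq; apply: hbb => // m3 s3 f3 hc3 hb3.
apply: ht_seq; apply: (ht_sset (w := c0)) => //.
  by evs; frs; exact: (proj1 hg).
move=> s4; set m4 := put _ _ _ _ in s4 *.
have f4 : fr [:: ii; xc; xb; xm] m m4.
  by apply: fr_put => //; apply: fr_trans (fr_sub2 _ f2) (fr_sub2 _ f3).
have h4 : get m4 xm 0 = c0 /\ get m4 xc 0 = cc /\ get m4 xb 0 = bb%:Z /\ get m4 kk 0 = enum_rank e0.
  by rewrite /m4; fgets; do !split=> //; frs.
move: m4 s4 f4 h4 => m4 s4 f4 [xm4 [xc4 [xb4 kk4]]].
have g4 : good L c0 m4 by apply: good_fr f4 _ _ _ hg.
have X4 : get m4 vX = get m vX by rewrite (fr_get f4).
have T4 : tset m4 = tset m by rewrite (tset_fr f4).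
pose s e := mass c0 (get m vX) (tset m) (hit e).
pose UB P := mass c0 (get m vX) (tset m) (miss P) + (e0 \in P)%:Z * bb%:Z * cc.
have I0 : flipI L s UB e0 bb Re c0 m4 0 m4.
  split=> //; exists c0, cc; split=> //; last by rewrite leqnn leqnSn.
  rewrite X4 T4; split=> //.
  by rewrite -/S /cc; case: (bb); rewrite /=; clear; lia.
apply: (ht_for (I := flipI L s UB e0 bb Re c0 m4) (N := c0)) => //.
- exact: flipI_put.
- by move=> j m' s' [f' _]; evs; rewrite (f' xm 0%N).
- move=> j m' s' jc hI hj; apply: (ht_flip_body Lb c0n s' jc hI hj) => // m'' s'' hI' hj'.
  by split=> //; exact: flipI_put.
move=> m5 s5 [f5 [c [cc' [g5 [hc5 cc5] [F1 F2 F3 F4] hc hp]]]] _.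
(* If mass were left over, all sets would have the changed bit and the marginal of [e0] would be 0
   or [L]; then [Re] would be negative or above [L]. *)
have ccz : cc' = 0.
  apply/eqP; rewrite eq_le; move/andP: (cc5) => [-> _]; rewrite andbT leNgt; apply/negP => h0.
  have [ec hT] := hp h0; subst c.
  have hm : mass c0 (get m5 vX) (tset m5) (hit e0) = (~~ bb)%:Z * L.
    rewrite -F1 /mass mulr_sumr; apply: eq_bigr => i _.
    by rewrite /hit hT // mulr1 mulrC.
  have F3' : (~~ bb)%:Z * L = Re + (bb%:Z *+ 2 - 1) * cc' by rewrite -hm.
  by move: F3'; rewrite mulr2n; case: (bb) => /=; clear -R01 h0 L1; lia.
rewrite ccz mulr0 addr0 in F3; rewrite {}ccz in F4.
apply: (HQ _ c) => //.
- by apply: fr_trans (fr_sub2 _ f4) (fr_sub2 _ f5).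
- by clear -hc; lia.
- move=> P hP; have := F4 P hP; rewrite mulr0 addr0 => h; apply: (le_trans h).
  rewrite /UB lerD2l -mulrA ler_wpM2l // /excess subr_ge0 /cc /bb.
  by case: (Re <= S); rewrite ?mul1r ?mul0r.
Qed.

(** Correcting one element does not change the marginals of the others, so each excess is that of
    the initial family, and the missed mass of [P] grows by at most their sum over [P]. *)
Lemma ht_flip L c0 m (Re : E -> int) (Q : memory -> Prop) :
  st m -> good L c0 m -> (c0 <= n.+1)%N -> 0 < L -> (`|L| < 2 ^ b)%N ->
  mass c0 (get m vX) (tset m) (fun=> 1) = L ->
  (forall e, get m vR (enum_rank e) = Re e) -> (forall e, 0 <= Re e <= L) ->
  (forall m' c, st m' -> fr [:: ii; jj; kk; vB; vX; xc; xn; xb; xm] m m' ->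
     good L c m' -> (c <= (2 * n).+1)%N -> mass c (get m' vX) (tset m') (fun=> 1) = L ->
     (forall e, mass c (get m' vX) (tset m') (hit e) = Re e) ->
     (forall P, P \in PP -> mass c (get m' vX) (tset m') (miss P) <=
        mass c0 (get m vX) (tset m) (miss P) + \sum_(e in P)
          excess (mass c0 (get m vX) (tset m) (hit e) - Re e)) ->
     Q m') ->
  ht flipP m Q.
Proof.
move=> hs hg c0n L1 Lb hL hR R01 HQ.
pose s e := mass c0 (get m vX) (tset m) (hit e).
pose U P := mass c0 (get m vX) (tset m) (miss P).
pose J k m' := fr [:: ii; jj; kk; vB; vX; xc; xn; xb; xm] m m' /\ exists c,
  [/\ good L c m' /\ (c <= c0 + k)%N, mass c (get m' vX) (tset m') (fun=> 1) = L,
   forall e, mass c (get m' vX) (tset m') (hit e) = if (enum_rank e < k)%N then Re e else s e &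
   forall P, P \in PP -> mass c (get m' vX) (tset m') (miss P) <=
        U P + \sum_(e in P | (enum_rank e < k)%N) excess (s e - Re e)].
have Jput k m' (v : int) : J k m' -> J k (put m' kk 0 v).
  move=> [f1 [c [[h1 h2] h3 h4 h5]]].
  have f2 : fr [:: kk] m' (put m' kk 0 v) by exact: fr_put.
  split; first exact: fr_put.
  exists c; rewrite (tset_fr f2) // (fr_get f2 (k := vX)) //; split=> //.
  by split=> //; apply: good_fr f2 _ _ _ h1.
apply: (ht_for (I := J) (N := n)) => //.
- exact: ltnW.
- exact: ltnW.
- apply: Jput; split=> //; exists c0; split=> //; first by rewrite addn0.
  by move=> P hP; rewrite [X in _ + X]big1 ?addr0 // => e /andP[_]; rewrite ltn0.
- by move=> j m' s' _; evs.
- move=> k m' s' kn [f' [c [[h1 h2] h3 h4 h5]]] hk.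
  pose e0 := enum_val (Ordinal (kn : (k < #|E|)%N)).
  have e0k : enum_rank e0 = k :> nat by rewrite /e0 enum_valK.
  have Rk : get m' vR (enum_rank e0) = Re e0 by rewrite (f' vR) // hR.
  apply: (ht_flip_elt (e0 := e0) s' _ h1 _ L1 Lb h3).
  + by rewrite e0k.
  + by clear -h2 c0n kn; lia.
  + by rewrite Rk.
  move=> m2 c2 s2 f2 g2 c2c t1 t2 t3 t4; rewrite Rk in t2 t4.
  split; first by frs.
  apply: Jput; split; first by apply: fr_trans f' (fr_sub2 _ f2).
  exists c2; split=> //; first by split=> //; clear -c2c h2; lia.
    move=> e; case: (e =P e0) => [->|/eqP ee0]; first by rewrite t2 e0k leqnn.
    rewrite t3 // h4 ltnS [in RHS]leq_eqVlt -{2}e0k.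
    by rewrite (_ : (_ == _) = false) //; apply: contraNF ee0 => /eqP/val_inj/enum_rank_inj ->.
  move=> P hP; apply: (le_trans (t4 P hP)); apply: (le_trans (lerD (h5 P hP) (lexx _))).
  rewrite h4 e0k ltnn -addrA lerD2l.
  case: (boolP (e0 \in P)) => eP; last first.
    rewrite mul0r addr0 le_eqVlt; apply/orP; left; apply/eqP; apply: eq_bigl => e.
    case: (boolP (e \in P)) => //= eP'; rewrite ltnS [in RHS]leq_eqVlt -{2}e0k.
    rewrite (_ : (_ == _) = false) //; apply: contraNF eP => /eqP/val_inj/enum_rank_inj <-.
    exact: eP'.
  rewrite mul1r [leRHS](bigD1 e0) /=; last by rewrite eP e0k leqnn.
  rewrite addrC lerD2l le_eqVlt; apply/orP; left; apply/eqP; apply: eq_bigl => e.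
  rewrite -andbA; case: (e \in P) => //=; case: (e =P e0) => [->|/eqP ee0].
    by rewrite e0k ltnn andbF.
  rewrite andbT ltnS [in RHS]leq_eqVlt -{2}e0k (_ : (_ == _) = false) //.
  by apply: contraNF ee0 => /eqP/val_inj/enum_rank_inj ->.
move=> m' s' [f' [c [[h1 h2] h3 h4 h5]]] _; apply: (HQ _ c) => //.
- by clear -h2 c0n; lia.
- by move=> e; rewrite h4 ltn_ord.
- move=> P hP; apply: (le_trans (h5 P hP)); rewrite lerD2l le_eqVlt; apply/orP; left; apply/eqP.
  by apply: eq_bigl => e; rewrite ltn_ord andbT.
Qed.

(** * Merging duplicates *)

(** Recorded or toggled sets may coincide, whereas [nonzero_entries] lists each set once. Bits are
    compared through the square of their difference, as guards test positivity. *)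
Definition merge_body : prog := (
  xe ::= #1 ;;
  forl kk nX (If ((vB $[ sc ii * nX + sc kk ] - vB $[ sc jj * nX + sc kk ]) *
                  (vB $[ sc ii * nX + sc kk ] - vB $[ sc jj * nX + sc kk ]))
                (xe ::= #0) Skip) ;;
  If (sc xe) (vX @[ sc ii ] ::= vX $[ sc ii ] + vX $[ sc jj ] ;;
              vX @[ sc jj ] ::= #0) Skip)%P.

Definition mergeP : prog := forl ii (sc xn) (forl jj (sc ii) merge_body).

(** The entries are counted in [xo], because cell 0 must keep [n] as long as addresses are
    computed. *)
Definition outP : prog := (
  xo ::= #0 ;;
  forl ii (sc xn) (If (vX $[ sc ii ]) (
    0%N @[ #1 + sc xo * (nX + #2) ] ::= vX $[ sc ii ] ;;
    0%N @[ #2 + sc xo * (nX + #2) ] ::= sc xL ;;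
    forl jj nX (0%N @[ #3 + sc xo * (nX + #2) + sc jj ] ::= vB $[ sc ii * nX + sc jj ]) ;;
    xo ::= sc xo + #1) Skip))%P.

Lemma mass_merge c X X' (T : nat -> {set E}) i j phi : (i < c)%N -> (j < c)%N ->
  i != j -> T i = T j -> X' i = X i + X j -> X' j = 0 ->
  (forall l, l != i -> l != j -> X' l = X l) -> mass c X' T phi = mass c X T phi.
Proof.
move=> ic jc ij eT e1 e2 e3; rewrite /mass.
rewrite (bigD1 (Ordinal ic)) // [RHS](bigD1 (Ordinal ic)) //=.
have hj : Ordinal jc != Ordinal ic by rewrite -val_eqE /= eq_sym.
rewrite (bigD1 (Ordinal jc)) // [in RHS](bigD1 (Ordinal jc)) //= e1 e2 eT mul0r add0r.
rewrite (eq_bigr (fun l : 'I_c => X l * phi (T l))); first by ring.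
by move=> l /andP[]; rewrite -!val_eqE /= => h1 h2; rewrite e3.
Qed.

Lemma mass_le c X (T : nat -> {set E}) i : (i < c)%N ->
  (forall l, (l < c)%N -> 0 <= X l) -> X i <= mass c X T (fun=> 1).
Proof.
move=> ic h; rewrite /mass (bigD1 (Ordinal ic)) //= mulr1 lerDl.
by apply: sumr_ge0 => l _; rewrite mulr1 h.
Qed.

Lemma bits_eq L c m i j : good L c m -> (i < c)%N -> (j < c)%N ->
  (forall e, (e < n)%N -> get m vB (i * n + e)%N = get m vB (j * n + e)%N) <->
  tset m i = tset m j.
Proof.
move=> hg ic jc; split=> [h|h e en]; first by apply/setP => e; rewrite !inE h.
have -> : e = enum_rank (enum_val (Ordinal (en : (e < #|E|)%N))) by rewrite enum_valK.
by rewrite !(bit_hit _ hg) // h.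
Qed.

Lemma ht_merge_body L c m (i j : nat) (Q : memory -> Prop) :
  st m -> good L c m -> (i < c)%N -> (j < i)%N -> (c <= (2 * n).+1)%N -> (`|L| < 2 ^ b)%N ->
  mass c (get m vX) (tset m) (fun=> 1) = L ->
  get m ii 0 = i -> get m jj 0 = j ->
  (forall m', st m' -> fr [:: kk; xe; vX] m m' -> good L c m' ->
     (forall phi, mass c (get m' vX) (tset m') phi = mass c (get m vX) (tset m) phi) ->
     (forall l, l != i -> 0 < get m' vX l -> 0 < get m vX l) ->
     (0 < get m' vX j -> tset m j != tset m i) -> Q m') ->
  ht merge_body m Q.
Proof.
move=> hs hg ic ji cn Lb hL hi hj HQ.
have jc : (j < c)%N by apply: ltn_trans ic.
apply: ht_seq; apply: (ht_sset (w := 1)) => //; first by clear -b_ge; lia.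
move=> s1; set m1 := put _ _ _ _ in s1 *.
have f1 : fr [:: kk; xe] m m1 by exact: fr_put.
pose I l m' := fr [:: kk; xe] m m' /\ exists bb : bool, get m' xe 0 = bb%:Z /\
  (bb <-> forall e, (e < l)%N -> get m vB (i * n + e)%N = get m vB (j * n + e)%N).
apply: ht_seq; apply: (ht_for (I := I) (N := n)) => //.
- exact: ltnW.
- exact: ltnW.
- by split; [exact: fr_put | exists true; rewrite /m1; fgets; split].
- by move=> l m' s' _; evs.
- move=> l m' s' ln [f' [bb [h1 h2]]] hl.
  have ei : get m' ii 0 = i by frs.
  have ej : get m' jj 0 = j by frs.
  have e1 : eval m' (vB $[ sc ii * nX + sc kk ])%P = get m vB (i * n + l)%N.
    by arx (i * n + l)%N; first [by frs | by rewrite ?ei ?hi ?hl; clear; lia].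
  have e2 : eval m' (vB $[ sc jj * nX + sc kk ])%P = get m vB (j * n + l)%N.
    by arx (j * n + l)%N; first [by frs | by rewrite ?ej ?hj ?hl; clear; lia].
  apply: (ht_if s'); evs; rewrite e1 e2 => gd.
    apply: (ht_sset (w := 0)) => // s2; split; first by fgets.
    split; first by do 2!(apply: fr_put => //).
    exists false; split; first by fgets.
    by split=> // h; move: gd; rewrite h ?leqnn // subrr mul0r ltxx.
  have el : get m vB (i * n + l)%N = get m vB (j * n + l)%N.
    by move: gd; rewrite -expr2 real_exprn_even_le0 ?num_real //= subr_eq0 => /eqP.
  apply: ht_skip => //; split=> //; split; first exact: fr_put.
  exists bb; split; first by fgets.
  split=> [/h2 h e|h]; last by apply/h2 => e el'; apply: h; exact: leqW.
  by rewrite ltnS leq_eqVlt => /orP[/eqP->|/h].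
move=> m2 s2 [f2 [bb [h1 h2]]] _.
have hT : bb <-> tset m i = tset m j by rewrite h2; exact: bits_eq hg ic jc.
have T2 : tset m2 = tset m by rewrite (tset_fr f2).
have X2 : get m2 vX = get m vX by rewrite (fr_get f2).
have X0 l : (l < c)%N -> 0 <= get m vX l.
  by move=> lc; have [_ h] := hg; case/andP: (h l lc).1.
apply: (ht_if s2); evs; rewrite h1 => gd; last first.
  have nbb : bb = false by move: gd; case: (bb).
  apply: ht_skip => //; apply: HQ => //.
  - exact: fr_sub2 f2.
  - by apply: good_fr f2 _ _ _ hg.
  - by move=> phi; rewrite T2 X2.
  - by rewrite X2.
  - by move=> _; apply/eqP => h; move: nbb; rewrite (proj2 hT).
have {}hT : tset m i = tset m j by apply/hT; move: gd; case: (bb).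
have ij : i != j by rewrite gtn_eqF.
pose X' l := if l == i then get m vX i + get m vX j else if l == j then 0 else get m vX l.
have hm phi : mass c X' (tset m) phi = mass c (get m vX) (tset m) phi.
  apply: (mass_merge (i := i) (j := j)) => //.
  - by rewrite /X' eqxx.
  - by rewrite /X' eq_sym (negbTE ij) eqxx.
  - by move=> l li lj; rewrite /X' (negbTE li) (negbTE lj).
have X'0 l : (l < c)%N -> 0 <= X' l <= L.
  have h0 l' : (l' < c)%N -> 0 <= X' l'.
    by move=> lc; rewrite /X'; do 2?case: ifP => _ //; rewrite ?addr_ge0 ?X0.
  by move=> lc; rewrite h0 //= -hL -hm; apply: mass_le.
have ii2 : get m2 ii 0 = i by frs.
have jj2 : get m2 jj 0 = j by frs.
apply: ht_seq; apply: (ht_aset (i := i) (w := X' i)) => //.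
- by evs.
- by evs; arx i => //; arx j => //; rewrite X2 /X' eqxx.
- by have := X'0 i ic; clear -Lb; lia.
move=> s3; apply: (ht_aset (i := j) (w := 0)) => //; first by evs; fgets.
set m4 := put _ _ _ _ => s4.
have X4 : get m4 vX = X'.
  apply: functional_extensionality => l; rewrite /m4; fgets; rewrite X2 /X'.
  case: (j =P l) => [<-|/eqP jl]; first by rewrite (eq_sym j) (negbTE ij) ?eqxx.
  case: (i =P l) => [<-|/eqP il]; first by rewrite eqxx.
  by rewrite (eq_sym l i) (negbTE il) (eq_sym l j) (negbTE jl).
have f24 : fr [:: vX] m2 m4 by do 2!(apply: fr_put => //).
have T4 : tset m4 = tset m by rewrite (tset_fr f24).
apply: HQ => //.
- by apply: fr_trans (fr_sub2 _ f2) (fr_sub2 _ f24).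
- have [g1 g2] := hg; split; first by frs.
  move=> l lc; rewrite X4; split; first exact: X'0.
  by move=> e en; frs; exact: (g2 l lc).2.
- by move=> phi; rewrite T4 X4 hm.
- by move=> l li; rewrite X4 /X' (negbTE li); case: ifP => //; rewrite ltxx.
- by rewrite X4 /X' eq_sym (negbTE ij) eqxx ltxx.
Qed.

(** Mass moves to the later index [i], so an earlier set can only lose its mass; the distinctness of
    the live sets before [i] thus survives the inner loop. *)
Lemma ht_merge L c m (Q : memory -> Prop) :
  st m -> good L c m -> (c <= (2 * n).+1)%N -> (`|L| < 2 ^ b)%N ->
  mass c (get m vX) (tset m) (fun=> 1) = L ->
  (forall m', st m' -> fr [:: ii; jj; kk; xe; vX] m m' -> good L c m' ->
     (forall phi, mass c (get m' vX) (tset m') phi = mass c (get m vX) (tset m) phi) ->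
     (forall a d, (a < d < c)%N -> 0 < get m' vX a -> 0 < get m' vX d ->
        tset m' a != tset m' d) -> Q m') ->
  ht mergeP m Q.
Proof.
move=> hs hg cn Lb hL HQ.
pose ks := [:: ii; jj; kk; xe; vX].
have cB : (c <= B)%N by clear -cn B_ge; lia.
have cb : (c < 2 ^ b)%N by clear -cn b_ge; lia.
pose C m' := [/\ fr ks m m', good L c m' &
  forall phi, mass c (get m' vX) (tset m') phi = mass c (get m vX) (tset m) phi].
pose D i m' := forall a d, (a < d < i)%N -> 0 < get m' vX a -> 0 < get m' vX d ->
        tset m' a != tset m' d.
pose F i j m' := forall a, (a < j)%N -> 0 < get m' vX a -> tset m' a != tset m' i.
have Cput k m' (v : int) : k \in [:: ii; jj] -> C m' -> C (put m' k 0 v).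
  move=> hk [h1 h2 h3]; have hv : valid n k 0 by move: hk; rewrite !inE => /orP[] /eqP->.
  have f1 : fr [:: ii; jj] m' (put m' k 0 v) by exact: fr_put.
  split; first by apply: fr_put => //; move: hk; rewrite !inE => /orP[] ->; rewrite ?orbT.
    by apply: good_fr f1 _ _ _ h2.
  by move=> phi; rewrite (tset_fr f1) // (fr_get f1).
have XT k m' (v : int) : k \in [:: ii; jj] ->
    get (put m' k 0 v) vX = get m' vX /\ tset (put m' k 0 v) = tset m'.
  move=> hk; have hv : valid n k 0 by move: hk; rewrite !inE => /orP[] /eqP->.
  have f1 : fr [:: ii; jj] m' (put m' k 0 v) by exact: fr_put.
  by rewrite (tset_fr f1) // (fr_get f1).
pose I i m' := C m' /\ D i m'.
have Iput i m' (v : int) : I i m' -> I i (put m' ii 0 v).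
  move=> [h1 h2]; split; first exact: Cput.
  by have [e1 e2] := XT ii m' v isT; rewrite /D e1 e2.
apply: (ht_for (I := I) (N := c)) => //.
- by apply: Iput; split=> // a d; rewrite ltn0 andbF.
- by move=> i m' s' [[_ [h _] _] _]; evs.
- move=> i m' s' ic [hC hD] hi.
  pose J j m'' := [/\ C m'', D i m'', F i j m'' & get m'' ii 0 = i].
  have Jput j m'' (v : int) : J j m'' -> J j (put m'' jj 0 v).
    move=> [h1 h2 h3 h4]; have [e1 e2] := XT jj m'' v isT.
    split; [exact: Cput|by rewrite /D e1 e2|by rewrite /F e1 e2|by fgets].
  apply: (ht_for (I := J) (N := i)) => //.
  + by apply: leq_trans cB; exact: ltnW.
  + exact: ltn_trans cb.
  + by apply: Jput; split.
  + by move=> j m'' s'' [_ _ _ h]; evs.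
  + move=> j m2 s2 ji [[c1 c2 c3] d1 d2 hi2] hj.
    apply: (ht_merge_body (L := L) (c := c) (i := i) (j := j)) => //; first by rewrite c3.
    move=> m3 s3 f3 g3 h3 x3 t3; split; first by frs.
    have T3 : tset m3 = tset m2 by rewrite (tset_fr f3).
    apply: Jput; split.
    * split=> //; first by apply: fr_trans c1 (fr_sub2 _ f3).
      by move=> phi; rewrite h3.
    * move=> a d ad xa xd; rewrite T3; apply: d1 => //; apply: x3 => //.
        by rewrite ltn_eqF //; case/andP: ad; exact: ltn_trans.
      by rewrite ltn_eqF //; case/andP: ad.
    * move=> a; rewrite ltnS leq_eqVlt T3 => /orP[/eqP->|aj] xa; first exact: t3.
      by apply: d2 => //; apply: x3 => //; rewrite ltn_eqF // (ltn_trans aj).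
    * by frs.
  move=> m2 s2 [c1 d1 d2 hi2] _; split=> //; apply: Iput; split=> //.
  move=> a d /andP[ad]; rewrite ltnS leq_eqVlt => /orP[/eqP e|di] xa xd.
    by subst d; exact: d2.
  by apply: d1; rewrite ?ad.
by move=> m' s' [[c1 c2 c3] d1] _; apply: HQ.
Qed.

Definition live (X : nat -> int) (i : nat) : seq nat := [seq x <- iota 0 i | 0 < X x].

Lemma live_rcons X i : live X i.+1 = if 0 < X i then rcons (live X i) i else live X i.
Proof. by rewrite /live -addn1 iotaD filter_cat /= add0n; case: ifP; rewrite ?cats0 // cats1. Qed.

Lemma ht_out L c m (Q : memory -> Prop) :
  st m -> good L c m -> (c <= (2 * n).+1)%N -> (`|L| < 2 ^ b)%N -> get m xL 0 = L ->
  (forall m', st m' -> let s := live (get m vX) c in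
     get m' xo 0 = size s ->
     (forall a, (a < size s)%N ->
        [/\ m' (1 + a * (n + 2))%N = get m vX (nth 0%N s a),
         m' (1 + a * (n + 2)).+1%N = L &
         set_at E m' (1 + a * (n + 2) + 2) = tset m (nth 0%N s a)]) -> Q m') ->
  ht outP m Q.
Proof.
move=> hs hg cn Lb hxL HQ; pose X := get m vX.
have cB : (c <= B)%N by clear -cn B_ge; lia.
have cb : (c < 2 ^ b)%N by clear -cn b_ge; lia.
have sz i : (size (live X i) <= i)%N by rewrite size_filter -{2}(size_iota 0 i) count_size.
have vld a r : (a <= 2 * n)%N -> (0 < r < n + 3)%N -> valid n 0 (r + a * (n + 2)).
  by move=> h1 h2; rewrite /valid /base /=; clear -h1 h2; nia.
apply: ht_seq; apply: (ht_sset (w := 0)) => // s1.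
set m1 := put _ _ _ _ in s1 *.
pose I i m' := fr [:: 0; ii; jj; xo]%N m m' /\ let s := live X i in
  get m' xo 0 = size s /\ forall a, (a < size s)%N ->
   [/\ get m' 0 (1 + a * (n + 2)) = X (nth 0%N s a),
       get m' 0 (2 + a * (n + 2)) = L &
       forall e, (e < n)%N -> get m' 0 (3 + e + a * (n + 2)) = get m vB (nth 0%N s a * n + e)].
have rinj a a' r r' : (0 < r < n + 3)%N -> (0 < r' < n + 3)%N ->
    (r + a * (n + 2) == r' + a' * (n + 2))%N = (a == a') && (r == r').
  move=> h1 h2; have e1 : (r + a * (n + 2) = a * (n + 2) + (r - 1) + 1)%N by clear -h1; lia.
  have e2 : (r' + a' * (n + 2) = a' * (n + 2) + (r' - 1) + 1)%N by clear -h2; lia.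
  rewrite e1 e2 eqn_add2r; have l1 : (r - 1 < n + 2)%N by clear -h1; lia.
  have l2 : (r' - 1 < n + 2)%N by clear -h2; lia.
  have n2 : (0 < n + 2)%N by rewrite addn2.
  apply/eqP/andP => [h|[/eqP-> /eqP->] //].
  have ea : a = a'.
    by have := congr1 (fun x => (x %/ (n + 2))%N) h; rewrite !divnMDl // !divn_small ?addn0.
  by subst a'; split=> //; move/addnI: h => h; apply/eqP; clear -h h1 h2; lia.
apply: (ht_for (I := I) (N := c)) => //.
- by split; [apply: fr_put => //; exact: fr_put | rewrite /m1; fgets].
- by move=> i m' s' [f' _]; evs; frs; exact: (proj1 hg).
- move=> i m' s' ic [f' [h1 h2]] hi.
  have eX : eval m' (vX $[ sc ii ])%P = X i by arx i; frs.
  apply: (ht_if s'); rewrite eX => gX; last first.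
    apply: ht_skip => //; split=> //; split; first exact: fr_put.
    rewrite live_rcons ltNge gX /=; split; first by fgets.
    move=> a ha; have [g1 g2 g3] := h2 a ha.
    have an : (a <= 2 * n)%N by have := sz i; clear -ic cn ha; lia.
    have v3 e : (e < n)%N -> valid n 0 (3 + e + a * (n + 2)) by move=> en; apply: vld => //; clear -en; lia.
    have v1 : valid n 0 (1 + a * (n + 2)) by apply: vld => //; rewrite addn3.
    have v2 : valid n 0 (2 + a * (n + 2)) by apply: vld => //; rewrite addn3.
    split; [by rewrite getP|by rewrite getP|].
    by move=> e en; rewrite getP //=; [exact: g3|exact: v3].
  set t := size (live X i) in h1 h2.
  have tn : (t <= 2 * n)%N by have := sz i; rewrite -/t; clear -ic cn; lia.
  have vt r : (0 < r < n + 3)%N -> valid n 0 (r + t * (n + 2)) by exact: vld.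
  have vt1 : valid n 0 (1 + t * (n + 2)) by apply: vt; rewrite addn3.
  have vt2 : valid n 0 (2 + t * (n + 2)) by apply: vt; rewrite addn3.
  have [_ /(_ i ic) [XL b01]] := hg.
  apply: ht_seq; apply: (ht_aset (i := 1 + t * (n + 2)) (w := X i)) => //.
  + by evs; rewrite h1; clear; lia.
  + by clear -XL Lb; rewrite -/X in XL; lia.
  move=> s2; apply: ht_seq; apply: (ht_aset (i := 2 + t * (n + 2)) (w := L)) => //.
  + by evs; fgets; rewrite h1; clear; lia.
  + by evs; fgets; frs.
  move=> s3; set m3 := put _ _ _ _ in s3 *.
  have f3 : fr [:: 0%N] m' m3 by apply: fr_put => //; exact: fr_put.
  have f03 : fr [:: 0; ii; jj; xo]%N m m3 by apply: fr_trans f' (fr_sub2 _ f3).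
  have L3 a r : (a <= 2 * n)%N -> (0 < r < n + 3)%N -> get m3 0 (r + a * (n + 2)) =
      if a == t then if r == 1%N then X i else if r == 2%N then L else get m' 0 (r + a * (n + 2))
      else get m' 0 (r + a * (n + 2)).
    move=> an hr; have vr := vld a r an hr.
    have h13 : (0 < 1 < n + 3)%N by rewrite addn3.
    have h23 : (0 < 2 < n + 3)%N by rewrite addn3.
    rewrite /m3 !getP //= !rinj // (eq_sym t); case: (a == t); last by [].
    by rewrite !(eq_sym r) !andTb; case: (1%N =P r) => [<-|].
  have ii3 : get m3 ii 0 = i by frs.
  have xo3 : get m3 xo 0 = t by frs.
  apply: ht_seq; apply: (ht_map (f := fun e => get m vB (i * n + e)%N) (N := n)
    (o := (3 + t * (n + 2))%N) ) => //.
  + exact: ltnW.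
  + exact: ltnW.
  + move=> e en; rewrite addnAC; apply: vld => //; clear -en; lia.
  + by move=> m4 s4 _; evs.
  + by move=> e en; case: (b01 e en) => ->; clear -b_ge; lia.
  + move=> e m4 s4 en f4 hp4 he; split; first by evs; frs; rewrite h1 he; clear; lia.
    arx (i * n + e)%N; first by frs.
  move=> m4 s4 f4 h4.
  apply: (ht_sset (w := t.+1)) => //.
  + by evs; frs; rewrite h1; clear; lia.
  + by clear -tn b_ge; lia.
  move=> s5; split; first by fgets; frs.
  split; first by do 2!(apply: fr_put => //); apply: fr_trans f03 (fr_sub2 _ f4).
  rewrite live_rcons gX /= size_rcons; split; first by fgets.
  move=> a ha; have an : (a <= 2 * n)%N by clear -ha tn; rewrite -/t in ha; lia.
  have g5 r : (0 < r < n + 3)%N -> get (put (put m4 xo 0 t.+1) ii 0 i.+1) 0 (r + a * (n + 2)) =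
      if a == t then if r == 1%N then X i else if r == 2%N then L else get m vB (i * n + (r - 3))
      else get m' 0 (r + a * (n + 2)).
    move=> hr; have vr := vld a r an hr; rewrite !getP //= h4 //.
    case: (a =P t) => [->|/eqP hat].
      case: (ltnP r 3) => r3.
        rewrite (_ : (_ <= _ < _)%N = false); last by apply/negbTE; clear -r3; lia.
        rewrite L3 // eqxx; case: eqP => // r1; case: eqP => // r2; exfalso.
        by clear -r1 r2 r3 hr; lia.
      rewrite (_ : (_ <= _ < _)%N); last by clear -r3 hr; lia.
      have -> : (r == 1)%N = false by clear -r3; lia.
      have -> : (r == 2)%N = false by clear -r3; lia.
      by congr (get m vB (_ + _)%N); clear -r3; lia.
    rewrite (_ : (_ <= _ < _)%N = false) ?L3 ?(negbTE hat) //.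
    apply/negbTE/negP => /andP[q1 q2]; move/negP: hat; apply; apply/eqP.
    by clear -q1 q2 hr; nia.
  rewrite nth_rcons -/t; case: (ltngtP a t) ha => [hat|hat|et] ha.
  + have [g1 g2 g3] := h2 a hat; have nat_ : (a == t) = false by rewrite ltn_eqF.
    rewrite nat_ in g5; split; rewrite ?g5 ?addn3 //.
    by move=> e en; rewrite g5; [exact: g3 | clear -en; lia].
  + by move: ha; rewrite ltnS leqNgt hat.
  + rewrite et eqxx in g5; rewrite ?et; split; rewrite ?g5 ?addn3 //.
    by move=> e en; rewrite g5 ?addKn //; clear -en; lia.
move=> m' s' [f' [h1 h2]] _; apply: HQ => // a ha; have [g1 g2 g3] := h2 a ha.
split=> //.
apply/setP => e; rewrite !inE -(g3 _ (ltn_ord (enum_rank e))).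
rewrite (_ : (_ + enum_rank e)%N = (3 + enum_rank e + a * (n + 2))%N) //.
by move: (a * (n + 2))%N (nat_of_ord (enum_rank e)) => u v; clear; lia.
Qed.

(** * The whole algorithm *)

(** The common denominator is the plain product of all denominators. The identity matrix is written
    by a formula: with rows of length [n + 1] the diagonal sits at the multiples of [n + 2], and
    [1 / (1 + r)] rounds down to 1 for remainder [r = 0] and to 0 otherwise. *)
Definition initP : prog := (
  xL ::= #1 ;;
  forl ii (nX + nX) (xL ::= sc xL * 0%N $[ #2 + #2 * sc ii ]) ;;
  forl ii nX (vR @[ sc ii ] ::=
    0%N $[ #1 + #2 * sc ii ] * (sc xL / 0%N $[ #2 + #2 * sc ii ])) ;;
  forl ii nX (vW @[ sc ii ] ::= vR $[ sc ii ] +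
    0%N $[ #1 + #2 * (nX + sc ii) ] * (sc xL / 0%N $[ #2 + #2 * (nX + sc ii) ])) ;;
  vW @[ nX ] ::= sc xL ;;
  forl ii ((nX + #1) * (nX + #1)) (vM @[ sc ii ] ::=
    #1 / (#1 + (sc ii - sc ii / (nX + #2) * (nX + #2)))) ;;
  xD ::= #1 ;;
  forl ii (nX + #1) (vP @[ sc ii ] ::= #1) ;;
  xn ::= #0)%P.

Lemma prod_ge (den : nat -> int) i j : (forall t, (t < j)%N -> 0 < den t) -> (i <= j)%N ->
  0 < \prod_(t < i) den t <= \prod_(t < j) den t.
Proof.
move=> h ij; apply/andP; split.
  by apply: prodr_gt0 => t _; apply: h; exact: leq_trans ij.
elim: j h ij => [|j IH] h; first by rewrite leqn0 => /eqP->.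
rewrite leq_eqVlt => /orP[/eqP-> //|]; rewrite ltnS => ij.
have h' t : (t < j)%N -> 0 < den t by move=> tj; apply: h; exact: ltnW.
apply: le_trans (IH h' ij) _; rewrite big_ord_recr /= ler_peMr //.
  by apply/ltW/prodr_gt0 => t _; exact: h'.
by have := h j (ltnSn j); lia.
Qed.

Lemma ht_init m (num den : nat -> int) (Q : memory -> Prop) :
  let L := \prod_(t < n + n) den t in
  st m -> (forall t, (t < n + n)%N -> get m 0 (1 + 2 * t) = num t /\ get m 0 (2 + 2 * t) = den t) ->
  (forall t, (t < n + n)%N -> 0 < den t /\ 0 <= num t <= den t) -> (`|L| * 2 < 2 ^ b)%N ->
  (forall m', st m' -> get m' xn 0 = 0 -> get m' xL 0 = L ->
     (forall e, (e < n)%N -> get m' vR e = num e * (L %/ den e)%Z) ->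
     (forall e, (e < n)%N -> get m' vW e =
        num e * (L %/ den e)%Z + num (n + e)%N * (L %/ den (n + e)%N)%Z) ->
     get m' vW n = L -> mxof (get m' vM) = 1%:M -> get m' xD 0 = 1 ->
     (forall i, (i <= n)%N -> get m' vP i = 1) -> Q m') ->
  ht initP m Q.
Proof.
move=> L hs hin hden Lb HQ.
have dpos t : (t < n + n)%N -> 0 < den t by move=> ht0; case: (hden t ht0).
have nn1 : (n.+1 <= B)%N by clear -B_ge; lia.
have nn2 : (n.+1 < 2 ^ b)%N by clear -b_ge; lia.
have nB : (n <= B)%N by exact: ltnW.
have nb : (n < 2 ^ b)%N by exact: ltnW.
have b1 : (`|1%R : int| < 2 ^ b)%N by clear -b_ge; lia.
have v0 t r : (t < n + n)%N -> (0 < r <= 2)%N -> valid n 0 (r + 2 * t).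
  by move=> h1 h2; rewrite /valid /base /=; clear -h1 h2; nia.
have v1 t : (t < n + n)%N -> valid n 0 (1 + 2 * t) by move=> ?; exact: v0.
have v2 t : (t < n + n)%N -> valid n 0 (2 + 2 * t) by move=> ?; exact: v0.
have Lp : 0 < L by apply: prodr_gt0 => t _; exact: dpos.
have wle t : (t < n + n)%N -> 0 <= num t * (L %/ den t)%Z <= L.
  move=> ht0; have [d0 /andP[h0 h1]] := hden t ht0.
  have q0 : 0 <= (L %/ den t)%Z by rewrite divz_ge0 // ltW.
  rewrite mulr_ge0 //= (le_trans (ler_wpM2r q0 h1)) // mulrC lez_floor // gt_eqF //.
apply: ht_seq; apply: (ht_sset (w := 1)) => // s1; set m1 := put _ _ _ _ in s1 *.
pose I j m' := fr [:: ii; xL] m m' /\ get m' xL 0 = \prod_(t < j) den t.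
apply: ht_seq; apply: (ht_for (I := I) (N := (n + n)%N)) => //.
- by clear -B_ge; lia.
- by clear -b_ge; lia.
- split; first by apply: fr_put => //; exact: fr_put.
  by rewrite /m1; fgets; rewrite big_ord0.
- by move=> j m' s' _; evs; lia.
- move=> j m' s' hj [f' hL] hi; have [_ hd] := hin j hj.
  apply: (ht_sset (w := \prod_(t < j.+1) den t)) => //.
  + evs; arx (2 + 2 * j)%N; rewrite (f' 0%N (2 + 2 * j)%N) // ?v2 //.
    by rewrite hd hL big_ord_recr.
  + have /andP[h1 h2] := prod_ge dpos hj; move: h1 h2 Lb; rewrite -/L; clear.
    by move: (\prod_(t < j.+1) _) (2 ^ b)%N => x y; lia.
  move=> s3; split; first by fgets.
  split; last by fgets.
  by do 2!(apply: fr_put => //).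
move=> m2 s2 [f2 hL] _; rewrite -/L in hL.
have i2 t : (t < n + n)%N -> get m2 0 (1 + 2 * t) = num t /\ get m2 0 (2 + 2 * t) = den t.
  by move=> ht0; rewrite (f2 0%N) ?v1 // (f2 0%N) ?v2 //; exact: hin.
apply: ht_seq; apply: (ht_map0 (f := fun e => num e * (L %/ den e)%Z) (N := n)) => //.
- by move=> m3 s3 f3; evs.
- move=> j hj; have := wle j (ltn_addr _ hj); move: (num j * _) Lb; clear.
  by move: (2 ^ b)%N => x y; lia.
- move=> j m3 s3 hj f3 h3 hi; have [g1 g2] := i2 j (ltn_addr _ hj).
  evs; arx (1 + 2 * j)%N; arx (2 + 2 * j)%N; frs.
  by rewrite (f3 0%N) ?v1 ?ltn_addr // (f3 0%N) ?v2 ?ltn_addr // g1 g2 hL.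
move=> m3 s3 f3 hR.
have i3 t : (t < n + n)%N -> get m3 0 (1 + 2 * t) = num t /\ get m3 0 (2 + 2 * t) = den t.
  by move=> ht0; rewrite (f3 0%N) ?v1 // (f3 0%N) ?v2 //; exact: i2.
have hL3 : get m3 xL 0 = L by frs.
apply: ht_seq; apply: (ht_map0 (f := fun e => num e * (L %/ den e)%Z +
   num (n + e)%N * (L %/ den (n + e)%N)%Z) (N := n)) => //.
- by move=> m4 s4 f4; evs.
- move=> j hj; have := wle j (ltn_addr _ hj).
  have := wle (n + j)%N; rewrite ltn_add2l => /(_ hj).
  move: (num j * _) (num (n + j)%N * _) Lb; clear.
  by move: (2 ^ b)%N => x y z; lia.
- move=> j m4 s4 hj f4 h4 hi; have hj' : (n + j < n + n)%N by rewrite ltn_add2l.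
  have [g1 g2] := i3 _ hj'.
  evs; arx j; arx (1 + 2 * (n + j))%N; arx (2 + 2 * (n + j))%N; frs.
  by rewrite (f4 0%N) ?v1 // (f4 0%N) ?v2 // g1 g2 hL hR hj.
move=> m4 s4 f4 hW; have hL4 : get m4 xL 0 = L by frs.
apply: ht_seq; apply: (ht_aset (i := n) (w := L)) => //.
- by evs.
- by evs.
- by clear -Lb; lia.
move=> s5; set m5 := put _ _ _ _ in s5 *.
have n2 : (0 < n + 2)%N by rewrite addn2.
apply: ht_seq; apply: (ht_map0 (f := fun t => (t %% (n + 2) == 0)%N%:Z) (N := (n.+1 * n.+1)%N)) => //.
- by move=> m6 s6 f6; evs; clear; lia.
- by move=> j _; case: (_ == _); [exact: b1 | clear -b_ge; lia].
- move=> j m6 s6 hj f6 h6 hi; evs; rewrite hi.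
  have -> : (j %/ (n%:Z + 2))%Z = (j %/ (n + 2))%N by rewrite -PoszD divz_nat.
  have -> : 1 + (j%:Z - (j %/ (n + 2))%N%:Z * (n%:Z + 2)) = (1 + j %% (n + 2))%N.
    have := divn_eq j (n + 2); move: (j %/ _)%N (j %% _)%N => x y ->.
    by rewrite !PoszD PoszM PoszD; ring.
  by rewrite divz_nat; case: (j %% (n + 2))%N => [|k] //; rewrite divn_small.
move=> m6 s6 f6 hM.
apply: ht_seq; apply: (ht_sset (w := 1)) => // s7; set m7 := put _ _ _ _ in s7 *.
apply: ht_seq; apply: (ht_map0 (f := fun t => 1) (N := n.+1)) => //.
- by move=> m8 s8 f8; evs; clear; lia.
move=> m8 s8 f8 hP.
apply: (ht_sset (w := 0)) => // s9; apply: HQ => //.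
- by fgets.
- by fgets; frs; rewrite /m7; fgets; frs; rewrite /m5; fgets; frs.
- move=> e en; fgets; frs; rewrite /m7; fgets; frs; rewrite /m5; fgets; frs.
  by rewrite hR en.
- move=> e en; fgets; frs; rewrite /m7; fgets; frs; rewrite /m5; fgets.
  by rewrite gtn_eqF // hW en.
- by fgets; frs; rewrite /m7; fgets; frs; rewrite /m5; fgets; rewrite eqxx.
- apply/matrixP => i j; rewrite !mxE; fgets; frs; rewrite /m7; fgets; rewrite hM.
  have hi := ltn_ord i; have hj := ltn_ord j.
  rewrite (_ : (_ < _)%N); last by clear -hi hj; nia.
  rewrite natz -val_eqE /=; congr (nat_of_bool _)%:Z.
  (* Position [i * (n + 1) + j] is [i * (n + 2) + (j - i)]; below the diagonal one multiple of
     [n + 2] has to be borrowed. *)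
  move: (nat_of_ord i) (nat_of_ord j) hi hj => {}i {}j hi hj; case: (leqP i j) => ij.
    rewrite (_ : (_ + j)%N = (i * (n + 2) + (j - i))%N); last by clear -ij; nia.
    by rewrite modnMDl modn_small; [clear -ij; lia | clear -hj; lia].
  rewrite (_ : (_ + j)%N = (i.-1 * (n + 2) + (n + 2 - (i - j)))%N).
    by rewrite modnMDl modn_small; clear -hi ij; lia.
  by case: i ij hi => [|i] //= ij hi; clear -ij hi; nia.
- by fgets; frs; rewrite /m7; fgets.
- by move=> i hi; fgets; rewrite hP ltnS hi.
Qed.

(** * The decomposition given by a family of weighted sets *)

Section Decomposition.
Variables (c : nat) (X : nat -> int) (T : nat -> {set E}) (L : int).
Hypothesis L_gt0 : 0 < L.
Hypothesis X_ge0 : forall i, (i < c)%N -> 0 <= X i.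

Definition decomposition : {ffun {set E} -> rat} :=
  [ffun S => (mass c X T (fun S' => (S' == S)%:Z))%:~R / L%:~R].

Lemma decomposition_sum (phi : pred {set E}) :
  \sum_(S | phi S) decomposition S = (mass c X T (fun S => (phi S)%:Z))%:~R / L%:~R.
Proof.
under eq_bigr => S _ do rewrite ffunE.
rewrite -mulr_suml; congr (_ / _).
rewrite -rmorph_sum /mass exchange_big /=; congr (_%:~R); apply: eq_bigr => i _.
rewrite -mulr_sumr; congr (_ * _); rewrite big_mkcond (bigD1 (T i)) //= eqxx big1 ?addr0.
  by case: (phi _).
by move=> S hS; rewrite eq_sym (negbTE hS); case: (phi S).
Qed.

(** For the last condition: every set either meets [P] or misses it, so the mass meeting [P] is [L]
    minus the missed mass. *)
Lemma decomposition_feasible (rho mu : {ffun E -> rat}) :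
  mass c X T (fun=> 1) = L ->
  (forall e, (mass c X T (hit e))%:~R = L%:~R * rho e) ->
  (forall P, P \in PP -> (mass c X T (miss P))%:~R <= L%:~R * \sum_(e in P) mu e) ->
  feasible_decomposition PP rho (fun P => 1 - \sum_(e in P) mu e) decomposition.
Proof.
move=> h1 he hP; have Lr : 0 < L%:~R :> rat by rewrite ltr0z.
have L0 : L%:~R != 0 :> rat by rewrite gt_eqF.
split.
- move=> S; rewrite ffunE divr_ge0 ?ler0z ?(ltW L_gt0) //; apply: sumr_ge0 => i _.
  by rewrite mulr_ge0 ?X_ge0.
- by rewrite decomposition_sum h1 divff.
- by move=> e; rewrite decomposition_sum he mulrC mulKf.
- move=> P PPP; rewrite decomposition_sum ler_pdivlMr // mulrBl mul1r lerBlDr.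
  rewrite [X in _ + X]mulrC; apply: le_trans (lerD (lexx _) (hP P PPP)).
  rewrite -[X in X%:~R <= _]h1.
  rewrite -intrD ler_int -big_split /= ler_sum // => i _; rewrite -mulrDr.
  by rewrite /miss; case: (_ == _).
Qed.

(** As the live sets are distinct, every nonzero entry is the mass of a single index divided by [L],
    and indices of mass 0 contribute nothing. *)
Lemma perm_decomposition :
  (forall a d, (a < d < c)%N -> 0 < X a -> 0 < X d -> T a != T d) ->
  perm_eq [seq (T a, (X a)%:~R / L%:~R) | a <- live X c] (nonzero_entries decomposition).
Proof.
move=> hd; have Lr : 0 < L%:~R :> rat by rewrite ltr0z.
have hd' a d : (a < c)%N -> (d < c)%N -> 0 < X a -> 0 < X d -> T a = T d -> a = d.
  move=> ac dc xa xd; case: (ltngtP a d) => // h /eqP; apply: contraTeq => _.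
    by apply: hd; rewrite ?h.
  by rewrite eq_sym; apply: hd; rewrite ?h.
have inl a : (a \in live X c) = (0 < X a) && (a < c)%N.
  by rewrite mem_filter mem_iota.
have xT a : a \in live X c -> decomposition (T a) = (X a)%:~R / L%:~R.
  rewrite inl ffunE => /andP[xa ac]; congr (_%:~R / _).
  rewrite /mass (bigD1 (Ordinal ac)) //= eqxx mulr1 big1 ?addr0 // => i hi.
  case: eqP => [h|_]; last by rewrite mulr0.
  rewrite mulr1; apply/eqP; rewrite eq_le X_ge0 // andbT leNgt.
  apply/negP => xi; move/negP: hi; apply; apply/eqP/val_inj/hd' => //; exact: ltn_ord.
apply: uniq_perm.
- rewrite map_inj_in_uniq ?filter_uniq ?iota_uniq // => a d.
  rewrite !inl => /andP[xa ac] /andP[xd dc] [h _]; exact: hd'.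
- by rewrite map_inj_uniq; [apply: filter_uniq; exact: enum_uniq | move=> S S' []].
move=> [S v]; apply/mapP/mapP => [[a ha [-> ->]]|[S']].
  exists (T a); last by rewrite xT.
  rewrite mem_filter mem_enum inE andbT xT //; move: ha; rewrite inl => /andP[xa _].
  by rewrite mulf_neq0 ?invr_neq0 ?gt_eqF // ltr0z.
rewrite mem_filter => /andP[hS _] [-> ->].
have [i hi] : exists i : 'I_c, X i * (T i == S')%:Z != 0.
  apply/existsP; apply: contraR hS => /existsPn h; rewrite ffunE /mass big1 ?mul0r //.
  by move=> i _; apply/eqP; rewrite -[_ == _]negbK h.
have eT : T i = S' by apply/eqP; apply: contraNT hi => /negbTE->; rewrite mulr0.
have il : val i \in live X c.
  rewrite inl lt_neqAle X_ge0 ?ltn_ord // !andbT eq_sym.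
  by apply: contraNneq hi => ->; rewrite mul0r.
by exists (val i); rewrite // -eT xT.
Qed.
End Decomposition.

(** * Reading the input *)

Section Input.
Variables rho mu : {ffun E -> rat}.

Definition entries : seq rat := [seq rho e | e <- enum E] ++ [seq mu e | e <- enum E].

Lemma size_entries : size entries = (n + n)%N.
Proof. by rewrite size_cat 2!size_map -cardE. Qed.

Lemma entries_rho e : nth 0 entries (enum_rank e) = rho e.
Proof.
by rewrite nth_cat size_map -cardE ltn_ord (nth_map e) -?cardE ?ltn_ord // nth_enum_rank.
Qed.

Lemma entries_mu e : nth 0 entries (n + enum_rank e) = mu e.
Proof.
rewrite nth_cat size_map -cardE ltnNge leq_addr /= addKn.
by rewrite (nth_map e) -?cardE ?ltn_ord // nth_enum_rank.
Qed.

Lemma flatten_entries :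
  enc_vec rho ++ enc_vec mu = flatten [seq enc_rat q | q <- entries].
Proof. by rewrite /entries map_cat flatten_cat -2!map_comp. Qed.

Lemma nth_enc (s : seq rat) t : (t < size s)%N ->
  nth 0 (flatten [seq enc_rat q | q <- s]) (2 * t) = numq (nth 0 s t) /\
  nth 0 (flatten [seq enc_rat q | q <- s]) (2 * t).+1 = denq (nth 0 s t).
Proof.
elim: s t => [|q s IH] [|t] // ht; rewrite mulnS; exact: (IH t ht).
Qed.

Lemma get_input t : (t < n + n)%N ->
  get (input rho mu) 0 (1 + 2 * t) = numq (nth 0 entries t) /\
  get (input rho mu) 0 (2 + 2 * t) = denq (nth 0 entries t).
Proof.
rewrite -size_entries => /nth_enc[h1 h2].
by rewrite /get /loc /input /= flatten_entries h1 h2.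
Qed.

Lemma encsize_entries :
  encsize (flatten [seq enc_rat q | q <- entries]) = (vsize rho + vsize mu)%N.
Proof. by rewrite -flatten_entries /encsize big_cat. Qed.

Lemma isize_input i : (isize (input rho mu i) <= (isize n + vsize rho + vsize mu)%N)%N.
Proof.
rewrite /input; case: (leqP (size (#|E|%:Z :: enc_vec rho ++ enc_vec mu)) i) => hi.
  by rewrite nth_default // -addnA; apply: leq_trans (leq_addr _ _); rewrite /isize; lia.
have := mem_nth 0 hi; set z := nth _ _ _; rewrite inE => /orP[/eqP->|hz].
  by rewrite -addnA leq_addr.
rewrite -addnA; apply: leq_trans (leq_addl _ _); rewrite /vsize /encsize -big_cat /=.
by rewrite (big_rem z) //= leq_addr.
Qed.

(** Bit lengths add up under multiplication, so the product of the denominators is about as long as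
    the input itself; this is the bound [L0] on the first common denominator. *)
Lemma prod_denq : (`|(\prod_(t < n + n) denq (nth 0 entries t))%R| <= 2 ^ (vsize rho + vsize mu))%N.
Proof.
rewrite -encsize_entries -size_entries; elim: entries => [|q s IH].
  by rewrite big_ord0 absz1 expn_gt0.
rewrite /= big_ord_recl abszM /encsize big_cons big_cons !expnD.
apply: leq_trans (leq_pmull _ _); last by rewrite expn_gt0.
apply: leq_mul IH.
apply: leq_trans (ltnW (pow_isize _)) _.
by rewrite leq_exp2l //; case: (isize _) (isize_gt0 (denq q)).
Qed.
End Input.

Definition coreP : prog := (initP ;; outerP ;; flipP ;; mergeP ;; outP)%P.

(** The last store puts the number of entries where [n] was and so leaves the invariant [st]; it is
    kept apart from [coreP], and its cost is counted separately. *)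
Definition decompP : prog := Seq coreP (Store (Lit 0) (sc xo)).

Lemma pbound_core : (pbound coreP <= kmax)%N.
Proof. by vm_compute. Qed.

(** * Correctness of the whole program *)

Section Core.
Variables rho mu : {ffun E -> rat}.
Hypothesis hPP : weak_mfmc R PP.
Hypothesis rho01 : forall e, 0 <= rho e <= 1.
Hypothesis mu01 : forall e, 0 <= mu e <= 1.
Hypothesis cover : forall P, P \in PP -> 1 - \sum_(e in P) mu e <= \sum_(e in P) rho e.
Let L0 := (2 ^ (vsize rho + vsize mu))%N.
Hypothesis big : (mstep_big ((2 * n.+1 * ((n.+1 * n.+1) ^ n.+1)) ^ n.+1 *
  (2 * (L0 * n.+1 ^ n.+1))) ((n.+1 * n.+1) ^ n.+1) < 2 ^ b)%N.
Hypothesis input_B : (b + vsize rho + vsize mu < B)%N.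
Local Notation ent := (nth 0 (entries rho mu)).

Let L0_gt0 : (0 < L0)%N. Proof. by rewrite /L0 expn_gt0. Qed.

Lemma entries01 t : (t < n + n)%N -> 0 <= ent t <= 1.
Proof.
move=> ht0; have := @mem_nth _ 0 (entries rho mu) t; rewrite size_entries => /(_ ht0).
by rewrite mem_cat => /orP[] /mapP[e _ ->].
Qed.

Lemma st_input : st (input rho mu).
Proof.
split=> // i; apply: leq_trans (isize_input _ _ _) _.
have : (isize n <= b.+1)%N by apply: isize_pow; clear -b_ge; lia.
by clear -input_B; lia.
Qed.

Lemma enum_rank_lt (e : E) : (enum_rank e < n)%N. Proof. exact: ltn_ord. Qed.

Lemma ht_core (Q : memory -> Prop) :
  (forall m (x : {ffun {set E} -> rat}), st m ->
     feasible_decomposition PP rho (fun P => 1 - \sum_(e in P) mu e) x ->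
     perm_eq (output E (write m 0 [:: eval m (sc xo)])) (nonzero_entries x) -> Q m) ->
  ht coreP (input rho mu) Q.
Proof.
move=> HQ; pose L := \prod_(t < n + n) denq (ent t).
have dpos t : 0 < denq (ent t) by exact: denq_gt0.
have Lp : 0 < L by apply: prodr_gt0 => t _; exact: dpos.
have LL0 : (`|L| <= L0)%N by exact: prod_denq.
have Lrp : 0 < L%:~R :> rat by rewrite ltr0z.
have frac t : (t < n + n)%N ->
    (numq (ent t) * (L %/ denq (ent t))%Z)%:~R = L%:~R * ent t.
  move=> ht0; have dL : (denq (ent t) %| L)%Z.
    by rewrite /L (bigD1 (Ordinal ht0)) //= dvdz_mulr.
  have -> : L%:~R = (L %/ denq (ent t))%Z%:~R * (denq (ent t))%:~R :> rat.
    by rewrite -intrM divzK.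
  rewrite -mulrA [_ * ent t]mulrC -[X in X * _%:~R]divq_num_den divfK ?intr_eq0 ?denq_neq0 //.
  by rewrite mulrC intrM.
apply: ht_seq; apply: (ht_init (num := fun t => numq (ent t))
  (den := fun t => denq (ent t))) => //.
- exact: st_input.
- by move=> t; exact: get_input.
- move=> t ht0; split; first exact: dpos.
  have /andP[h0 h1] := entries01 ht0; rewrite numq_ge0 h0 /=.
  by move: h1; rewrite -{1}[ent t]divq_num_den ler_pdivrMr ?ltr0z // mul1r ler_int.
- apply: leq_ltn_trans (V0_lt big); rewrite mulnC leq_mul2l /=; apply: (leq_trans LL0).
  by rewrite leq_pmulr // expn_gt0.
move=> m1 s1 hn hL hR hW hWn hM hD hP.
pose y t := ent t + ent (n + t)%N; pose rh t := ent t.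
have y2 e : (e < n)%N -> y e <= 2%:R.
  move=> en; have /andP[_ h1] := entries01 (ltn_addr n en).
  have := @entries01 (n + e)%N; rewrite ltn_add2l => /(_ en) /andP[_ h2].
  by rewrite (natrD _ 1 1) lerD.
have rh01 e : (e < n)%N -> 0 <= rh e <= 1 by move=> en; exact: entries01 (ltn_addr n en).
have wy e : (e < n)%N -> (get m1 vW e)%:~R = L%:~R * y e.
  by move=> en; rewrite hW // intrD !frac ?ltn_add2l ?ltn_addr // -mulrDr.
have w0 i : (i <= n)%N -> 0 <= get m1 vW i.
  rewrite leq_eqVlt => /orP[/eqP->|hi]; first by rewrite hWn ltW.
  rewrite -(ler0z rat) wy // mulr_ge0 ?(ltW Lrp) // addr_ge0 //.
    by case/andP: (entries01 (ltn_addr n hi)).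
  by have := @entries01 (n + i)%N; rewrite ltn_add2l => /(_ hi) /andP[].
(* At the start [M] is empty, with the identity as projection, and the all-ones row is pending. That
   [w] lies in the cone is the hypothesis [cover]. *)
have I0 : outerI y rh L0 0 m1.
  exists L, (get m1 vW), 0%N; split=> //.
  - by rewrite muln1.
  - split=> //; apply/andP; split.
      by apply/forallP => i; rewrite w0 // -ltnS.
    apply/forall_inP => P PPP; rewrite hWn -(ler_int rat) rmorph_sum /=.
    rewrite (eq_bigr (fun e => L%:~R * (rho e + mu e))); last first.
      by move=> e _; rewrite wy ?enum_rank_lt // /y entries_rho entries_mu.
    rewrite -mulr_sumr ler_peMr ?(ltW Lrp) // big_split /=.
    by have := cover PPP; rewrite lerBlDr.
  - split=> //; first by rewrite big_ord0 add0r.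
    + by move=> e en; rewrite big_ord0 add0r wy.
    + by move=> e en; rewrite hR // frac // ltn_addr.
  right; split.
    rewrite big_ord_recr /= hWn ltr_wpDl // sumr_ge0 // => i _.
    by rewrite w0 // ltnW.
  exists 0%N, 0, 1, (fun=> 1); split=> //; split=> //.
  - by rewrite hM; exact: projm0.
  - by case.
  - split=> //; split; first by move=> i _; rewrite normr1.
    by left.
  - rewrite hM mul1mx; split.
      apply/eqP => /matrixP /(_ ord0 ord0); rewrite !mxE.
      by move/eqP; rewrite oner_eq0.
    by exists (rshift 0 ord0) => j; rewrite col_mxEd mxE.
apply: ht_seq.
apply: (ht_outer y2 rh01 hPP L0_gt0 big s1 I0).
move=> m2 c L' s2 hc cn hL2 L2b hrec.
have [[L'p L's] r2 r3 r4 r5] := hrec.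
have L'rp : 0 < L'%:~R :> rat by rewrite ltr0z.
have g2 : good L' c m2.
  split=> // i ic; split; first exact: (recs_boundX hrec).
  by case: (r4 i ic).
have mass2 : mass c (get m2 vX) (tset m2) (fun=> 1) = L'.
  by rewrite L's addr0; apply: eq_bigr => i _; rewrite mulr1.
have Re2 e : (get m2 vR (enum_rank e))%:~R = L'%:~R * rho e.
  by rewrite r3 ?enum_rank_lt // /rh entries_rho.
apply: ht_seq; apply: (ht_flip (L := L') (c0 := c)
  (Re := fun e => get m2 vR (enum_rank e))) => //.
  move=> e; rewrite -(ler0z rat) -(ler_int rat) Re2; have /andP[h0 h1] := rho01 e.
  by rewrite mulr_ge0 ?(ltW L'rp) //= ler_piMr ?(ltW L'rp).
move=> m3 c3 s3 f3 g3 cn3 mass3 hit3 miss3.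
apply: ht_seq; apply: (ht_merge (L := L') (c := c3)) => //.
move=> m4 s4 f4 g4 mass4 dist4.
apply: (ht_out (L := L') (c := c3)) => //; first by frs.
move=> m5 s5 s hs ho; have [_ g4'] := g4.
apply: (HQ m5 (decomposition c3 (get m4 vX) (tset m4) L')) => //.
  apply: decomposition_feasible => //.
  - by move=> i ic; case: (g4' i ic) => /andP[].
  - by rewrite mass4.
  - by move=> e; rewrite mass4 hit3.
  - move=> P PPP; rewrite mass4; have := miss3 P PPP; rewrite -(ler_int rat).
    (* Before the flips a set can miss [P] only if it has mass 0. *)
    have -> : mass c (get m2 vX) (tset m2) (miss P) = 0.
      rewrite /mass big1 // => i _; have [/andP[X0 _] _] := (proj2 g2) i (ltn_ord i).
      have [Xp|] := ltP 0 (get m2 vX i); last first.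
        by move=> Xn; have -> : get m2 vX i = 0 by apply/eqP; rewrite eq_le X0 Xn.
      have [e eP] := r5 i (ltn_ord i) Xp P PPP.
      rewrite /bits (bit_hit e g2 (ltn_ord i)) /hit /miss => he.
      case: eqP => [h|_]; last by rewrite mulr0.
      move/setP: h => /(_ e); rewrite in_setI in_set0 eP andbT => h.
      by rewrite h in he.
    rewrite add0r => h; apply: (le_trans h); rewrite rmorph_sum mulr_sumr /=.
    apply: ler_sum => e _; have /andP[mu0 _] := mu01 e.
    (* The recorded sets cover [e] with mass at most [L'] times [rho e + mu e], so the excess over
       [rho e] is at most [L'] times [mu e]. *)
    rewrite /excess; case: ifP => _; last by rewrite mulr_ge0 ?(ltW L'rp).
    rewrite intrB Re2 lerBlDl -mulrDr.
    have := r2 _ (enum_rank_lt e); rewrite addr0 /y entries_rho entries_mu.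
    congr (_%:~R <= _); apply: eq_bigr => i _.
    by rewrite /bits (bit_hit e g2 (ltn_ord i)).
set m6 := write _ _ _.
have e6 i : m6 i.+1 = m5 i.+1 by rewrite /m6 writeE.
have -> : output E m6 = [seq (tset m4 a, (get m4 vX a)%:~R / L'%:~R) | a <- s].
  rewrite -[in RHS](mkseq_nth 0%N s) /mkseq -map_comp /output.
  have -> : `|m6 0%N|%N = size s by rewrite /m6 writeE eqxx (ev_sc _ s5) hs.
  apply/eq_in_map => a; rewrite mem_iota /= => sa; have [h1 h2 h3] := ho a sa.
  rewrite /= -h3; congr (_, _).
  by rewrite /rat_at add1n !e6 -h1 -h2 add1n.
by apply: perm_decomposition => // i ic; case: (g4' i ic) => /andP[].
Qed.
End Core.
End Machine.

(** * Polynomial bounds *)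

(* All numbers of the run have at most that many bits. *)
Definition bound (x : nat) : nat := (25 * x.+1 ^ 3)%N.

(** Every factor is bounded by a power of 2, and the exponents add up. The cubic term comes from the
    walk: its growth factor per step has about [2 * N ^ 2] bits and is raised to the power [N]. *)
Lemma mstep_big_lt (E : finType) (V : nat) (x : nat) : (nelts E + V <= x)%N ->
  forall N, N = (nelts E).+1 ->
  (mstep_big E ((2 * N * (N * N) ^ N) ^ N * (2 * (2 ^ V * N ^ N))) ((N * N) ^ N) < 2 ^ bound x)%N.
Proof.
move=> hx N eN; rewrite /mstep_big -eN; set Db := ((N * N) ^ N)%N.
set Vb := ((2 * N * Db) ^ N * _)%N.
have pw y k : (y <= 2 ^ k)%N -> (y + 1 <= 2 ^ k.+1)%N.
  by move=> h; rewrite expnS mul2n -addnn leq_add // expn_gt0.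
have N1 : (0 < N)%N by rewrite eN.
have N2 : (N <= 2 ^ N)%N by apply: ltnW; exact: ltn_expl.
have NN : (N ^ N <= 2 ^ (N * N))%N by rewrite expnM leq_exp2r.
have D2 : (Db <= 2 ^ (2 * N * N))%N.
  rewrite -mulnA mul2n -addnn expnD /Db expnMn; exact: leq_mul.
have V2 : (Vb <= 2 ^ ((1 + N + 2 * N * N) * N + (1 + (V + N * N))))%N.
  rewrite /Vb (expnD 2 (_ * _)) (expnD 2 1) (expnD 2 V) expnM.
  by rewrite leq_mul ?leq_mul // leq_exp2r // !expnD !leq_mul.
have h1 : ((N * (Db * Db)) ^ 2 + 1 <= 2 ^ ((N + (2 * N * N + 2 * N * N)) * 2).+1)%N.
  by apply: pw; rewrite expnM leq_exp2r // !expnD !leq_mul.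
have h2 := leq_mul N2 V2; rewrite -expnD in h2.
move/pw: h2 => h2; have h3 := pw _ _ D2; have := leq_mul (leq_mul h1 h2) h3.
rewrite -!expnD => h; apply: leq_ltn_trans h _; rewrite ltn_exp2l // /bound.
have Nx : (N <= x.+1)%N by rewrite eN ltnS (leq_trans (leq_addr _ _) hx).
have Vx : (V <= x)%N by rewrite (leq_trans (leq_addl _ _) hx).
clear -Nx Vx N1; move: Nx N1 => Nx N1.
have e3 : (N * N * N <= x.+1 ^ 3)%N by rewrite !expnS expn0 muln1 mulnA !leq_mul.
have e2 : (N * N <= x.+1 ^ 3)%N by apply: leq_trans e3; exact: leq_pmulr.
have e1 : (x.+1 <= x.+1 ^ 3)%N by rewrite -[leqLHS]expn1 leq_pexp2l.
set d := (X in (X < _)%N).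
(* Each monomial, as well as 1, is at most [x.+1 ^ 3], and the coefficients sum to 23, below the 25
   in [bound]. *)
have -> : d = (2 * (N * N * N) + 12 * (N * N) + 4 * N + V + 4)%N by rewrite /d; ring.
move: (x.+1 ^ 3)%N (N * N * N)%N (N * N)%N e3 e2 e1 => y y3 y2; clear -Nx Vx; lia.
Qed.

(** For a fixed program [kost] is a polynomial in the loop bound, which is in turn a polynomial in
    the size of the instance and [TY]. *)
Fixpoint kostp (B : {poly nat}) (c : prog) : {poly nat} :=
  match c with
  | Seq c d | If _ c d => 1 + kostp B c + kostp B d
  | While _ c => 1 + (1 + kostp B c) * B
  | _ => 1
  end.

Lemma horner_kostp B c z : (kostp B c).[z] = kost B.[z] c.
Proof.
have h1 : (1 : {poly nat}).[z] = 1 by exact: hornerC.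
by elim: c => //= [c IHc d IHd|_ c IHc d IHd|_ c IHc];
  rewrite ?(hornerM, hornerD, h1) ?IHc ?IHd.
Qed.

Theorem theorem2 (R : realType) :
  exists (c : prog) (p q : {poly nat}),
  forall (E : finType) (PP : {set {set E}}) (O : oracle E)
         (rho mu : {ffun E -> rat}) (TY : nat),
    weak_mfmc R PP ->
    separation_oracle R PP O ->
    (forall e, 0 <= rho e <= 1) ->
    (forall e, 0 <= mu e <= 1) ->
    let ppi : {set E} -> rat := fun P => 1 - \sum_(e in P) mu e in
    (forall P, P \in PP -> ppi P <= \sum_(e in P) rho e) ->
    (forall y : {ffun E -> rat},
       (vsize y <= q.[#|E| + vsize mu + vsize rho])%N -> (otime O y <= TY)%N) ->
    exists (x : {ffun {set E} -> rat}) (m : memory) (t : nat),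
      [/\ feasible_decomposition PP rho ppi x,
          exec O c (input rho mu) m t,
          perm_eq (output E m) (nonzero_entries x)
        & (t <= p.[TY + #|E| + vsize mu + vsize rho])%N].
Proof.
have horner_nat (k z : nat) : k%:R%:P.[z] = k by rewrite hornerC natn.
have [bp bpE] : exists bp : {poly nat}, forall z, bp.[z] = bound z.
  exists (25%:R%:P * ('X + 1%:R%:P) * ('X + 1%:R%:P) * ('X + 1%:R%:P)) => z.
  rewrite !hornerM !hornerD !horner_nat hornerX.
  by rewrite (_ : z + 1 = z.+1) 1?[LHS]/(25 * z.+1 * z.+1 * z.+1)%N /bound ?expnSr ?expn1 ?mulnA // -addn1.
have [Bp BpE] : exists Bp : {poly nat}, forall z, Bp.[z] = (bound z + 20 * z + (101 + kmax))%N.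
  by exists (bp + 20%:R%:P * 'X + (101 + kmax)%:R%:P) => z; rewrite !hornerD hornerM !horner_nat hornerX bpE.
(* The second polynomial is the query size [2 * n * (b + 1)] from [vsize_frac]; in the first one
   [kmax + 2] pays for the final store. *)
exists decompP, ((kostp Bp coreP + (kmax + 2)%:R%:P) * (Bp * Bp)), (2%:R%:P * 'X * (bp + 1%:R%:P)).
move=> E PP O rho mu TY hPP HO rho01 mu01 ppi cover.
rewrite !hornerM hornerD hornerX bpE !horner_nat hornerD horner_kostp horner_nat BpE.
set x0 := (#|E| + vsize mu + vsize rho)%N.
set z := (TY + #|E| + vsize mu + vsize rho)%N => Hq.
have zE : z = (TY + x0)%N by rewrite /z /x0 !addnA.
(* [TY] enters [B] but not [b]: the size of the queries must be settled before [TY] says anything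
   about the oracle. *)
set b := bound x0; set B := (bound z + 20 * z + (101 + kmax))%N.
have bz : (b <= bound z)%N by rewrite /b /bound leq_mul2l /= leq_exp2r // zE ltnS leq_addl.
have x0E : x0 = (nelts E + (vsize mu + vsize rho))%N by rewrite addnA.
have bB : (b < B)%N by rewrite /B; clear -bz; lia.
have B_ge : (100 + kmax + 20 * nelts E <= B)%N.
  by rewrite /B; clear -zE x0E; lia.
have cube (y : nat) : (y.+1 * y.+1 <= bound y)%N.
  by rewrite /bound !expnS expn0 muln1; nia.
have bge (y k : nat) : (k < y)%N -> (k < 2 ^ y)%N.
  by move=> h; apply: ltn_trans h _; exact: ltn_expl.
have nx0 : (nelts E <= x0)%N by rewrite x0E leq_addr.
have nn : ((nelts E).+1 * (nelts E).+1 <= b)%N.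
  by apply: leq_trans (cube x0); rewrite leq_mul.
have nnB : ((nelts E).+1 * (nelts E).+1 <= B)%N.
  exact: leq_trans nn (ltnW bB).
have nnb : ((nelts E).+1 * (nelts E).+1 < 2 ^ b)%N.
  exact: leq_ltn_trans nn (ltn_expl _ _).
have b_ge : (2 * nelts E + 4 < 2 ^ b)%N.
  apply: leq_ltn_trans (ltn_expl b _) => //.
  by rewrite /b /bound !expnS expn0 muln1; clear -nx0; nia.
have Hq' (y : {ffun E -> rat}) : (vsize y <= 2 * nelts E * b.+1)%N ->
    (20 * nelts E + otime O y + (100 + kmax) <= B)%N.
  move=> hy; have hT : (otime O y <= TY)%N.
    apply: Hq; apply: (leq_trans hy); rewrite -[leqRHS]/(2 * x0 * (b + 1))%N addn1.
    by rewrite leq_mul2r leq_mul2l nx0 orbT.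
  by rewrite /B; clear -hT zE nx0; lia.
have xV : (nelts E + (vsize rho + vsize mu) <= x0)%N by rewrite x0E; clear; lia.
have big := mstep_big_lt xV erefl.
have input_B : (b + vsize rho + vsize mu < B)%N by rewrite /B; clear -bz zE x0E; lia.
pose Q m := exists2 x, feasible_decomposition PP rho ppi x &
  perm_eq (output E (write m 0 [:: eval m (sc xo)])) (nonzero_entries x).
have [|m [sm [x fx px] hm]] := ht_core bB B_ge b_ge HO Hq' nnB nnb hPP rho01 mu01 cover
  big input_B (Q := Q); first by move=> m x _ fx px; exists x.
have [t et tB] := hm pbound_core.
exists x, (write m 0 [:: eval m (sc xo)]), (1 + t + (1 + eval_cost m (Lit 0) +
  eval_cost m (sc xo) + isize (eval m (Lit 0)) + isize (eval m (sc xo))))%N; split=> //.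
  exact: exec_seq et (exec_store O (Lit 0) (sc xo) m).
have pb : (pbound (Store (Lit 0) (sc xo)) <= kmax)%N by vm_compute.
have B0 : (0 < B)%N by exact: leq_ltn_trans bB.
apply: (@leq_trans ((kost B coreP + (kmax + 2)) * (B * B))); last exact: leqnn.
have h1 := cboundP B0 (proj2 sm) (sc xo); have h2 := vboundP B0 (proj2 sm) (sc xo).
have h3 := cboundP B0 (proj2 sm) (Lit 0); have h4 := vboundP B0 (proj2 sm) (Lit 0).
move: pb; rewrite [pbound _]/(_ + _ + _ + _ + _)%N => pb.
move: tB B0 pb h1 h2 h3 h4; rewrite /tick; clear.
move: (kost B coreP) (cbound _) (vbound _) (cbound _) (vbound _) (eval_cost _ _) (eval_cost _ _)
  (isize _) (isize _) => k c1 v1 c2 v2 e1 e2 i1 i2.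
nia.
Qed.
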